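(* Let $\vec{p}=(p_1,p_2)$ and $\vec{q}=(q_1,q_2)$ satisfy $1<p_-\le p_+\le q_-\le q_+<\infty$, and let $\vec a,\vec b,\vec c\in\mathbb{R}^2$, $\vec\alpha,\vec\beta\in(-1,\infty)^2$. Then the following are equivalent: (1) $S_{\vec a,\vec b,\vec c}$ is bounded from $L^{\vec p}_{\vec\alpha}(T_B\times T_B)$ to $L^{\vec q}_{\vec\beta}(T_B\times T_B)$; (2) $T_{\vec a,\vec b,\vec c}$ is bounded from $L^{\vec p}_{\vec\alpha}(T_B\times T_B)$ to $L^{\vec q}_{\vec\beta}(T_B\times T_B)$; (3) for each $i\in\{1,2\}$: $-q_ia_i<\beta_i+1$, $\alpha_i+1<p_i(b_i+1)$, and $c_i=n+1+a_i+b_i+\lambda_i$, where $\lambda_i=\frac{n+1+\beta_i}{q_i}-\frac{n+1+\alpha_i}{p_i}$.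
   Context: Let $n$ be a positive integer. For $z=(z_1,\dots,z_n)\in\mathbb{C}^n$ write $z=x+iy$ with $x,y\in\mathbb{R}^n$, $z'=(z_1,\dots,z_{n-1})$, $y'=(y_1,\dots,y_{n-1})$. Let $B=\{y\in\mathbb{R}^n: |y'|^2<y_n\}$ and $T_B=\{x+iy: x\in\mathbb{R}^n, y\in B\}$. For $z\in T_B$ put $\rho(z)=y_n-|y'|^2>0$, and for $z,u\in T_B$ put $\rho(z,u)=\frac14\big(\sum_{j=1}^{n-1}(z_j-\overline{u_j})^2-2i(z_n-\overline{u_n})\big)$; this has positive real part, and complex powers $\rho(z,u)^c$ are taken with the principal branch. $dV$ is Lebesgue measure on $\mathbb{C}^n$ and $dV_\alpha(z)=\rho(z)^\alpha dV(z)$. For $\vec p=(p_1,p_2)\in[1,\infty]^2$ and $\vec\alpha=(\alpha_1,\alpha_2)$, $L^{\vec p}_{\vec\alpha}(T_B\times T_B)$ is the space of measurable $f$ on $T_B\times T_B$ with finite mixed norm $\|f\|_{\vec p,\vec\alpha}=\big\{\int_{T_B}\big(\int_{T_B}|f(z,w)|^{p_1}dV_{\alpha_1}(z)\big)^{p_2/p_1}dV_{\alpha_2}(w)\big\}^{1/p_2}$, with the inner (resp. outer) integral replaced by an essential supremum in $z$ (resp. $w$) when $p_1=\infty$ (resp. $p_2=\infty$); when $\vec p=(\infty,\infty)$ this is $L^\infty(T_B\times T_B)$. Write $p_-=\min\{p_1,p_2\}$, $p_+=\max\{p_1,p_2\}$, and similarly $q_\pm$. For $\vec a=(a_1,a_2),\vec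 b=(b_1,b_2),\vec c=(c_1,c_2)\in\mathbb{R}^2$, $T_{\vec a,\vec b,\vec c}f(z,w)=\rho(z)^{a_1}\rho(w)^{a_2}\int_{T_B}\int_{T_B}\frac{\rho(u)^{b_1}\rho(\eta)^{b_2}}{\rho(z,u)^{c_1}\rho(w,\eta)^{c_2}}f(u,\eta)\,dV(u)\,dV(\eta)$ and $S_{\vec a,\vec b,\vec c}f(z,w)=\rho(z)^{a_1}\rho(w)^{a_2}\int_{T_B}\int_{T_B}\frac{\rho(u)^{b_1}\rho(\eta)^{b_2}}{|\rho(z,u)|^{c_1}|\rho(w,\eta)|^{c_2}}f(u,\eta)\,dV(u)\,dV(\eta)$. An operator is bounded from $X$ to $Y$ if for every $f\in X$ the defining integral converges for a.e. $(z,w)$ and $\|Tf\|_Y\le C\|f\|_X$ with $C$ independent of $f$. *)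

(* Defs.v *)
From mathcomp Require Import all_boot all_algebra.
From mathcomp Require Import complex.
From mathcomp Require Import all_classical all_reals all_analysis.
Import GRing.Theory Num.Theory.

Set Implicit Arguments.
Unset Strict Implicit.
Unset Printing Implicit Defensive.

Local Open Scope ring_scope.
Local Open Scope complex_scope.

Section TubeDomain.
Variable R : realType.

(** ** Points of C^n.  A point z = x + i y of C^n is the pair (x, y) of real
    n-tuples; coordinate j (0-based) is z_j = x_j + i y_j.  The type carries
    the product of the (Borel) coordinate sigma-algebras. *)
Definition pt (n : nat) := (n.-tuple R * n.-tuple R)%type.

Definition coord (n : nat) (z : pt n) (j : nat) : R[i] :=
  (nth 0 z.1 j) +i* (nth 0 z.2 j).

(** rho(z) = y_n - |y'|^2  (y_n is the last coordinate, index n-1). *)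
Definition rho (n : nat) (z : pt n) : R :=
  nth 0 z.2 n.-1 - \sum_(j < n.-1) (nth 0 z.2 j) ^+ 2.

(** z is in T_B iff y is in B iff rho(z) > 0. *)
Definition inTB (n : nat) (z : pt n) : bool := 0 < rho z.

(** rho(z,u) = 1/4 ( sum_{j<n-1} (z_j - conj u_j)^2 - 2 i (z_n - conj u_n) ). *)
Definition rho2 (n : nat) (z u : pt n) : R[i] :=
  (4%:R)^-1 * (\sum_(j < n.-1) (coord z j - (coord u j)^*) ^+ 2
               - 2%:R * 'i * (coord z n.-1 - (coord u n.-1)^*)).

(** modulus of a complex number *)
Definition cmod (w : R[i]) : R := Num.sqrt (complex.Re w ^+ 2 + complex.Im w ^+ 2).

(** principal argument, with values in (-pi, pi] *)
Definition Arg (w : R[i]) : R :=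
  if 0 < complex.Re w then atan (complex.Im w / complex.Re w)
  else if complex.Re w < 0 then
    (if 0 <= complex.Im w then atan (complex.Im w / complex.Re w) + pi else atan (complex.Im w / complex.Re w) - pi)
  else if 0 < complex.Im w then pi / 2
  else if complex.Im w < 0 then - (pi / 2) else 0.

(** principal branch of the complex power w^c = exp(c Log w), c real
    (0^c is set to 0; it never occurs since Re rho(z,u) > 0 on T_B). *)
Definition cpow (w : R[i]) (c : R) : R[i] :=
  if w == 0 then 0
  else ((cmod w) `^ c)%:C * (cos (c * Arg w) +i* sin (c * Arg w)).

(** ** Lebesgue integration of nonnegative functions on R^m, as iterated
    one-dimensional Lebesgue integrals (by Tonelli this is the integral
    against m-dimensional Lebesgue measure for measurable integrands). *)
Fixpoint iint (m : nat) : (m.-tuple R -> \bar R) -> \bar R :=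
  match m return (m.-tuple R -> \bar R) -> \bar R with
  | 0 => fun g => g [tuple]
  | m'.+1 => fun g =>
      (\int[@lebesgue_measure R]_(t in setT)
         iint (fun v : m'.-tuple R => g (cons_tuple t v)))%E
  end.

(** integral against dV (Lebesgue measure on C^n = R^{2n}) *)
Definition intV (n : nat) (g : pt n -> \bar R) : \bar R :=
  iint (fun x : n.-tuple R => iint (fun y : n.-tuple R => g (x, y))).

(** integral over T_B against dV_alpha = rho^alpha dV *)
Definition intTB (n : nat) (alpha : R) (g : pt n -> \bar R) : \bar R :=
  intV (fun z => if inTB z then ((rho z `^ alpha)%:E * g z)%E else 0%E).

(** ** Mixed norm  ||h||_{(p1,p2),(a1,a2)}  for finite exponents, of a
    function h(z,w) on T_B x T_B (z inner variable, w outer variable). *)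
Definition mixnorm (n : nat) (p1 p2 a1 a2 : R) (h : pt n -> pt n -> R[i])
  : \bar R :=
  (intTB a2 (fun w =>
     (intTB a1 (fun z => ((cmod (h z w)) `^ p1)%:E)) `^ (p2 / p1))
   `^ (p2^-1))%E.

(** measurability of a complex function on C^n x C^n (real and imaginary
    parts measurable for the product sigma-algebra) *)
Definition cmeasurable (n : nat) (f : pt n -> pt n -> R[i]) : Prop :=
  measurable_fun setT (fun zw : pt n * pt n => complex.Re (f zw.1 zw.2)) /\
  measurable_fun setT (fun zw : pt n * pt n => complex.Im (f zw.1 zw.2)).

(** f belongs to L^{(p1,p2)}_{(a1,a2)}(T_B x T_B) *)
Definition inL (n : nat) (p1 p2 a1 a2 : R) (f : pt n -> pt n -> R[i]) : Prop :=
  cmeasurable f /\ (mixnorm p1 p2 a1 a2 f < +oo)%E.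

(** ** Integrals over T_B x T_B (against dV(u) dV(eta), unweighted) *)
Definition intTB2 (n : nat) (G : pt n -> pt n -> \bar R) : \bar R :=
  intTB 0 (fun eta => intTB 0 (fun u => G u eta)).

(** Lebesgue integral of a real integrable function over T_B x T_B:
    integral of the positive part minus integral of the negative part. *)
Definition rint2 (n : nat) (g : pt n -> pt n -> R) : R :=
  fine (intTB2 (fun u eta => (Num.max (g u eta) 0)%:E))
  - fine (intTB2 (fun u eta => (Num.max (- g u eta) 0)%:E)).

(** complex integral over T_B x T_B *)
Definition cint2 (n : nat) (g : pt n -> pt n -> R[i]) : R[i] :=
  (rint2 (fun u eta => complex.Re (g u eta))) +i* (rint2 (fun u eta => complex.Im (g u eta))).

(** the defining integral converges (absolutely, i.e. Lebesgue) *)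
Definition converges (n : nat) (g : pt n -> pt n -> R[i]) : Prop :=
  (intTB2 (fun u eta => (cmod (g u eta))%:E) < +oo)%E.

(** Integral operator with kernel K(z,w,u,eta) and outer factor
    rho(z)^a1 rho(w)^a2:
    (Op f)(z,w) = rho(z)^a1 rho(w)^a2 \int\int K(z,w,u,eta) f(u,eta) dV dV. *)
Definition intop (n : nat) (a1 a2 : R) (K : pt n -> pt n -> pt n -> pt n -> R[i])
  (f : pt n -> pt n -> R[i]) (z w : pt n) : R[i] :=
  ((rho z `^ a1) * (rho w `^ a2))%:C * cint2 (fun u eta => K z w u eta * f u eta).

(** kernel of T_{a,b,c} *)
Definition kerT (n : nat) (b1 b2 c1 c2 : R) (z w u eta : pt n) : R[i] :=
  ((rho u `^ b1) * (rho eta `^ b2))%:C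
  / (cpow (rho2 z u) c1 * cpow (rho2 w eta) c2).

(** kernel of S_{a,b,c} *)
Definition kerS (n : nat) (b1 b2 c1 c2 : R) (z w u eta : pt n) : R[i] :=
  ((rho u `^ b1) * (rho eta `^ b2)
   / ((cmod (rho2 z u)) `^ c1 * (cmod (rho2 w eta)) `^ c2))%:C.

Definition opT (n : nat) (a1 a2 b1 b2 c1 c2 : R) :=
  @intop n a1 a2 (kerT b1 b2 c1 c2).
Definition opS (n : nat) (a1 a2 b1 b2 c1 c2 : R) :=
  @intop n a1 a2 (kerS b1 b2 c1 c2).

(** null sets of C^n x C^n (for Lebesgue measure dV x dV) *)
Definition null2 (n : nat) (N : set (pt n * pt n)) : Prop :=
  measurable N /\
  intV (fun w => intV (fun z => (\1_N (z, w) : R)%:E)) = 0%E.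

(** Boundedness of the integral operator from L^p_alpha to L^q_beta:
    for every f in L^p_alpha the defining integral converges for a.e.
    (z,w) in T_B x T_B and ||Op f|| <= C ||f|| with C independent of f. *)
Definition bounded_op (n : nat) (a1 a2 : R)
  (K : pt n -> pt n -> pt n -> pt n -> R[i])
  (p1 p2 al1 al2 q1 q2 be1 be2 : R) : Prop :=
  exists C : R, forall f : pt n -> pt n -> R[i],
    inL p1 p2 al1 al2 f ->
    (exists N : set (pt n * pt n), null2 N /\
       forall z w : pt n, inTB z -> inTB w -> ~ N (z, w) ->
         converges (fun u eta => K z w u eta * f u eta)) /\
    (mixnorm q1 q2 be1 be2 (intop a1 a2 K f)
       <= C%:E * mixnorm p1 p2 al1 al2 f)%E.

(** condition (3) for one index i *)
Definition cond3 (n : nat) (p q a b c al be : R) : Prop :=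
  - (q * a) < be + 1 /\ al + 1 < p * (b + 1) /\
  c = n%:R + 1 + a + b + ((n%:R + 1 + be) / q - (n%:R + 1 + al) / p).

End TubeDomain.

(* Main.v *)
Require Import Defs.
From HB Require Import structures.
From mathcomp Require Import all_boot all_order all_algebra.
From mathcomp Require Import complex.
From mathcomp Require Import all_classical all_reals all_analysis.
From mathcomp Require Import measurable_realfun ring lra.
Import Order.TTheory GRing.Theory Num.Theory.
Import numFieldNormedType.Exports.
Set Implicit Arguments.
Unset Strict Implicit.
Unset Printing Implicit Defensive.
Local Open Scope classical_set_scope.
Local Open Scope ring_scope.

(* Sufficiency: |rho(z,u)| dominates, up to a constant, each of rho(z) + rho(u),
   (rho(z)^(1/2) + |x_j|)^2, (rho(z)^(1/2) + |y_j|)^2 and rho(z) + |Re u_n - sigma|,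
   where x_j, y_j are the real and imaginary parts of u_j - z_j for j < n, and
   sigma depends only on z and u_1, ..., u_(n-1). A negative power of |rho(z,u)|
   is thus bounded by a product of functions of one real variable, which gives the
   Forelli-Rudin estimate. Schur's test with powers of rho then bounds the operator
   in each variable from L^p to L^q, and Minkowski's inequality combines the two
   bounds.
   Necessity: let f be a product of powers of rho cut off to boxes of size s, s^2,
   with rho(u), rho(z) at most 2 M s^2 and one of them at least M s^2, for a large
   constant M. There rho(z,u) is comparable to s^2 and nearly real, so that the
   modulus and the real part of either kernel are comparable, and boundedness turns
   into an inequality between explicit integrals of powers. Scaling the box forces
   the homogeneity relation; moving the cutoff to the boundary rho = 0 forces the
   two integrability conditions. *)

(** * Integration over the tube domain *)

(** The kernels of S and T have the same modulus, a product of a function of (z, u) and one of (w,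
    eta). Both equivalences are therefore instances of one statement about an abstract kernel with
    this modulus and with small phase where both factors are nearly real; the principal branch of
    the powers enters only in the verification of these two properties for T. The one-variable
    integrals decouple because the shifted real part of u_n and rho(u) can replace the last two real
    coordinates of u without changing the volume: each is a translation once the other coordinates
    are fixed. In the necessity part, cancellation in T is the obstacle. It is excluded as soon as
    one of rho(z), rho(u) is large compared with s^2, so the other may tend to 0; this freedom gives
    one integrability condition for each of the two roles. *)

Section lower_integral.
Context d (T : measurableType d) (R : realType).
Variable mu : {measure set T -> \bar R}.
Local Open Scope ereal_scope.

(** The integral of a nonnegative function is a supremum over the simple functions below it, so it
    is monotone for arbitrary functions. This is what allows images under [intop] to be compared
    with measurable functions. *)
Lemma le_integralT (f g : T -> \bar R) : (forall x, 0 <= f x) ->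
  (forall x, f x <= g x) -> \int[mu]_x f x <= \int[mu]_x g x.
Proof.
move=> f0 fg; rewrite !ge0_integralTE//; last first.
  by move=> x; exact: le_trans (f0 x) (fg x).
apply: le_ereal_sup => _ [h /= hf <-]; exists h => // x.
exact: le_trans (hf x) (fg x).
Qed.

Lemma le_integralD (D : set T) (f g : T -> \bar R) :
  (forall x, D x -> 0 <= f x) -> (forall x, D x -> f x <= g x) ->
  \int[mu]_(x in D) f x <= \int[mu]_(x in D) g x.
Proof.
move=> f0 fg; rewrite !(integral_mkcond D); apply: le_integralT => x.
  exact: erestrict_ge0.
by rewrite !patchE; case: ifPn => // /[!inE]; exact: fg.
Qed.

End lower_integral.

Section iterated.
Context {R : realType}.
Local Open Scope ereal_scope.

Lemma iint_ge0 m (g : m.-tuple R -> \bar R) : (forall v, 0 <= g v) -> 0 <= iint g.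
Proof.
by elim: m g => [|m IH] g g0 //=; apply: integral_ge0 => t _; exact: IH.
Qed.

Lemma le_iint m (f g : m.-tuple R -> \bar R) : (forall v, 0 <= f v) ->
  (forall v, f v <= g v) -> iint f <= iint g.
Proof.
elim: m f g => [|m IH] f g f0 fg //=; apply: le_integralT => t.
  exact: iint_ge0.
exact: IH.
Qed.

Lemma eq_iint m (f g : m.-tuple R -> \bar R) : f =1 g -> iint f = iint g.
Proof. by move=> /funext->. Qed.

End iterated.

(* The library's instance of [\x] as a sigma-finite measure is shadowed by its
   instance for subprobabilities, so it is not found by unification. *)
Section sigma_finite_product.
Context d1 d2 (T1 : measurableType d1) (T2 : measurableType d2) (R : realType).
Variables (m1 : {sigma_finite_measure set T1 -> \bar R})
          (m2 : {sigma_finite_measure set T2 -> \bar R}).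
Local Open Scope ereal_scope.

Definition sprod : set (T1 * T2) -> \bar R := m1 \x m2.

HB.instance Definition _ := Measure.on sprod.

Let sprod_sigma_finite : sigma_finite setT sprod.
Proof.
(* Monotone exhaustions are chosen so that rectangles with a common index cover the product: a pair
   found at indices i and j lies in the rectangle of index [maxn i j]. *)
have /sigma_finiteP[F [TF ndF Foo]] := sigma_finiteT m1.
have /sigma_finiteP[G [TG ndG Goo]] := sigma_finiteT m2.
exists (fun k => F k `*` G k).
  apply/seteqP; split=> // -[x y] _.
  have [i _ Fx] : (\bigcup_k F k) x by rewrite -TF.
  have [j _ Gy] : (\bigcup_k G k) y by rewrite -TG.
  exists (maxn i j) => //; split => /=.
    exact/(subsetPset _ _ (ndF _ _ (leq_maxl i j))).
  exact/(subsetPset _ _ (ndG _ _ (leq_maxr i j))).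
move=> k; have [mF Fk] := Foo k; have [mG Gk] := Goo k.
split; first exact: measurableX.
rewrite /sprod product_measure1E//.
by rewrite lte_mul_pinfty// ge0_fin_numE.
Qed.

HB.instance Definition _ := Measure_isSigmaFinite.Build _ _ _ sprod
  sprod_sigma_finite.

Lemma integral_sprod (f : T1 * T2 -> \bar R) : measurable_fun setT f ->
  (forall x, 0 <= f x) ->
  \int[sprod]_z f z = \int[m1]_x \int[m2]_y f (x, y).
Proof. exact: fubini_tonelli1. Qed.

End sigma_finite_product.

(** * Lebesgue measure on tuples *)

Section tuple_measure.
Context {R : realType}.
Local Open Scope ereal_scope.

Let consp m (tv : measurableTypeR R * m.-tuple R) :
  m.+1.-tuple R := cons_tuple tv.1 tv.2.

Let measurable_consp m : measurable_fun [set: _] (@consp m).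
Proof.
apply: measurable_cons; last exact: measurable_snd.
exact: (measurable_fst : measurable_fun setT
  (fst : measurableTypeR R * m.-tuple R -> measurableTypeR R)).
Qed.

Section step.
Variables (m : nat) (mu : {sigma_finite_measure set (m.-tuple R) -> \bar R}).

Definition cons_measure := pushforward (sprod (@lebesgue_measure R) mu) (@consp m).

Let cons_measure0 : cons_measure set0 = 0.
Proof. by rewrite /cons_measure /pushforward preimage_set0 measure0. Qed.

Let cons_measure_ge0 A : 0 <= cons_measure A.
Proof. by rewrite /cons_measure /pushforward; exact: measure_ge0. Qed.

Let cons_measure_sigma_additive : semi_sigma_additive cons_measure.
Proof.
move=> F mF tF mUF; rewrite /cons_measure /pushforward preimage_bigcup.
have mp B : measurable B -> measurable (@consp m @^-1` B).
  by move=> mB; rewrite -[X in measurable X]setTI; exact: measurable_consp.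
apply: measure_semi_sigma_additive.
- by move=> k; exact: mp.
- apply/trivIsetP => /= i j _ _ ij; rewrite -preimage_setI.
  by move/trivIsetP : tF => /(_ _ _ _ _ ij) ->//; rewrite preimage_set0.
- by rewrite -preimage_bigcup; exact: mp.
Qed.

HB.instance Definition _ := isMeasure.Build _ _ _ cons_measure
  cons_measure0 cons_measure_ge0 cons_measure_sigma_additive.

Lemma cons_measure_sigma_finite : sigma_finite setT cons_measure.
Proof.
have [F TF Foo] := sigma_finiteT
  [the {sigma_finite_measure set _ -> \bar R} of sprod (@lebesgue_measure R) mu].
pose g (v : m.+1.-tuple R) :
  measurableTypeR R * m.-tuple R :=
  (thead v, [tuple of behead v]).
have mg : measurable_fun setT g.
  apply/measurable_fun_pairP; split.
    exact: measurable_tnth.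
  exact: measurable_behead.
exists (fun k => g @^-1` F k).
  by rewrite -preimage_bigcup -TF preimage_setT.
move=> k; have [mF Fk] := Foo k; split.
  by rewrite -[X in measurable X]setTI; exact: mg.
rewrite /cons_measure /pushforward -comp_preimage.
rewrite [X in X @^-1` _](_ : _ = id)//; apply/funext => -[t v] /=.
rewrite /g /consp /=; congr pair.
by apply: val_inj.
Qed.

HB.instance Definition _ := Measure_isSigmaFinite.Build _ _ _ cons_measure
  cons_measure_sigma_finite.

End step.

(** A single sigma-finite measure behind the iterated integral [iint], so that Tonelli and Hoelder
    become available; the point mass at the empty tuple starts the recursion. *)
Fixpoint lebesgue_tuple m :
    {sigma_finite_measure set (m.-tuple R) -> \bar R} :=
  match m with
  | 0 => [the {sigma_finite_measure set _ -> \bar R} of @dirac _ _ [tuple] R]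
  | m'.+1 => [the {sigma_finite_measure set _ -> \bar R} of
               cons_measure (lebesgue_tuple m')]
  end.

Lemma iintE m (g : m.-tuple R -> \bar R) :
  measurable_fun setT g -> (forall v, 0 <= g v) ->
  iint g = \int[lebesgue_tuple m]_v g v.
Proof.
elim: m g => [|m IH] g mg g0.
  by rewrite integral_dirac//= diracT mul1e.
rewrite [RHS]ge0_integral_pushforward//=; last exact: measurable_consp.
rewrite preimage_setT integral_sprod//=; last first.
  by apply: measurableT_comp => //; exact: measurable_consp.
apply: eq_integral => t _; rewrite IH///=.
apply: measurableT_comp => //.
exact: measurable_cons.
Qed.

End tuple_measure.

Section translation.
Context {R : realType}.
Local Open Scope ereal_scope.
Local Notation mu := (@lebesgue_measure R).

Lemma integral_translation (f : R -> \bar R) (c : R) :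
  measurable_fun setT f -> (forall t, 0 <= f t) ->
  \int[mu]_t f (t - c)%R = \int[mu]_t f t.
Proof.
move=> mf f0.
pose phi (t : measurableTypeR R) : measurableTypeR R := (t - c)%R.
have mphi : measurable_fun setT phi.
  by apply: (@measurable_funB _ _ R setT id (cst c)) => //; exact: measurable_id.
rewrite -[setT in LHS]/(phi @^-1` setT).
rewrite -ge0_integral_pushforward//.
(* The pushforward under a translation agrees with Lebesgue measure on half-open intervals, which
   determine it. *)
apply: eq_measure_integral => A mA _.
apply/esym/lebesgue_measure_unique => //= _ [[a b]] _ <-.
rewrite /pushforward/=.
rewrite [X in _ = mu X](_ : _ = `](a + c)%R, (b + c)%R]%classic).
  rewrite !lebesgue_measure_itv/= !lte_fin ltrD2r.
  by case: ifPn => // _; rewrite -!EFinB; congr EFin; ring.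
by apply/seteqP; split => t /=; rewrite /phi !in_itv/= ltrBrDr lerBlDr.
Qed.

End translation.

Section slicing.
Context {R : realType}.
Local Open Scope ereal_scope.
Local Notation mu := (@lebesgue_measure R).

Lemma iintS m (g : m.+1.-tuple R -> \bar R) :
  iint g = \int[mu]_t iint (fun v : m.-tuple R => g (cons_tuple t v)).
Proof. by []. Qed.

(** Triangular substitution: the last variable is shifted by a function of the preceding ones and is
    integrated innermost, so translation invariance suffices. The generality in [k], [a] and [sigma]
    serves the induction, where the outermost variable passes into [k] and into [sigma]. *)
Lemma iint_slices m (g h : R -> \bar R) (a : nat -> R) (sigma : seq R -> R)
    (k : \bar R) :
  measurable_fun setT g -> (forall t, 0 <= g t) ->
  measurable_fun setT h -> (forall t, 0 <= h t) -> 0 <= k ->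
  iint (fun v : m.+1.-tuple R => k * (\prod_(j < m) g (nth 0%R v j - a j)%R) *
          h (nth 0%R v m - sigma (take m v))%R) =
  k * (\int[mu]_t g t) ^+ m * \int[mu]_t h t.
Proof.
move=> mg g0 mh h0; elim: m a sigma k => [|m IH] a sigma k k0.
  rewrite expe0 mule1 /=.
  under eq_integral do rewrite big_ord0 mule1.
  rewrite ge0_integralZl//; last first.
    apply: (@measurableT_comp _ _ _ _ _ _ h) => //.
    by apply: (@measurable_funB _ _ R setT id (cst (sigma [::]))) => //; exact: measurable_id.
  by rewrite integral_translation.
rewrite iintS; under eq_integral => t _.
  rewrite (_ : (fun _ => _) = (fun v : m.+1.-tuple R =>
      (k * g (t - a 0%N)%R) *
      (\prod_(j < m) g (nth 0%R v j - (a \o succn) j)%R) *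
      h (nth 0%R v m - (fun s => sigma (t :: s)) (take m v))%R)); last first.
    by apply/funext => v; rewrite big_ord_recl/= muleA.
  rewrite (IH (a \o succn) (fun s => sigma (t :: s)) (k * g _)) ?mule_ge0//.
  over.
have i0 : 0 <= \int[mu]_t g t by exact: integral_ge0.
have j0 : 0 <= \int[mu]_t h t by exact: integral_ge0.
have mgt : measurable_fun setT (fun t : R => g (t - a 0%N)%R).
  apply: (@measurableT_comp _ _ _ _ _ _ g) => //.
  by apply: (@measurable_funB _ _ R setT id (cst (a 0%N))) => //; exact: measurable_id.
under eq_integral do rewrite -!muleA.
rewrite ge0_integralZl//; last 2 first.
- by apply: emeasurable_funM => //.
- by move=> t _; rewrite !mule_ge0// expe_ge0.
rewrite ge0_integralZr//; last first.
  by rewrite mule_ge0// expe_ge0.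
by rewrite integral_translation// expeS !muleA.
Qed.

End slicing.

(** * Volume integrals in coordinates adapted to the domain *)

Section points.
Context {R : realType}.
Local Open Scope ereal_scope.
Local Notation mu := (@lebesgue_measure R).

Definition pt_measure n : set (pt R n) -> \bar R :=
  sprod (lebesgue_tuple n) (lebesgue_tuple n).

HB.instance Definition _ n := SigmaFiniteMeasure.on (@pt_measure n).

Lemma intVE n (g : pt R n -> \bar R) : measurable_fun setT g ->
  (forall z, 0 <= g z) -> intV g = \int[@pt_measure n]_z g z.
Proof.
move=> mg g0; rewrite integral_sprod// -iintE.
- apply: eq_iint => x; rewrite -iintE//.
  exact: measurable_fun_pair2.
- exact: measurable_fun_fubini_tonelli_F.
- by move=> x; exact: integral_ge0.
Qed.

(** With y outside, rho is constant in the inner integration over x, and [shear] depends there only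
    on the first coordinates of x. *)
Lemma intV_swap n (g : pt R n -> \bar R) : measurable_fun setT g ->
  (forall z, 0 <= g z) ->
  intV g = iint (fun y => iint (fun x => g (x, y))).
Proof.
move=> mg g0; rewrite intVE// integral_sprod//.
rewrite [LHS](@fubini_tonelli _ _ _ _ _ (lebesgue_tuple n) (lebesgue_tuple n) _ mg g0).
rewrite -iintE.
- apply: eq_iint => x; rewrite /fubini_G -iintE//.
  exact: measurable_fun_pair1.
- exact: measurable_fun_fubini_tonelli_G.
- by move=> x; exact: integral_ge0.
Qed.

Lemma measurable_nth m j : measurable_fun setT (fun v : m.-tuple R => nth 0%R v j).
Proof.
have [jm|mj] := ltnP j m; last first.
  by rewrite (_ : (fun _ => _) = cst 0%R)//; apply/funext => v; rewrite nth_default ?size_tuple.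
rewrite (_ : (fun _ => _) = (fun v : m.-tuple R => tnth v (Ordinal jm))); first exact: measurable_tnth.
by apply/funext => v; rewrite (tnth_nth 0%R).
Qed.

Lemma measurable_re_coord n j : measurable_fun setT (fun z : pt R n => nth 0%R z.1 j).
Proof. by apply: (measurableT_comp (measurable_nth j)); exact: measurable_fst. Qed.

Lemma measurable_im_coord n j : measurable_fun setT (fun z : pt R n => nth 0%R z.2 j).
Proof. by apply: (measurableT_comp (measurable_nth j)); exact: measurable_snd. Qed.

Lemma measurable_rho n : measurable_fun setT (@rho R n).
Proof.
apply: measurable_funB; first exact: measurable_im_coord.
apply: measurable_sum => j; apply: measurable_funX.
exact: measurable_im_coord.
Qed.

(* [4 * Im (rho2 z u) = 2 * (Re u_n - shear z u)] *)
Definition shear n (z u : pt R n) : R :=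
  (nth 0 z.1 n.-1 - \sum_(j < n.-1)
    (nth 0 z.1 j - nth 0 u.1 j) * (nth 0 z.2 j + nth 0 u.2 j))%R.

Lemma measurable_shear n : measurable_fun setT
  (fun zu : pt R n * pt R n => shear zu.1 zu.2).
Proof.
have m1 j : measurable_fun setT (fun zu : pt R n * pt R n => nth 0%R zu.1.1 j).
  by apply: (measurableT_comp (measurable_re_coord j)); exact: measurable_fst.
have m2 j : measurable_fun setT (fun zu : pt R n * pt R n => nth 0%R zu.1.2 j).
  by apply: (measurableT_comp (measurable_im_coord j)); exact: measurable_fst.
have m3 j : measurable_fun setT (fun zu : pt R n * pt R n => nth 0%R zu.2.1 j).
  by apply: (measurableT_comp (measurable_re_coord j)); exact: measurable_snd.
have m4 j : measurable_fun setT (fun zu : pt R n * pt R n => nth 0%R zu.2.2 j).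
  by apply: (measurableT_comp (measurable_im_coord j)); exact: measurable_snd.
apply: measurable_funB; first exact: m1.
apply: measurable_sum => j; apply: measurable_funM.
  exact: measurable_funB.
exact: measurable_funD.
Qed.

(** The dimension is n + 1, so index n is the last coordinate. For fixed y, [shear z u] involves
    only the earlier coordinates of x; afterwards rho(u) is the last coordinate of y minus a
    function of the earlier ones. Both substitutions are triangular with unit Jacobian, and the
    integral factors. *)
Lemma intV_siegel n (g h psi : R -> R) (z : pt R n.+1) :
  measurable_fun setT g -> (forall t, 0 <= g t)%R ->
  measurable_fun setT h -> (forall t, 0 <= h t)%R ->
  measurable_fun setT psi -> (forall t, 0 <= psi t)%R ->
  intV (fun u : pt R n.+1 =>
     (\prod_(j < n) g (nth 0 u.1 j - nth 0 z.1 j) *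
     \prod_(j < n) g (nth 0 u.2 j - nth 0 z.2 j) *
     h (nth 0 u.1 n - shear z u) * psi (rho u))%:E) =
  (\int[mu]_t (g t)%:E) ^+ n * (\int[mu]_t (g t)%:E) ^+ n *
  \int[mu]_t (h t)%:E * \int[mu]_t (psi t)%:E.
Proof.
move=> mg g0 mh h0 mpsi psi0.
have i0 : 0 <= \int[mu]_t (g t)%:E by apply: integral_ge0 => t _; rewrite lee_fin.
have j0 : 0 <= \int[mu]_t (h t)%:E by apply: integral_ge0 => t _; rewrite lee_fin.
rewrite intV_swap; first last.
- by move=> u; rewrite lee_fin !mulr_ge0// prodr_ge0.
- apply/measurable_EFinP; apply: measurable_funM; last first.
    by apply: (measurableT_comp mpsi); exact: measurable_rho.
  apply: measurable_funM; last first.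
    apply: (measurableT_comp mh); apply: measurable_funB.
      exact: measurable_re_coord.
    have /measurable_fun_pair2 := @measurable_shear n.+1.
    exact.
  apply: measurable_funM.
    apply: measurable_prod => j _; apply: (measurableT_comp mg).
    by apply: measurable_funB => //; exact: measurable_re_coord.
  apply: measurable_prod => j _; apply: (measurableT_comp mg).
  by apply: measurable_funB => //; exact: measurable_im_coord.
transitivity (iint (fun y : n.+1.-tuple R =>
  ((\int[mu]_t (g t)%:E) ^+ n * \int[mu]_t (h t)%:E) *
  (\prod_(j < n) (g (nth 0 y j - nth 0 z.2 j)%R)%:E) *
  (psi (nth 0 y n - (fun s => \sum_(j < n) nth 0 s j ^+ 2) (take n y))%R)%:E)).
  apply: eq_iint => y.
  transitivity (iint (fun x : n.+1.-tuple R =>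
    (\prod_(j < n) g (nth 0 y j - nth 0 z.2 j) * psi (@rho R n.+1 (x, y)))%:E *
    (\prod_(j < n) (g (nth 0 x j - nth 0 z.1 j)%R)%:E) *
    (h (nth 0 x n - (fun s => nth 0 z.1 n - \sum_(j < n)
    (nth 0 z.1 j - nth 0 s j) * (nth 0 z.2 j + nth 0 y j)) (take n x))%R)%:E)).
    apply: eq_iint => x.
    rewrite /shear/=.
    have -> : (\sum_(j < n) (nth 0 z.1 j - nth 0 (take n x) j) * (nth 0 z.2 j + nth 0 y j) =
      \sum_(j < n) (nth 0 z.1 j - nth 0 x j) * (nth 0 z.2 j + nth 0 y j))%R.
      by apply: eq_bigr => j _; rewrite nth_take.
    by rewrite prodEFin -!EFinM; congr EFin; ring.
  rewrite /rho/= [LHS](@iint_slices _ _ (EFin \o g) (EFin \o h) (nth 0%R z.1)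
    (fun s => nth 0 z.1 n - \sum_(j < n)
    (nth 0 z.1 j - nth 0 s j) * (nth 0 z.2 j + nth 0 y j))%R)//; first last.
  - by rewrite lee_fin mulr_ge0// prodr_ge0.
  - exact/measurable_EFinP.
  - exact/measurable_EFinP.
  have -> : (\sum_(j < n) nth 0 (take n y) j ^+ 2 = \sum_(j < n) nth 0 y j ^+ 2)%R.
    by apply: eq_bigr => j _; rewrite nth_take.
  by rewrite EFinM prodEFin /= -!muleA muleC -!muleA muleCA [X in _ * X]muleC -!muleA.
rewrite [LHS](@iint_slices _ _ (EFin \o g) (EFin \o psi) (nth 0%R z.2)
   (fun s => \sum_(j < n) nth 0 s j ^+ 2)%R)//; first last.
- by rewrite mule_ge0// expe_ge0.
- exact/measurable_EFinP.
- exact/measurable_EFinP.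
by rewrite -!muleA; congr (_ * _); rewrite muleCA.
Qed.

End points.

(** * Schur's test and Minkowski's integral inequality *)

Section hoelder_weighted.
Context d (T : measurableType d) (R : realType).
Variable mu : {measure set T -> \bar R}.

(** Weighted arithmetic-geometric mean of x/a and y/b. When a and b are the integrals of the two
    functions, the last factor integrates to 1, which is Hoelder's inequality. *)
Lemma powR_weighted_mean (th x y a b : R) : 0 < th < 1 -> 0 <= x -> 0 <= y ->
  0 < a -> 0 < b -> x `^ th * y `^ (1 - th) <=
  a `^ th * b `^ (1 - th) * (th / a * x + (1 - th) / b * y).
Proof.
move=> /andP[th0 th1] x0 y0 a0 b0.
have th1' : 0 < 1 - th by rewrite subr_gt0.
have xa0 : 0 <= x / a by rewrite divr_ge0// ltW.
have yb0 : 0 <= y / b by rewrite divr_ge0// ltW.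
have le : (x / a) `^ th * (y / b) `^ (1 - th) <= (x / a) * th + (y / b) * (1 - th).
  have := @conjugate_powR _ ((x / a) `^ th) ((y / b) `^ (1 - th)) th^-1 (1 - th)^-1.
  rewrite !powR_ge0 !invr_gt0 !invrK => /(_ isT isT th0 th1' (subrKC _ _)).
  by rewrite -!powRrM mulfV ?mulfV ?(gt_eqF th0) ?(gt_eqF th1')// !powRr1.
have pa : 0 < a `^ th by apply: powR_gt0.
have pb : 0 < b `^ (1 - th) by apply: powR_gt0.
have -> : x `^ th = a `^ th * (x / a) `^ th.
  by rewrite -powRM ?(ltW a0)// mulrC divfK// gt_eqF.
have -> : y `^ (1 - th) = b `^ (1 - th) * (y / b) `^ (1 - th).
  by rewrite -powRM ?(ltW b0)// mulrC divfK// gt_eqF.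
rewrite mulrACA; apply: ler_wpM2l; first by rewrite mulr_ge0// ltW.
by apply: (le_trans le); rewrite le_eqVlt; apply/orP; left; apply/eqP; ring.
Qed.

Local Open Scope ereal_scope.

Lemma poweR_weighted_mean (th a b : R) (x y : \bar R) :
  (0 < th < 1)%R -> 0 <= x -> 0 <= y ->
  (0 < a)%R -> (0 < b)%R -> x `^ th * y `^ (1 - th) <=
  (a `^ th * b `^ (1 - th) * (th / a))%:E * x +
  (a `^ th * b `^ (1 - th) * ((1 - th) / b))%:E * y.
Proof.
move=> /[dup] th01 /andP[th0 th1] x0 y0 a0 b0.
have th1' : (0 < 1 - th)%R by rewrite subr_gt0.
have pos1 : (0 < a `^ th * b `^ (1 - th) * (th / a))%R.
  by rewrite !mulr_gt0 ?powR_gt0 ?invr_gt0.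
have pos2 : (0 < a `^ th * b `^ (1 - th) * ((1 - th) / b))%R.
  by rewrite !mulr_gt0 ?powR_gt0 ?invr_gt0.
case: x x0 => [x| |]// x0; case: y y0 => [y| |]// y0.
- rewrite !poweR_EFin -!EFinM -EFinD lee_fin -!(mulrA (_ * _)%R) -mulrDr.
  exact: powR_weighted_mean.
- by rewrite gt0_muley ?lte_fin// addey ?leey// -EFinM.
- by rewrite gt0_muley ?lte_fin// addye ?leey// -EFinM.
- by rewrite !gt0_muley ?lte_fin// leey.
Qed.

Lemma hoelder_weighted (th : R) (X Y : T -> \bar R) : (0 < th < 1)%R ->
  measurable_fun setT X -> measurable_fun setT Y ->
  (forall x, 0 <= X x) -> (forall x, 0 <= Y x) ->
  \int[mu]_x (X x `^ th * Y x `^ (1 - th)) <=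
  (\int[mu]_x X x) `^ th * (\int[mu]_x Y x) `^ (1 - th).
Proof.
move=> /[dup] th01 /andP[th0 th1] mX mY X0 Y0.
have th1' : (0 < 1 - th)%R by rewrite subr_gt0.
have mpow (Z : T -> \bar R) r : measurable_fun setT Z -> measurable_fun setT (fun x => Z x `^ r).
  by move=> mZ; apply: (measurableT_comp (measurable_poweR _)).
have mXY : measurable_fun setT (fun x => X x `^ th * Y x `^ (1 - th)).
  by apply: emeasurable_funM; exact: mpow.
have A0 : 0 <= \int[mu]_x X x by exact: integral_ge0.
have B0 : 0 <= \int[mu]_x Y x by exact: integral_ge0.
(* A vanishing integral cannot serve for normalisation; in that case one function is 0 almost
   everywhere, and so is the product. *)
have zero (Z : T -> \bar R) : measurable_fun setT Z -> (forall x, 0 <= Z x) ->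
    (forall x, Z x = 0 -> X x `^ th * Y x `^ (1 - th) = 0) -> \int[mu]_x Z x = 0 ->
    \int[mu]_x (X x `^ th * Y x `^ (1 - th)) = 0.
  move=> mZ Z0 ZXY IZ.
  rewrite (ae_eq_integral (cst 0))//; first by rewrite integral0.
  have : \int[mu]_x `|Z x| = 0.
    by under eq_integral do rewrite gee0_abs//.
  move/(ae_eq_integral_abs mu measurableT mZ).
  by apply: filterS => x /(_ I)/= /ZXY.
have [/eqP A00|An0] := boolP (\int[mu]_x X x == 0).
  rewrite (zero X)//; first by rewrite mule_ge0 ?poweR_ge0.
  by move=> x ->; rewrite poweR0r ?gt_eqF// mul0e.
have [/eqP B00|Bn0] := boolP (\int[mu]_x Y x == 0).
  rewrite (zero Y)//; first by rewrite mule_ge0 ?poweR_ge0.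
  by move=> x ->; rewrite poweR0r ?gt_eqF// mule0.
have Agt : 0 < \int[mu]_x X x by rewrite lt0e An0.
have Bgt : 0 < \int[mu]_x Y x by rewrite lt0e Bn0.
have [AE|Ay] := eqVneq (\int[mu]_x X x) +oo.
  by rewrite AE poweRyr ?gt_eqF// gt0_mulye ?leey// poweR_gt0.
have [BE|By] := eqVneq (\int[mu]_x Y x) +oo.
  by rewrite BE poweRyr ?gt_eqF// gt0_muley ?leey// poweR_gt0.
have Afin : \int[mu]_x X x \is a fin_num by rewrite ge0_fin_numE// ltey.
have Bfin : \int[mu]_x Y x \is a fin_num by rewrite ge0_fin_numE// ltey.
move: Afin Bfin Agt Bgt => /fineK AE /fineK BE.
rewrite -AE -BE !lte_fin => Agt Bgt.
set a := fine _ in AE Agt *; set b := fine _ in BE Bgt *.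
apply: (@le_trans _ _ (\int[mu]_x ((a `^ th * b `^ (1 - th) * (th / a))%:E * X x +
  (a `^ th * b `^ (1 - th) * ((1 - th) / b))%:E * Y x))).
  apply: le_integralT => x; first by rewrite mule_ge0 ?poweR_ge0.
  exact: poweR_weighted_mean.
rewrite ge0_integralD//=; last 4 first.
- by move=> x _; rewrite mule_ge0// lee_fin !mulr_ge0 ?powR_ge0 ?invr_ge0 ?ltW.
- exact: measurable_funeM.
- by move=> x _; rewrite mule_ge0// lee_fin !mulr_ge0 ?powR_ge0 ?invr_ge0 ?ltW.
- exact: measurable_funeM.
rewrite !ge0_integralZl_EFin//; last 2 first.
  by rewrite !mulr_ge0 ?powR_ge0 ?invr_ge0 ?ltW.
  by rewrite !mulr_ge0 ?powR_ge0 ?invr_ge0 ?ltW.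
rewrite -AE -BE -!EFinM -EFinD lee_fin.
rewrite -!(mulrA (_ * _)%R) -mulrDr !divfK ?gt_eqF// subrKC mulr1.
exact: lexx.
Qed.

End hoelder_weighted.

Section schur.
Context d1 d2 (Z : measurableType d1) (U : measurableType d2) (R : realType).
Variables (mz : {sigma_finite_measure set Z -> \bar R})
          (mu : {sigma_finite_measure set U -> \bar R}).
Local Open Scope ereal_scope.

Lemma measurable_poweR_fun d (T : measurableType d) (f : T -> \bar R) r :
  measurable_fun setT f -> measurable_fun setT (fun x => f x `^ r).
Proof. by move=> mf; apply: (measurableT_comp (measurable_poweR _)). Qed.

Lemma measurable_powR_fun d (T : measurableType d) (f : T -> R) r :
  measurable_fun setT f -> measurable_fun setT (fun x => f x `^ r)%R.
Proof. by move=> mf; apply: (measurableT_comp (measurable_powR _)). Qed.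

Lemma le_poweR (r : R) (x y : \bar R) : (0 <= r)%R -> 0 <= x -> x <= y ->
  x `^ r <= y `^ r.
Proof.
move=> r0 x0 xy; apply: gt0_ler_poweR => //; rewrite in_itv/= leey andbT//.
exact: le_trans xy.
Qed.

(** [F] stands for the p-th power of a density. Hoelder with exponents 1 - 1/p and 1/p splits off
    [A], whose integral in u is controlled by [w]. A second application, with p/q and 1 - p/q,
    leaves [B] to the first power after raising to the power q, so that Tonelli and the integral of
    [B] in z conclude. The powers of the integral of [F] add up to (q/p - 1) + 1. *)
Lemma schur_test (p q C1 C2 : R) (A B : Z * U -> R) (F : U -> \bar R)
    (v w : Z -> R) :
  (1 < p)%R -> (p <= q)%R ->
  measurable_fun setT A -> (forall x, 0 <= A x)%R ->
  measurable_fun setT B -> (forall x, 0 <= B x)%R ->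
  measurable_fun setT F -> (forall u, 0 <= F u) ->
  measurable_fun setT v -> (forall z, 0 <= v z)%R ->
  measurable_fun setT w -> (forall z, 0 <= w z)%R -> (0 <= C1)%R -> (0 <= C2)%R ->
  (forall z, \int[mu]_u (A (z, u))%:E <= (C1 * w z)%:E) ->
  (forall u, \int[mz]_z (w z `^ (q * (1 - p^-1)) * v z * B (z, u))%:E <= C2%:E) ->
  \int[mz]_z ((v z)%:E * (\int[mu]_u ((A (z, u) `^ (1 - p^-1) *
      B (z, u) `^ q^-1)%:E * F u `^ p^-1)) `^ q) <=
  (C1 `^ (q * (1 - p^-1)) * C2)%:E * (\int[mu]_u F u) `^ (q / p).
Proof.
move=> p1 pq mA A0 mB B0 mF F0 mv v0 mw w0 C10 C20 hA hB.
have p0 : (0 < p)%R by apply: lt_trans p1.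
have q0 : (0 < q)%R by apply: lt_le_trans pq.
have th0 : (0 < p^-1 < 1)%R by rewrite invr_gt0 p0 invf_lt1.
have th1 : (0 <= 1 - p^-1)%R by rewrite subr_ge0 ltW// (andP th0).2.
have pq1 : (0 < p / q <= 1)%R by rewrite divr_gt0//= ler_pdivrMr// mul1r.
have IF0 : 0 <= \int[mu]_u F u by exact: integral_ge0.
have mAz z : measurable_fun setT (fun u => A (z, u)) by exact: measurable_fun_pair2.
have mBz z : measurable_fun setT (fun u => B (z, u)) by exact: measurable_fun_pair2.
set s := (q * (1 - p^-1))%R.
have s0 : (0 <= s)%R by rewrite mulr_ge0// ltW.
have pointwise z : (\int[mu]_u ((A (z, u) `^ (1 - p^-1) *
      B (z, u) `^ q^-1)%:E * F u `^ p^-1)) `^ q <=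
   (C1 * w z)%:E `^ s * (\int[mu]_u F u) `^ (q / p - 1) *
    \int[mu]_u ((B (z, u))%:E * F u).
  have IBF0 : 0 <= \int[mu]_u ((B (z, u))%:E * F u).
    by apply: integral_ge0 => u _; rewrite mule_ge0// lee_fin.
  have step1 : \int[mu]_u ((A (z, u) `^ (1 - p^-1) *
      B (z, u) `^ q^-1)%:E * F u `^ p^-1) <=
    (\int[mu]_u ((B (z, u) `^ (p / q))%:E * F u)) `^ p^-1 *
    (\int[mu]_u (A (z, u))%:E) `^ (1 - p^-1).
    rewrite [leLHS](_ : _ = \int[mu]_u (((B (z, u) `^ (p / q))%:E * F u) `^ p^-1 *
        (A (z, u))%:E `^ (1 - p^-1))); last first.
      apply: eq_integral => u _.
      rewrite poweRM ?lee_fin ?powR_ge0// !poweR_EFin -powRrM mulrAC mulfV ?gt_eqF//.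
      by rewrite mul1r muleAC -EFinM mulrC.
    apply: hoelder_weighted => //.
    - apply: emeasurable_funM => //; apply/measurable_EFinP.
      exact: measurable_powR_fun.
    - exact/measurable_EFinP.
    - by move=> u; rewrite mule_ge0// lee_fin powR_ge0.
    - by move=> u; rewrite lee_fin.
  have step2 : \int[mu]_u ((B (z, u) `^ (p / q))%:E * F u) <=
     (\int[mu]_u ((B (z, u))%:E * F u)) `^ (p / q) *
     (\int[mu]_u F u) `^ (1 - p / q).
    (* For p = q the exponent 1 - p/q is 0, outside the range of [hoelder_weighted]; the claim is
       then an equality. *)
    have [pqE|pqN] := eqVneq (p / q)%R 1%R.
      rewrite pqE subrr poweRe0 mule1 poweRe1//.
      by under eq_integral do rewrite powRr1//.
    rewrite [leLHS](_ : _ = \int[mu]_u (((B (z, u))%:E * F u) `^ (p / q) *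
        F u `^ (1 - p / q))); last first.
      apply: eq_integral => u _.
      rewrite poweRM ?lee_fin// -muleA -poweRD; last first.
        by rewrite add_neq0_poweRD_def// subrKC oner_neq0.
      by rewrite subrKC poweRe1.
    apply: hoelder_weighted => //.
    - by rewrite (andP pq1).1 lt_neqAle pqN (andP pq1).2.
    - by apply: emeasurable_funM => //; exact/measurable_EFinP.
    - by move=> u; rewrite mule_ge0// lee_fin.
  have I1 : 0 <= \int[mu]_u ((B (z, u) `^ (p / q))%:E * F u).
    by apply: integral_ge0 => u _; rewrite mule_ge0// lee_fin powR_ge0.
  have IA : 0 <= \int[mu]_u (A (z, u))%:E.
    by apply: integral_ge0 => u _; rewrite lee_fin.
  have I0 : 0 <= \int[mu]_u ((A (z, u) `^ (1 - p^-1) *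
      B (z, u) `^ q^-1)%:E * F u `^ p^-1).
    by apply: integral_ge0 => u _; rewrite mule_ge0 ?poweR_ge0// lee_fin mulr_ge0 ?powR_ge0.
  apply: (@le_trans _ _ ((((\int[mu]_u ((B (z, u))%:E * F u)) `^ (p / q) *
     (\int[mu]_u F u) `^ (1 - p / q)) `^ p^-1 * (C1 * w z)%:E `^ (1 - p^-1)) `^ q)).
    apply: le_poweR => //; first exact: ltW.
    apply: (le_trans step1); apply: lee_pmul; rewrite ?poweR_ge0//.
      by apply: le_poweR => //; rewrite invr_ge0 ltW.
    exact: le_poweR.
  rewrite poweRM ?poweR_ge0// -!poweRrM poweRM ?poweR_ge0// -!poweRrM.
  rewrite (_ : p / q * (p^-1 * q) = 1)%R; last by field; rewrite !gt_eqF.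
  rewrite (_ : (1 - p / q) * (p^-1 * q) = q / p - 1)%R; last by field; rewrite !gt_eqF.
  by rewrite poweRe1// (mulrC _ q) muleC [X in _ * X <= _]muleC muleA.
have v0E z : 0 <= (v z)%:E by rewrite lee_fin.
apply: (@le_trans _ _ (\int[mz]_z ((C1 `^ s)%:E * (\int[mu]_u F u) `^ (q / p - 1) *
    \int[mu]_u ((w z `^ s * v z * B (z, u))%:E * F u)))).
  apply: le_integralT => z; first by rewrite mule_ge0 ?poweR_ge0.
  apply: (@le_trans _ _ ((v z)%:E * ((C1 * w z)%:E `^ s * (\int[mu]_u F u) `^ (q / p - 1) *
    \int[mu]_u ((B (z, u))%:E * F u)))).
    exact: lee_wpmul2l.
  rewrite poweR_EFin powRM// EFinM.
  have -> : \int[mu]_u ((w z `^ s * v z * B (z, u))%:E * F u) =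
      (w z `^ s * v z)%:E * \int[mu]_u ((B (z, u))%:E * F u).
    under eq_integral do rewrite EFinM -muleA.
    rewrite ge0_integralZl_EFin//.
    - by move=> u _; rewrite mule_ge0// lee_fin.
    - by apply: emeasurable_funM => //; exact/measurable_EFinP.
    - by rewrite mulr_ge0// powR_ge0.
  rewrite !EFinM !muleA le_eqVlt; apply/orP; left; apply/eqP; congr (_ * _).
  by rewrite -!muleA muleCA; congr (_ * _); rewrite muleC -muleA muleCA muleA.
have mwvB : measurable_fun setT (fun zu : Z * U => (w zu.1 `^ s * v zu.1 * B zu)%R).
  apply: measurable_funM => //; apply: measurable_funM.
    by apply: measurable_powR_fun; exact: measurableT_comp.
  exact: measurableT_comp.
have mwvBF : measurable_fun setT (fun zu : Z * U => (w zu.1 `^ s * v zu.1 * B zu)%:E * F zu.2).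
  apply: emeasurable_funM; first exact/measurable_EFinP.
  exact: measurableT_comp.
have wvBF0 zu : 0 <= (w zu.1 `^ s * v zu.1 * B zu)%:E * F zu.2.
  by rewrite mule_ge0// lee_fin !mulr_ge0// powR_ge0.
rewrite ge0_integralZl//; first last.
- by rewrite mule_ge0 ?poweR_ge0// lee_fin powR_ge0.
- by move=> z _; apply: integral_ge0 => u _; exact: (wvBF0 (z, u)).
- exact: (@measurable_fun_fubini_tonelli_F _ _ _ _ _ mu _ mwvBF wvBF0).
rewrite [X in _ * X](@fubini_tonelli _ _ _ _ _ mz mu _ mwvBF wvBF0)/=.
apply: (@le_trans _ _ ((C1 `^ s)%:E * (\int[mu]_u F u) `^ (q / p - 1) *
    \int[mu]_u (C2%:E * F u))).
  apply: lee_wpmul2l; first by rewrite mule_ge0 ?poweR_ge0// lee_fin powR_ge0.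
  apply: le_integralT => u.
    by apply: integral_ge0 => z _; exact: (wvBF0 (z, u)).
  rewrite /fubini_G/=.
  rewrite ge0_integralZr//; first exact: lee_wpmul2r.
    by apply/measurable_EFinP; exact: (measurable_fun_pair1 u mwvB).
  by move=> z _; rewrite lee_fin !mulr_ge0// powR_ge0.
rewrite ge0_integralZl_EFin// EFinM -!muleA; apply: lee_wpmul2l.
  by rewrite lee_fin powR_ge0.
rewrite muleCA; apply: lee_wpmul2l; first by rewrite lee_fin.
rewrite -[X in _ * X]poweRe1// -poweRD ?subrK//.
by rewrite add_neq0_poweRD_def// subrK mulf_neq0 ?invr_neq0 ?gt_eqF.
Qed.

End schur.

Section minkowski_integral.
Context d1 d2 (Z : measurableType d1) (U : measurableType d2) (R : realType).
Variables (mz : {sigma_finite_measure set Z -> \bar R})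
          (mu : {sigma_finite_measure set U -> \bar R}).
Local Open Scope ereal_scope.

(* Hoelder with the weight [fine (g u) `^ (1 - q)] reduces the claim to Tonelli. *)
Lemma minkowski_integral (q : R) (k : U -> R) (g : U -> \bar R)
    (H : Z * U -> \bar R) : (1 < q)%R ->
  measurable_fun setT k -> (forall u, 0 <= k u)%R ->
  measurable_fun setT g -> (forall u, 0 <= g u) ->
  measurable_fun setT H -> (forall x, 0 <= H x) ->
  (forall u, \int[mz]_z H (z, u) `^ q <= g u `^ q) ->
  (forall z u, g u = 0 -> H (z, u) = 0) ->
  \int[mz]_z (\int[mu]_u ((k u)%:E * H (z, u))) `^ q <=
  (\int[mu]_u ((k u)%:E * g u)) `^ q.
Proof.
move=> q1 mk k0 mg g0 mH H0 Hg Hg0.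
have q0 : (0 < q)%R by apply: lt_trans q1.
have th0 : (0 < q^-1 < 1)%R by rewrite invr_gt0 q0 invf_lt1.
have q1n0 : (1 - q != 0)%R by rewrite subr_eq0 lt_eqF.
have kg0 u : 0 <= (k u)%:E * g u by rewrite mule_ge0// lee_fin.
have mkg : measurable_fun setT (fun u => (k u)%:E * g u).
  by apply: emeasurable_funM => //; exact/measurable_EFinP.
have I0 : 0 <= \int[mu]_u ((k u)%:E * g u) by exact: integral_ge0.
have [->|Ify] := eqVneq (\int[mu]_u ((k u)%:E * g u)) +oo.
  by rewrite poweRyr ?gt_eqF// leey.
(* [fine] is 0 at +oo, and 0 to the nonzero power 1 - q is 0, so [G] vanishes where g is 0 or
   infinite. Where g = 0, H vanishes by hypothesis; where g is infinite, finiteness of k g almost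
   everywhere forces k = 0 there. *)
pose G u := (fine (g u) `^ (1 - q))%R.
have mG : measurable_fun setT G.
  by apply: measurable_powR_fun; exact: measurableT_comp.
pose X zu := (k zu.2 * G zu.2)%:E * H zu `^ q.
have X0 zu : 0 <= X zu by rewrite mule_ge0 ?poweR_ge0// lee_fin mulr_ge0// powR_ge0.
have mX : measurable_fun setT X.
  apply: emeasurable_funM; last exact: measurable_poweR_fun.
  apply/measurable_EFinP; apply: measurable_funM.
    by apply: (measurableT_comp mk); exact: measurable_snd.
  by apply: (measurableT_comp mG); exact: measurable_snd.
have mHz z : measurable_fun setT (fun u => H (z, u)) by exact: measurable_fun_pair2.
have mXz z : measurable_fun setT (fun u => X (z, u)) by exact: measurable_fun_pair2.
have aefin : {ae mu, forall u, (k u)%:E * g u \is a fin_num}.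
  have : mu.-integrable setT (fun u => (k u)%:E * g u).
    apply/integrableP; split => //; under eq_integral do rewrite gee0_abs//.
    by rewrite ltey.
  by move/(integrable_ae measurableT); apply: filterS => u; apply.
have pointwise z : \int[mu]_u ((k u)%:E * H (z, u)) <=
    (\int[mu]_u X (z, u)) `^ q^-1 * (\int[mu]_u ((k u)%:E * g u)) `^ (1 - q^-1).
  apply: (@le_trans _ _ (\int[mu]_u (X (z, u) `^ q^-1 * ((k u)%:E * g u) `^ (1 - q^-1)))).
    apply: ae_ge0_le_integral => //.
    - by move=> u _; rewrite mule_ge0// lee_fin.
    - by apply: emeasurable_funM => //; exact/measurable_EFinP.
    - by move=> u _; rewrite mule_ge0 ?poweR_ge0.
    - by apply: emeasurable_funM; exact: measurable_poweR_fun.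
    apply: filterS aefin => u kgfin _.
    have [gu0|gun0] := eqVneq (g u) 0.
      by rewrite Hg0// mule0 mule_ge0 ?poweR_ge0.
    have [ku0|kun0] := eqVneq (k u) 0%R.
      by rewrite ku0 mul0e mule_ge0 ?poweR_ge0.
    have kgt0 : (0 < k u)%R by rewrite lt0r kun0 k0.
    move: (g0 u) gun0 kgfin; rewrite /X/G/=; case: (g u) => [r| |]//=; last first.
      by rewrite gt0_muley ?lte_fin.
    rewrite lee_fin eqe => r0 rn0 _.
    have rgt0 : (0 < r)%R by rewrite lt0r rn0.
    rewrite poweRM ?poweR_ge0//; last by rewrite lee_fin mulr_ge0// powR_ge0.
    rewrite -poweRrM mulfV ?gt_eqF// poweRe1// poweR_EFin muleAC -EFinM.
    rewrite le_eqVlt; apply/orP; left; apply/eqP; congr (EFin _ * _).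
    rewrite !powRM ?powR_ge0// -powRrM mulrACA -!powRD ?subrKC ?powRr1//; first last.
    - by rewrite oner_eq0.
    - by rewrite rn0 implybT.
    - rewrite (_ : _ + _ = 0)%R ?powRr0 ?mulr1//.
      by field; rewrite gt_eqF.
  by apply: hoelder_weighted.
have IX0 z : 0 <= \int[mu]_u X (z, u) by exact: integral_ge0.
apply: (@le_trans _ _ (\int[mz]_z ((\int[mu]_u ((k u)%:E * g u)) `^ (q - 1) *
    \int[mu]_u X (z, u)))).
  apply: le_integralT => z; first exact: poweR_ge0.
  apply: (@le_trans _ _ (((\int[mu]_u X (z, u)) `^ q^-1 *
      (\int[mu]_u ((k u)%:E * g u)) `^ (1 - q^-1)) `^ q)).
    apply: le_poweR => //; first exact: ltW.
    by apply: integral_ge0 => u _; rewrite mule_ge0// lee_fin.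
  rewrite poweRM ?poweR_ge0// -!poweRrM mulVf ?gt_eqF// poweRe1// muleC.
  by rewrite mulrBl mul1r mulVf ?gt_eqF.
rewrite ge0_integralZl//; first last.
- exact: poweR_ge0.
- exact: (@measurable_fun_fubini_tonelli_F _ _ _ _ _ mu _ mX X0).
rewrite [X in _ * X](@fubini_tonelli _ _ _ _ _ mz mu _ mX X0)/=.
rewrite [leRHS](_ : _ = (\int[mu]_u ((k u)%:E * g u)) `^ (q - 1) *
    \int[mu]_u ((k u)%:E * g u)); last first.
  rewrite -[X in _ * X]poweRe1// -poweRD ?subrK//.
  by rewrite add_neq0_poweRD_def// subrK gt_eqF.
apply: lee_wpmul2l; first exact: poweR_ge0.
apply: le_integralT => u; first by apply: integral_ge0 => z _; exact: X0.
rewrite /X/= ge0_integralZl_EFin//; first last.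
- by rewrite mulr_ge0// powR_ge0.
- by apply: measurable_poweR_fun; exact: (measurable_fun_pair1 u mH).
- by move=> z _; exact: poweR_ge0.
apply: (@le_trans _ _ ((k u * G u)%:E * g u `^ q)).
  by apply: lee_wpmul2l => //; rewrite lee_fin mulr_ge0// powR_ge0.
rewrite EFinM -muleA; apply: lee_wpmul2l; first by rewrite lee_fin.
move: (g0 u); rewrite /G; case: (g u) => [r| |]//=; last first.
  by rewrite powR0// mul0e leey.
rewrite lee_fin => r0; rewrite -EFinM lee_fin.
have [->|rn0] := eqVneq r 0%R; first by rewrite powR0// mul0r.
by rewrite -powRD ?subrK ?powRr1// rn0 implybT.
Qed.

End minkowski_integral.

(** * Forelli-Rudin estimates *)

Section power_integrals.
Context {R : realType}.
Local Notation mu := (@lebesgue_measure R).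

Lemma continuous_powR_at (e x : R) : 0 < x -> {for x, continuous (@powR R ^~ e)}.
Proof.
move=> x0; apply/differentiable_continuous/derivable1_diffP.
by apply: derivable_powR; rewrite in_itv/= x0.
Qed.

Lemma integral_powR_itv (e a b : R) : 0 < a -> a < b -> e + 1 != 0 ->
  (\int[mu]_(t in `[a, b]) (t `^ e)%:E =
   ((b `^ (e + 1) - a `^ (e + 1)) / (e + 1))%:E)%E.
Proof.
move=> a0 ab e1.
have cpow : {within `[a, b], continuous (@powR R ^~ e)}.
  apply: continuous_in_subspaceT => x; rewrite inE/= in_itv/= => /andP[ax _].
  by apply: continuous_powR_at; exact: lt_le_trans ax.
have dF (x : R) : 0 < x -> is_derive x (1 : R) (fun t : R => (e + 1)^-1 * t `^ (e + 1)) (x `^ e).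
  move=> x0; have := is_derive1_powR (e + 1) x0.
  move/(is_deriveZ (e + 1)^-1); rewrite addrK.
  by rewrite scalerA mulVf// scale1r.
rewrite (continuous_FTC2 ab cpow (F := fun t => (e + 1)^-1 * t `^ (e + 1))).
- by rewrite -EFinB -mulrBr mulrC.
- split => [x| |].
  + rewrite in_itv/= => /andP[ax _].
    by have [] := dF x (lt_trans a0 ax).
  + apply: cvg_at_right_filter; apply: cvgMr.
    exact: continuous_powR_at.
  + apply: cvg_at_left_filter; apply: cvgMr.
    by apply: continuous_powR_at; exact: lt_trans ab.
- move=> x; rewrite in_itv/= => /andP[ax _].
  by rewrite derive1E; have [_ ->] := dF x (lt_trans a0 ax).
Qed.

Lemma integral_inv_itv (a b : R) : 0 < a -> a < b ->
  (\int[mu]_(t in `[a, b]) (t `^ (-1))%:E = (ln b - ln a)%:E)%E.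
Proof.
move=> a0 ab.
have cpow : {within `[a, b], continuous (@powR R ^~ (-1))}.
  apply: continuous_in_subspaceT => x; rewrite inE/= in_itv/= => /andP[ax _].
  by apply: continuous_powR_at; exact: lt_le_trans ax.
rewrite (continuous_FTC2 ab cpow (F := @ln R)).
- by rewrite -EFinB.
- split => [x| |].
  + rewrite in_itv/= => /andP[ax _].
    by have [] := is_derive1_ln (lt_trans a0 ax).
  + by apply: cvg_at_right_filter; exact: continuous_ln.
  + by apply: cvg_at_left_filter; apply: continuous_ln; exact: lt_trans ab.
- move=> x; rewrite in_itv/= => /andP[ax _].
  rewrite derive1E; have [_ ->] := is_derive1_ln (lt_trans a0 ax).
  by rewrite powR_inv1// ltW// (lt_trans a0).
Qed.

Local Open Scope ereal_scope.

Lemma integral_gt0_le (f : R -> R) (M : \bar R) : measurable_fun setT f ->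
  (forall t, 0 <= f t)%R ->
  (forall a b : R, (0 < a)%R -> (a < b)%R -> \int[mu]_(t in `[a, b]) (f t)%:E <= M) ->
  \int[mu]_t (if (0 < t)%R then f t else 0%R)%:E <= M.
Proof.
move=> mf f0 hM.
(* Monotone convergence along compact intervals, on which primitives are available; starting at 2
   keeps every interval nondegenerate. *)
pose F (k : nat) : set R := (`[(k.+2%:R^-1)%R, (k.+2%:R)%R])%classic.
have FE : \bigcup_k F k = `]0%R, +oo[%classic.
  apply/seteqP; split => [t [k _]|t] /=; rewrite /F/= !in_itv/= ?andbT.
    by move=> /andP[l _]; apply: lt_le_trans l; rewrite invr_gt0 ltr0n.
  move=> t0; exists (maxn (Num.truncn t) (Num.truncn t^-1)) => //=.
  have le1 (x : R) m : (0 <= x)%R -> (Num.truncn x <= m)%N -> (x <= m.+2%:R)%R.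
    move=> x0 xm; apply: ltW; apply: lt_le_trans (truncnS_gt _) _.
    by rewrite ler_nat ltnS leqW.
  rewrite in_itv/=; apply/andP; split; last by rewrite le1 ?ltW// leq_maxl.
  rewrite -[leRHS]invrK lef_pV2 ?posrE ?invr_gt0 ?ltr0n//.
  by rewrite le1 ?leq_maxr// invr_ge0 ltW.
have mfE A : measurable_fun A (EFin \o f).
  by apply/measurable_EFinP; exact: measurable_funTS.
have := @ge0_nondecreasing_set_cvg_integral _ (measurableTypeR R) R F (EFin \o f) mu.
move=> /(_ _ _ _ _)/cvg_lim; rewrite FE => lim.
have -> : \int[mu]_t (if (0 < t)%R then f t else 0%R)%:E =
    \int[mu]_(t in `]0%R, +oo[) (EFin \o f) t.
  rewrite [RHS]integral_mkcond; apply: eq_integral => t _.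
  by rewrite patchE/= mem_setE in_itv/= andbT; case: ifP.
rewrite -lim//; first last.
- by move=> i x _; rewrite lee_fin.
- by move=> i; exact: mfE.
- by move=> i; exact: measurable_itv.
- apply/nondecreasing_seqP => k; rewrite subsetEset /F => t /=.
  rewrite !in_itv/= => /andP[l u]; apply/andP; split.
    by apply: le_trans l; rewrite lef_pV2 ?posrE ?ltr0n// ler_nat.
  by apply: (le_trans u); rewrite ler_nat.
apply: lime_le.
  apply: ereal_nondecreasing_is_cvgn.
  apply: ge0_nondecreasing_set_nondecreasing_integral => //.
  - apply/nondecreasing_seqP => k; rewrite subsetEset /F => t /=.
    rewrite !in_itv/= => /andP[l u]; apply/andP; split.
      by apply: le_trans l; rewrite lef_pV2 ?posrE ?ltr0n// ler_nat.
    by apply: (le_trans u); rewrite ler_nat.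
  - by move=> i; exact: measurable_itv.
  - by move=> i; exact: mfE.
  - by move=> i x _; rewrite lee_fin.
apply: nearW => k; apply: hM; first by rewrite invr_gt0 ltr0n.
by rewrite (@lt_trans _ _ 1%R)// ?ltr1n// invf_lt1 ?ltr1n ?ltr0n.
Qed.

(** The integral is cut at t = r. Below, (r + t)^(-k) is at most r^(-k), and s > -1 gives
    convergence at 0; above, it is at most t^(-k), and k > s + 1 gives convergence at infinity. The
    two pieces yield the two terms of the constant. *)
Lemma integral_powR_shift_le (s k : R) : (-1 < s)%R -> (s + 1 < k)%R ->
  exists2 C : R, (0 <= C)%R & forall r : R, (0 < r)%R ->
  \int[mu]_t (if (0 < t)%R then t `^ s * (r + t) `^ (- k) else 0)%:E <=
  (C * r `^ (s + 1 - k))%:E.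
Proof.
move=> s1 sk.
have s10 : (0 < s + 1)%R by rewrite -ltrBlDr sub0r.
have ks0 : (0 < k - s - 1)%R by rewrite -addrA -opprD subr_gt0.
have k0 : (0 < k)%R by exact: lt_trans sk.
exists ((s + 1)^-1 + (k - s - 1)^-1)%R.
  by rewrite addr_ge0// invr_ge0 ltW.
move=> r r0.
pose f t : R := (t `^ s * (r + t) `^ (- k))%R.
have mf : measurable_fun setT f.
  apply: measurable_funM; first exact: measurable_powR.
  apply: measurable_powR_fun.
  by apply: measurable_funD; [exact: measurable_cst|exact: measurable_id].
have mfE A : measurable_fun A (EFin \o f).
  by apply/measurable_EFinP; exact: measurable_funTS.
have f0 t : (0 <= f t)%R by rewrite mulr_ge0// powR_ge0.
have f0E A t : A t -> 0 <= (EFin \o f) t by rewrite lee_fin.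
apply: integral_gt0_le => // a b a0 ab.
(* The interval is enlarged so that r lies strictly inside and both pieces are nondegenerate. *)
pose a' := Num.min a (r / 2)%R; pose b' := Num.max b (2 * r)%R.
have r2 : (0 < r / 2)%R by rewrite divr_gt0.
have a'0 : (0 < a')%R by rewrite lt_min a0.
have a'r : (a' < r)%R.
  by rewrite gt_min; apply/orP; right; rewrite gtr_pMr// invf_lt1// ltr1n.
have rb' : (r < b')%R by rewrite lt_max; apply/orP; right; rewrite ltr_pMl// ltr1n.
have mitv (i : interval R) : measurable ([set` i] : set (measurableTypeR R)) by exact: measurable_itv.
apply: (@le_trans _ _ (\int[mu]_(t in `[a', b']) (EFin \o f) t)).
  apply: ge0_subset_integral => //; first exact: mfE.
    by move=> t _; rewrite lee_fin; exact: f0.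
  move=> t /=; rewrite !in_itv/= => /andP[at_ tb].
  by rewrite ge_min at_/= le_max tb.
have -> : (`[a', b'] = `[a', r] `|` `]r, b'])%classic.
  rewrite -itv_bndbnd_setU//; first by rewrite bnd_simp ltW.
  by rewrite bnd_simp ltW.
rewrite ge0_integral_setU//=; first last.
- apply/disj_setPS => x /= []; rewrite !in_itv/= => /andP[_ xr] /andP[rx _].
  by have := lt_le_trans rx xr; rewrite ltxx.
- by move=> t _; rewrite lee_fin; exact: f0.
- exact: mfE.
rewrite mulrDl EFinD; apply: leeD.
- apply: (@le_trans _ _ (\int[mu]_(t in `[a', r]) ((r `^ (- k))%:E * (t `^ s)%:E))).
    apply: le_integralD => [t _|]; first by rewrite lee_fin; exact: f0.
    + move=> t /=; rewrite in_itv/= => /andP[at_ tr].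
      rewrite -EFinM lee_fin /f mulrC ler_wpM2r ?powR_ge0//.
      have t0 : (0 < t)%R by exact: lt_le_trans at_.
      rewrite !powRN lef_pV2 ?posrE ?powR_gt0// ?addr_gt0//.
      by rewrite ge0_ler_powR// ?nnegrE ?lerDl ?ltW// addr_gt0.
  rewrite ge0_integralZl_EFin//; first last.
  + exact: powR_ge0.
  + by apply/measurable_EFinP; apply: measurable_funTS; exact: measurable_powR.
  + by move=> t _; rewrite lee_fin powR_ge0.
  rewrite integral_powR_itv ?gt_eqF// -EFinM lee_fin.
  rewrite mulrA mulrC ler_pM2l ?invr_gt0//.
  apply: (@le_trans _ _ (r `^ (- k) * r `^ (s + 1))%R).
    by rewrite ler_wpM2l ?powR_ge0// gerBl powR_ge0.
  by rewrite -powRD ?(gt_eqF r0) ?implybT// addrC.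
- apply: (@le_trans _ _ (\int[mu]_(t in `[r, b']) (t `^ (s - k))%:E)).
    apply: (@le_trans _ _ (\int[mu]_(t in `]r, b']) (t `^ (s - k))%:E)).
      apply: le_integralD => [t _|]; first by rewrite lee_fin; exact: f0.
      + move=> t /=; rewrite in_itv/= => /andP[rt tb].
        have t0 : (0 < t)%R by exact: lt_trans rt.
        rewrite lee_fin /f powRD ?(gt_eqF t0) ?implybT// ler_wpM2l ?powR_ge0//.
        rewrite !powRN lef_pV2 ?posrE ?powR_gt0// ?addr_gt0//.
        by rewrite ge0_ler_powR// ?nnegrE ?lerDr ?ltW// addr_gt0.
    apply: ge0_subset_integral => //.
    + by apply/measurable_EFinP; apply: measurable_funTS; exact: measurable_powR.
    + by move=> t _; rewrite lee_fin powR_ge0.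
    + by apply: subset_itvr; rewrite bnd_simp.
  have e : (s - k + 1 = - (k - s - 1))%R by ring.
  rewrite integral_powR_itv ?e ?oppr_eq0 ?gt_eqF// lee_fin.
  rewrite invrN mulrN -mulNr opprB mulrC ler_pM2l ?invr_gt0//.
  rewrite (_ : s + 1 - k = - (k - s - 1))%R; last by ring.
  by rewrite gerBl powR_ge0.
Qed.

Lemma integral_powR_norm_le (k : R) : (1 < k)%R ->
  exists2 C : R, (0 <= C)%R & forall r : R, (0 < r)%R ->
  \int[mu]_t ((r + `|t|) `^ (- k))%:E <= (C * r `^ (1 - k))%:E.
Proof.
move=> k1.
have [||C C0 hC] := @integral_powR_shift_le 0%R k; first by rewrite ltrN10.
  by rewrite add0r.
exists (2 * C)%R => [|r r0]; first by rewrite mulr_ge0.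
rewrite ge0_symfun_integralT//=; first last.
- by move=> t /=; rewrite normrN.
- move=> t; apply: (@continuous_comp _ _ _ (fun t : R => r + `|t|)%R (@powR R ^~ (- k)%R)).
    by apply: cvgD; [exact: cvg_cst|exact: norm_continuous].
  by apply: continuous_powR_at; rewrite ltr_wpDr.
- by move=> t; exact: powR_ge0.
rewrite -mulrA EFinM lee_pmul2l// ?lte_fin//.
apply: le_trans (_ : _ <= (C * r `^ (0 + 1 - k))%:E) _; last by rewrite add0r.
apply: le_trans (hC r r0).
rewrite -set_itvcy -integral_itv_obnd_cbnd; last first.
  apply/measurable_EFinP; apply: measurable_funTS; apply: measurable_powR_fun.
  apply: measurable_funD; first exact: measurable_cst.
  exact: normr_measurable.
rewrite integral_mkcond le_eqVlt; apply/orP; left; apply/eqP.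
apply: eq_integral => t _.
rewrite patchE/= mem_setE in_itv/= andbT; case: ifP => // t0.
by rewrite powRr0 mul1r gtr0_norm.
Qed.

End power_integrals.

(** * Size of the kernel function rho(z, u) *)

Section siegel_kernel.
Context {R : realType}.
Local Notation Re := complex.Re.
Local Notation Im := complex.Im.

Lemma complex_sumE (m : nat) (f : 'I_m -> R[i]) :
  \sum_(j < m) f j = ((\sum_(j < m) Re (f j)) +i* (\sum_(j < m) Im (f j)))%C.
Proof.
elim: m f => [|m IH] f; first by rewrite !big_ord0.
by rewrite !big_ord_recl IH; case: (f ord0).
Qed.

Lemma rho2E n (z u : pt R n) : rho2 z u =
  ((4^-1 * ((\sum_(j < n.-1) ((nth 0 z.1 j - nth 0 u.1 j) ^+ 2 +
     (nth 0 z.2 j - nth 0 u.2 j) ^+ 2)) + 2 * (rho z + rho u))) +i*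
   (2^-1 * (nth 0 u.1 n.-1 - shear z u)))%C.
Proof.
rewrite /rho2 /coord complex_sumE /rho /shear.
have -> : (4%:R^-1 : R[i]) = ((4^-1 : R) +i* 0)%C.
  by rewrite -[RHS]/(real_complex R 4^-1) fmorphV rmorph_nat.
have -> : (2%:R : R[i]) = (2 +i* 0)%C by rewrite -[RHS]/(real_complex R 2) rmorph_nat.
apply/eqP; rewrite eq_complex; apply/andP; split; apply/eqP => /=.
(* Since -(y + v)^2 = (y - v)^2 - 2 y^2 - 2 v^2, the last two squares combine with the imaginary
   parts of z_n and u_n to give 2 (rho z + rho u). *)
- have -> : \sum_(j < n.-1)
      ((nth 0 z.1 j - nth 0 u.1 j) * (nth 0 z.1 j - nth 0 u.1 j) -
       (nth 0 z.2 j - - nth 0 u.2 j) * (nth 0 z.2 j - - nth 0 u.2 j)) =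
    \sum_(j < n.-1) ((nth 0 z.1 j - nth 0 u.1 j) ^+ 2 +
       (nth 0 z.2 j - nth 0 u.2 j) ^+ 2) -
    2 * \sum_(j < n.-1) nth 0 z.2 j ^+ 2 - 2 * \sum_(j < n.-1) nth 0 u.2 j ^+ 2.
    by rewrite !mulr_sumr -!sumrB; apply: eq_bigr => j _; ring.
  by ring.
- have -> : \sum_(j < n.-1)
      ((nth 0 z.1 j - nth 0 u.1 j) * (nth 0 z.2 j - - nth 0 u.2 j) +
       (nth 0 z.2 j - - nth 0 u.2 j) * (nth 0 z.1 j - nth 0 u.1 j)) =
    2 * \sum_(j < n.-1) (nth 0 z.1 j - nth 0 u.1 j) * (nth 0 z.2 j + nth 0 u.2 j).
    by rewrite mulr_sumr; apply: eq_bigr => j _; ring.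
  by field.
Qed.

Lemma rho2_sym n (z u : pt R n) : Re (rho2 u z) = Re (rho2 z u) /\
  Im (rho2 u z) = - Im (rho2 z u).
Proof.
rewrite !rho2E /=; split.
  have -> : \sum_(j < n.-1) ((nth 0 u.1 j - nth 0 z.1 j) ^+ 2 + (nth 0 u.2 j - nth 0 z.2 j) ^+ 2) =
    \sum_(j < n.-1) ((nth 0 z.1 j - nth 0 u.1 j) ^+ 2 + (nth 0 z.2 j - nth 0 u.2 j) ^+ 2).
    by apply: eq_bigr => j _; ring.
  by ring.
rewrite /shear -mulrN; congr (_ * _).
have -> : \sum_(j < n.-1) (nth 0 u.1 j - nth 0 z.1 j) * (nth 0 u.2 j + nth 0 z.2 j) =
   - \sum_(j < n.-1) (nth 0 z.1 j - nth 0 u.1 j) * (nth 0 z.2 j + nth 0 u.2 j).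
  by rewrite -sumrN; apply: eq_bigr => j _; ring.
by ring.
Qed.

Lemma cmod_ge0 (w : R[i]) : 0 <= cmod w.
Proof. exact: sqrtr_ge0. Qed.

Lemma cmod_rho2C n (z u : pt R n) : cmod (rho2 u z) = cmod (rho2 z u).
Proof. by rewrite /cmod; have [-> ->] := rho2_sym z u; rewrite sqrrN. Qed.

Lemma cmod_Re (w : R[i]) : `|Re w| <= cmod w.
Proof. by rewrite -sqrtr_sqr ler_wsqrtr// lerDl sqr_ge0. Qed.

Lemma cmod_Im (w : R[i]) : `|Im w| <= cmod w.
Proof. by rewrite -sqrtr_sqr ler_wsqrtr// lerDr sqr_ge0. Qed.

Lemma cmod_le (w : R[i]) : cmod w <= `|Re w| + `|Im w|.
Proof.
rewrite -(ger0_norm (addr_ge0 (normr_ge0 _) (normr_ge0 _))) -sqrtr_sqr.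
rewrite ler_wsqrtr// sqrrD !real_normK ?num_real// lerD2r lerDl.
by rewrite mulrn_wge0// mulr_ge0.
Qed.

Lemma cmodM (v w : R[i]) : cmod (v * w) = cmod v * cmod w.
Proof. by have := ComplexField.Normc.normcM v w; case: v w => [a b] [c d]. Qed.

Lemma cmod_real (a : R) : 0 <= a -> cmod (a%:C)%C = a.
Proof. by move=> a0; rewrite /cmod/= expr0n/= addr0 sqrtr_sqr ger0_norm. Qed.

Lemma rho2_bounds n (z u : pt R n) : 0 < rho z -> 0 < rho u ->
  [/\ rho z + rho u <= 8 * cmod (rho2 z u),
   forall j, (j < n.-1)%N ->
     (Num.sqrt (rho z) + `|nth 0 u.1 j - nth 0 z.1 j|) ^+ 2 <= 8 * cmod (rho2 z u),
   forall j, (j < n.-1)%N ->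
     (Num.sqrt (rho z) + `|nth 0 u.2 j - nth 0 z.2 j|) ^+ 2 <= 8 * cmod (rho2 z u) &
   rho z + `|nth 0 u.1 n.-1 - shear z u| <= 8 * cmod (rho2 z u)].
Proof.
move=> rz ru.
have hR : 4 * Re (rho2 z u) <= 4 * cmod (rho2 z u).
  by rewrite ler_pM2l//; apply: le_trans (cmod_Re _); exact: ler_norm.
have hI := cmod_Im (rho2 z u).
move: hR hI; set c := cmod _; rewrite rho2E /= mulrA mulfV ?mul1r ?pnatr_eq0// => hR hI.
have S0 : 0 <= \sum_(j < n.-1) ((nth 0 z.1 j - nth 0 u.1 j) ^+ 2 +
       (nth 0 z.2 j - nth 0 u.2 j) ^+ 2).
  by apply: sumr_ge0 => j _; rewrite addr_ge0// sqr_ge0.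
have Sj j : (j < n.-1)%N -> (nth 0 z.1 j - nth 0 u.1 j) ^+ 2 +
       (nth 0 z.2 j - nth 0 u.2 j) ^+ 2 + 2 * (rho z + rho u) <= 4 * c.
  move=> jn; apply: le_trans hR; rewrite lerD2r (bigD1 (Ordinal jn))//= lerDl.
  by apply: sumr_ge0 => k _; rewrite addr_ge0// sqr_ge0.
(* The factor 2 lost here turns the 4 of [hR] into the 8 of the statement. *)
have sq (a : R) : (Num.sqrt (rho z) + `|a|) ^+ 2 <= 2 * rho z + 2 * a ^+ 2.
  rewrite -[in leRHS](sqr_sqrtr (ltW rz)) -[in leRHS](real_normK (num_real a)).
  have := sqr_ge0 (Num.sqrt (rho z) - `|a|); set x := Num.sqrt _; set y := `|a|.
  by nra.
split.
- by lra.
- move=> j /Sj h; apply: (le_trans (sq _)).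
  by have := sqr_ge0 (nth 0 z.2 j - nth 0 u.2 j); rewrite -sqrrN opprB in h *; lra.
- move=> j /Sj h; apply: (le_trans (sq _)).
  have := sqr_ge0 (nth 0 z.1 j - nth 0 u.1 j).
  by rewrite -[(nth 0 z.2 j - _) ^+ 2]sqrrN opprB in h; lra.
- rewrite normrM ger0_norm ?invr_ge0// in hI.
  rewrite mulrC ler_pdivrMr// in hI.
  by lra.
Qed.

Lemma measurable_rho2 n : measurable_fun setT
  (fun zu : pt R n * pt R n => cmod (rho2 zu.1 zu.2)).
Proof.
have m1 j : measurable_fun setT (fun zu : pt R n * pt R n => nth 0 zu.1.1 j).
  by apply: (measurableT_comp (measurable_re_coord j)); exact: measurable_fst.
have m2 j : measurable_fun setT (fun zu : pt R n * pt R n => nth 0 zu.1.2 j).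
  by apply: (measurableT_comp (measurable_im_coord j)); exact: measurable_fst.
have m3 j : measurable_fun setT (fun zu : pt R n * pt R n => nth 0 zu.2.1 j).
  by apply: (measurableT_comp (measurable_re_coord j)); exact: measurable_snd.
have m4 j : measurable_fun setT (fun zu : pt R n * pt R n => nth 0 zu.2.2 j).
  by apply: (measurableT_comp (measurable_im_coord j)); exact: measurable_snd.
apply: (measurableT_comp (continuous_measurable_fun (@sqrt_continuous R))).
apply: measurable_funD; apply: measurable_funX.
- rewrite (_ : (fun _ => _) = (fun zu : pt R n * pt R n =>
    4^-1 * ((\sum_(j < n.-1) ((nth 0 zu.1.1 j - nth 0 zu.2.1 j) ^+ 2 +
     (nth 0 zu.1.2 j - nth 0 zu.2.2 j) ^+ 2)) + 2 * (rho zu.1 + rho zu.2)))).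
    apply: measurable_funM; first exact: measurable_cst.
    apply: measurable_funD.
      apply: measurable_sum => j.
      by apply: measurable_funD; apply: measurable_funX; apply: measurable_funB.
    apply: measurable_funM; first exact: measurable_cst.
    apply: measurable_funD; apply: (measurableT_comp (@measurable_rho R n)).
      exact: measurable_fst.
    exact: measurable_snd.
  by apply/funext => zu; rewrite rho2E.
- rewrite (_ : (fun _ => _) = (fun zu : pt R n * pt R n =>
    2^-1 * (nth 0 zu.2.1 n.-1 - shear zu.1 zu.2))).
    apply: measurable_funM; first exact: measurable_cst.
    by apply: measurable_funB => //; exact: measurable_shear.
  by apply/funext => zu; rewrite rho2E.
Qed.

Lemma measurable_if_gt0 d (T : measurableType d) (f g : T -> R) :
  measurable_fun setT f -> measurable_fun setT g ->
  measurable_fun setT (fun x => if 0 < f x then g x else 0).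
Proof.
move=> mf mg; apply: measurable_fun_ifT => //.
by apply: measurable_fun_ltr => //; exact: measurable_cst.
Qed.

Lemma ler_powRN (k a b : R) : 0 <= k -> 0 < a -> a <= b -> b `^ (- k) <= a `^ (- k).
Proof.
move=> k0 a0 ab; have b0 : 0 < b by exact: lt_le_trans ab.
rewrite !powRN lef_pV2 ?posrE ?powR_gt0//.
by rewrite ge0_ler_powR// nnegrE ltW.
Qed.

Lemma expr_prod_ord (x : R) m : x ^+ m = \prod_(j < m) x.
Proof. by rewrite prodr_const card_ord. Qed.

Lemma powR_sumX (X k : R) m : 0 < X -> (X `^ k) ^+ m = X `^ (m%:R * k).
Proof. by move=> X0; rewrite -powR_mulrn ?powR_ge0// -powRrM mulrC. Qed.

Local Open Scope ereal_scope.

Lemma forelli_rudin n (s t : R) : (-1 < s)%R -> (n.+1%:R + 1 + s < t)%R ->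
  exists2 C : R, (0 <= C)%R & forall z : pt R n.+1, (0 < rho z)%R ->
  \int[@pt_measure R n.+1]_u
    (if (0 < rho u)%R then rho u `^ s * cmod (rho2 z u) `^ (- t) else 0)%:E <=
  (C * rho z `^ (n.+1%:R + 1 + s - t))%:E.
Proof.
move=> s1 st.
(* The excess of t over the critical exponent is shared equally: each of the n pairs x_j, y_j, the
   last real coordinate and rho(u) receive d. On each single x_j or y_j the power (1 + d)/2 of the
   kernel is spent; since its lower bound is a square, this gives the exponent 1 + d, integrable on
   the line. *)
pose d := ((t - (n.+1%:R + 1 + s)) / (n.+1%:R + 1))%R.
have n20 : (0 < n.+1%:R + 1 :> R)%R by rewrite addr_gt0.
have d0 : (0 < d)%R by rewrite divr_gt0// subr_gt0.
have dE : (d * (n.+1%:R + 1) = t - (n.+1%:R + 1 + s))%R.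
  by rewrite /d divfK// gt_eqF.
have n1 : (n.+1%:R = n%:R + 1 :> R)%R by rewrite -natr1.
have tE : (t = n%:R * (1 + d) + (1 + d) + (s + 1 + d))%R.
  have -> : (t = d * (n.+1%:R + 1) + (n.+1%:R + 1 + s))%R by rewrite dE subrK.
  by rewrite n1; ring.
have [|C1 C10 hC1] := @integral_powR_norm_le R (1 + d); first by rewrite ltrDl.
have [||C3 C30 hC3] := @integral_powR_shift_le R s (s + 1 + d) => //.
  by rewrite ltrDl.
exists (8 `^ t * (C1 ^+ n * C1 ^+ n * C1 * C3))%R.
  by rewrite !mulr_ge0 ?powR_ge0 ?exprn_ge0.
move=> z z0.
set r := rho z.
pose g (x : R) : R := ((Num.sqrt r + `|x|) `^ (- (1 + d)))%R.
pose h (x : R) : R := ((r + `|x|) `^ (- (1 + d)))%R.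
pose psi (x : R) : R := (if 0 < x then x `^ s * (r + x) `^ (- (s + 1 + d)) else 0)%R.
have sr0 : (0 < Num.sqrt r)%R by rewrite sqrtr_gt0.
have mg : measurable_fun setT g.
  apply: measurable_powR_fun; apply: measurable_funD; first exact: measurable_cst.
  exact: normr_measurable.
have mh : measurable_fun setT h.
  apply: measurable_powR_fun; apply: measurable_funD; first exact: measurable_cst.
  exact: normr_measurable.
have mpsi : measurable_fun setT psi.
  apply: measurable_if_gt0; first exact: measurable_id.
  apply: measurable_funM; first exact: measurable_powR.
  apply: measurable_powR_fun; apply: measurable_funD; first exact: measurable_cst.
  exact: measurable_id.
have g0 (x : R) : (0 <= g x)%R by exact: powR_ge0.
have h0 (x : R) : (0 <= h x)%R by exact: powR_ge0.
have psi0 (x : R) : (0 <= psi x)%R by rewrite /psi; case: ifP => // _; rewrite mulr_ge0 ?powR_ge0.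
have bound u : (0 < rho u)%R -> (rho u `^ s * cmod (rho2 z u) `^ (- t) <=
   8 `^ t * (\prod_(j < n) g (nth 0 u.1 j - nth 0 z.1 j) *
     \prod_(j < n) g (nth 0 u.2 j - nth 0 z.2 j) *
     h (nth 0 u.1 n - shear z u) * psi (rho u)))%R.
  move=> u0.
  have [b1 b2 b3 b4] := rho2_bounds z0 u0.
  move: b1 b2 b3 b4; set X := (8 * _)%R => b1 b2 b3 b4.
  have X0 : (0 < X)%R by apply: lt_le_trans b1; rewrite addr_gt0.
  have -> : (cmod (rho2 z u) `^ (- t) = 8 `^ t * X `^ (- t))%R.
    rewrite /X powRM ?cmod_ge0// mulrA -powRD ?subrr ?powRr0 ?mul1r//.
    by rewrite pnatr_eq0 implybT.
  rewrite mulrCA ler_pM2l ?powR_gt0//.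
  have XE : (X `^ (- t) = (X `^ (- ((1 + d) / 2))) ^+ n * (X `^ (- ((1 + d) / 2))) ^+ n *
     X `^ (- (1 + d)) * X `^ (- (s + 1 + d)))%R.
    rewrite !powR_sumX// -!powRD ?(gt_eqF X0) ?implybT//.
    by congr (_ `^ _)%R; rewrite [in LHS]tE; field.
  have d1 : (0 <= 1 + d)%R by rewrite addr_ge0// ltW.
  have gX (x : R) : ((Num.sqrt r + `|x|) ^+ 2 <= X)%R -> (X `^ (- ((1 + d) / 2)) <= g x)%R.
    move=> xX; have p0 : (0 < Num.sqrt r + `|x|)%R by rewrite ltr_wpDr.
    apply: (@le_trans _ _ (((Num.sqrt r + `|x|) ^+ 2) `^ (- ((1 + d) / 2)))%R).
      by apply: ler_powRN; rewrite ?divr_ge0 ?exprn_gt0.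
    rewrite -powR_mulrn ?(ltW p0)// -powRrM /g le_eqVlt; apply/orP; left; apply/eqP.
    by congr (_ `^ _)%R; field.
  rewrite XE [leLHS]mulrC -[leLHS]mulrA; apply: ler_pM.
  - by rewrite !mulr_ge0 ?exprn_ge0 ?powR_ge0.
  - by rewrite mulr_ge0 ?powR_ge0.
  - apply: ler_pM; rewrite ?mulr_ge0 ?exprn_ge0 ?powR_ge0//.
      apply: ler_pM; rewrite ?exprn_ge0 ?powR_ge0//.
        rewrite expr_prod_ord; apply: ler_prod => j _.
        by rewrite powR_ge0 gX// b2.
      rewrite expr_prod_ord; apply: ler_prod => j _.
      by rewrite powR_ge0 gX// b3.
    apply: ler_powRN => //.
    by rewrite ltr_wpDr.
  - rewrite /psi u0 mulrC ler_wpM2l ?powR_ge0//.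
    apply: ler_powRN => //; last by rewrite addr_gt0.
    by rewrite addr_ge0 ?(ltW d0)// -lerBlDr sub0r ltW.
pose W (u : pt R n.+1) := (\prod_(j < n) g (nth 0 u.1 j - nth 0 z.1 j) *
     \prod_(j < n) g (nth 0 u.2 j - nth 0 z.2 j) *
     h (nth 0 u.1 n - shear z u) * psi (rho u))%R.
have W0 u : (0 <= W u)%R by rewrite !mulr_ge0// prodr_ge0.
have mW : measurable_fun setT W.
  apply: measurable_funM; last by apply: (measurableT_comp mpsi); exact: measurable_rho.
  apply: measurable_funM; last first.
    apply: (measurableT_comp mh); apply: measurable_funB.
      exact: measurable_re_coord.
    exact: (measurable_fun_pair2 z (@measurable_shear R n.+1)).
  apply: measurable_funM; apply: measurable_prod => j _; apply: (measurableT_comp mg).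
    by apply: measurable_funB => //; exact: measurable_re_coord.
  by apply: measurable_funB => //; exact: measurable_im_coord.
apply: (@le_trans _ _ (\int[@pt_measure R n.+1]_u ((8 `^ t)%:E * (W u)%:E))).
  apply: le_integralT => u.
    by rewrite lee_fin; case: ifP => // _; rewrite mulr_ge0 ?powR_ge0.
  rewrite -EFinM lee_fin; case: ifPn => [u0|_]; first exact: bound.
  by rewrite mulr_ge0 ?powR_ge0.
rewrite ge0_integralZl_EFin ?powR_ge0//; first last.
- exact/measurable_EFinP.
- by move=> u _; rewrite lee_fin.
rewrite -intVE; first last.
- by move=> u; rewrite lee_fin.
- exact/measurable_EFinP.
rewrite intV_siegel//.
have le_fin (f : R -> R) (M : R) : (forall x, 0 <= f x)%R ->
    \int[@lebesgue_measure R]_x (f x)%:E <= M%:E ->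
    exists2 I : R, (0 <= I <= M)%R & \int[@lebesgue_measure R]_x (f x)%:E = I%:E.
  move=> f0 fM.
  have I0 : 0 <= \int[@lebesgue_measure R]_x (f x)%:E.
    by apply: integral_ge0 => x _; rewrite lee_fin.
  have Ifin : \int[@lebesgue_measure R]_x (f x)%:E \is a fin_num.
    by rewrite ge0_fin_numE//; apply: le_lt_trans fM _; rewrite ltry.
  exists (fine (\int[@lebesgue_measure R]_x (f x)%:E)); last by rewrite fineK.
  by rewrite fine_ge0//= -lee_fin fineK.
have [G /andP[G0 GC] ->] := le_fin g _ g0 (hC1 _ sr0).
have [H /andP[H0 HC] ->] := le_fin h _ h0 (hC1 _ z0).
have [P /andP[P0 PC] ->] := le_fin psi _ psi0 (hC3 _ z0).
rewrite -EFin_expe -!EFinM lee_fin -[leRHS]mulrA ler_wpM2l ?powR_ge0//.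
(* Each of the 2n factors contributes r^(-d/2) and the two remaining ones r^(-d), in total the
   excess n + 2 + s - t. *)
have -> : (C1 ^+ n * C1 ^+ n * C1 * C3 * rho z `^ (n.+1%:R + 1 + s - t) =
  (C1 * Num.sqrt r `^ (1 - (1 + d))) ^+ n * (C1 * Num.sqrt r `^ (1 - (1 + d))) ^+ n *
  (C1 * r `^ (1 - (1 + d))) * (C3 * r `^ (s + 1 - (s + 1 + d))))%R.
  rewrite -(powR12_sqrt (ltW z0)) -!powRrM !exprMn !powR_sumX//.
  transitivity (C1 ^+ n * C1 ^+ n * C1 * C3 * (r `^ (n%:R * (2^-1 * (1 - (1 + d)))) *
    r `^ (n%:R * (2^-1 * (1 - (1 + d)))) * r `^ (1 - (1 + d)) * r `^ (s + 1 - (s + 1 + d))))%R.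
    rewrite -!powRD ?(gt_eqF z0) ?implybT//; congr (_ * _ `^ _)%R.
    by rewrite [in LHS]tE n1; field.
  by ring.
by rewrite !ler_pM ?mulr_ge0 ?exprn_ge0 ?lerXn2r ?nnegrE ?mulr_ge0 ?powR_ge0.
Qed.

End siegel_kernel.

(** * Sufficiency *)

Section one_variable.
Context {R : realType}.

(** The cut-off turns integrals over T_B into integrals over the whole space, to which Tonelli and
    Schur's test apply. *)
Definition weight n (al : R) (u : pt R n) : R := if 0 < rho u then rho u `^ al else 0.

Definition bergman_kernel n (a b c : R) (zu : pt R n * pt R n) : R :=
  weight a zu.1 * (weight b zu.2 * cmod (rho2 zu.1 zu.2) `^ (- c)).

Lemma weight_ge0 n al (u : pt R n) : 0 <= weight al u.
Proof. by rewrite /weight; case: ifP => // _; exact: powR_ge0. Qed.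

Lemma weight_le0 n al (u : pt R n) : rho u <= 0 -> weight al u = 0.
Proof. by rewrite /weight ltNge => ->. Qed.

Lemma weightM n al al' (u : pt R n) : weight al u * weight al' u = weight (al + al') u.
Proof.
rewrite /weight; case: ifPn => [u0|_]; last by rewrite mulr0.
by rewrite -powRD// (gt_eqF u0) implybT.
Qed.

Lemma weight_powR n al k (u : pt R n) : k != 0 -> weight al u `^ k = weight (al * k) u.
Proof.
move=> k0; rewrite /weight; case: ifPn => _; last by rewrite powR0.
by rewrite -powRrM.
Qed.

Lemma measurable_weight n al : measurable_fun setT (@weight n al).
Proof.
apply: measurable_if_gt0; first exact: measurable_rho.
by apply: measurable_powR_fun; exact: measurable_rho.
Qed.

Lemma bergman_kernel_ge0 n a b c zu : 0 <= @bergman_kernel n a b c zu.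
Proof. by rewrite !mulr_ge0 ?weight_ge0 ?powR_ge0. Qed.

Lemma measurable_bergman_kernel n a b c : measurable_fun setT (@bergman_kernel n a b c).
Proof.
apply: measurable_funM.
  by apply: (measurableT_comp (@measurable_weight n a)); exact: measurable_fst.
apply: measurable_funM.
  by apply: (measurableT_comp (@measurable_weight n b)); exact: measurable_snd.
by apply: measurable_powR_fun; exact: measurable_rho2.
Qed.

Lemma cmod_rho2_gt0 n (z u : pt R n) : 0 < rho z -> 0 < rho u -> 0 < cmod (rho2 z u).
Proof.
move=> z0 u0; have [h _ _ _] := rho2_bounds z0 u0.
by rewrite -(pmulr_rgt0 _ (ltr0n _ 8)); apply: lt_le_trans h; rewrite addr_gt0.
Qed.

Local Open Scope ereal_scope.
Local Notation V n := (@pt_measure R n).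

Lemma forelli_rudin_weight n (s t : R) : (-1 < s)%R -> (n.+1%:R + 1 + s < t)%R ->
  exists2 C : R, (0 <= C)%R & forall z : pt R n.+1, (0 < rho z)%R ->
  \int[V n.+1]_u (weight s u * cmod (rho2 z u) `^ (- t))%:E <=
  (C * rho z `^ (n.+1%:R + 1 + s - t))%:E.
Proof.
move=> s1 st; have [C C0 hC] := forelli_rudin s1 st; exists C => // z z0.
rewrite (le_trans _ (hC z z0))// le_eqVlt; apply/orP; left; apply/eqP.
by apply: eq_integral => u _; rewrite /weight; case: ifPn => //; rewrite mul0r.
Qed.

Lemma one_variable_bound n (p q a b c al be : R) : (1 < p)%R -> (p <= q)%R ->
  cond3 n.+1 p q a b c al be ->
  exists2 C : R, (0 < C)%R & forall F : pt R n.+1 -> \bar R,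
    measurable_fun setT F -> (forall u, 0 <= F u) ->
    \int[V n.+1]_z ((weight be z)%:E *
      (\int[V n.+1]_u ((bergman_kernel a b c (z, u))%:E * F u `^ p^-1)) `^ q) <=
    C%:E * (\int[V n.+1]_u ((weight al u)%:E * F u)) `^ (q / p).
Proof.
move=> p1 pq [h1 [h2 h3]].
have p0 : (0 < p)%R by exact: lt_trans p1.
have q0 : (0 < q)%R by exact: lt_le_trans pq.
have p10 : (p - 1 != 0)%R by rewrite subr_eq0 gt_eqF.
pose N : R := (n.+1%:R + 1)%R.
have N0 : (0 < N)%R by rewrite addr_gt0.
pose p' : R := (1 - p^-1)%R.
have p'0 : (0 < p')%R by rewrite subr_gt0 invf_lt1.
(* [B] and [A] are the gaps in the two integrability conditions, divided by p and q. Each is spent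
   in halves: A/2 gives decay at infinity in the first Schur integral and q A/2 = E + 1 convergence
   at the boundary in the second; B/2 serves the first at the boundary and the second at
   infinity. *)
pose B : R := (b + 1 - (al + 1) / p)%R.
have B0 : (0 < B)%R by rewrite subr_gt0 ltr_pdivrMr// mulrC.
pose A : R := ((a * q + be + 1) / q)%R.
have A0 : (0 < A)%R.
  by rewrite divr_gt0//; lra.
(* The kernel splits as A^(1-1/p) B^(1/q) rho(u)^(al/p), with b = e1 + e2 + al/p
   and c = t1 + t2. *)
pose e1 : R := (B / 2)%R; pose e2 : R := (B / 2 - p')%R.
pose t1 : R := (A / 2 + N * p' + e2)%R; pose t2 : R := (c - t1)%R.
have cE : (c = n.+1%:R + 1 + a + b + ((n.+1%:R + 1 + be) / q - (n.+1%:R + 1 + al) / p))%R by [].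
pose E : R := (q * A / 2 - 1)%R.
have [||CA CA0 hA] := @forelli_rudin_weight n (e2 / p')%R (t1 / p')%R.
- rewrite ltr_pdivlMr// mulN1r /e2 ltrBrDr addNr.
  by rewrite divr_gt0.
- rewrite ltr_pdivlMr// mulrDl divfK ?gt_eqF// /t1 ltrD2r ltrDr divr_gt0//.
have [||CB CB0 hB] := @forelli_rudin_weight n E (t2 * q)%R.
- by rewrite ltrBrDr addNr divr_gt0// mulr_gt0.
- rewrite -subr_gt0 (_ : _ - _ = e1 * q)%R; first by rewrite mulr_gt0// divr_gt0.
  rewrite /t2 /t1 /E /e1 /e2 /A /B /p' /N cE; field.
  by rewrite !gt_eqF.
exists (CA `^ (q * p') * CB + 1)%R.
  by rewrite ltr_wpDl// mulr_ge0 ?powR_ge0.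
move=> F mF F0.
pose Ak := @bergman_kernel n.+1 0 (e2 / p') (t1 / p').
pose Bk := @bergman_kernel n.+1 0 (e1 * q) (t2 * q).
(* This exponent, equal to - A / (2 p'), is what the first Schur integral leaves; the power q p' of
   the corresponding weight enters the second one. *)
pose mu := (N + e2 / p' - t1 / p')%R.
have integrandE z u : (bergman_kernel a b c (z, u))%:E * F u `^ p^-1 =
  (weight a z)%:E * ((Ak (z, u) `^ (1 - p^-1) * Bk (z, u) `^ q^-1)%:E *
    ((weight al u)%:E * F u) `^ p^-1).
  rewrite poweRM ?lee_fin ?weight_ge0// poweR_EFin muleA muleA -!EFinM; congr (EFin _ * _).
  rewrite /Ak /Bk /bergman_kernel/=.
  rewrite !powRM ?mulr_ge0 ?weight_ge0 ?powR_ge0//.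
  rewrite !weight_powR ?gt_eqF ?invr_gt0// !mul0r divfK ?gt_eqF// mulfK ?gt_eqF//.
  have [z0|z0] := ltP 0%R (rho z); last first.
    by rewrite !(weight_le0 _ z0) !mul0r.
  have [u0|u0] := ltP 0%R (rho u); last first.
    by rewrite !(weight_le0 _ u0) !(mul0r, mulr0).
  have w0 : weight 0 z = 1%R by rewrite /weight z0 powRr0.
  rewrite w0 !mul1r -!powRrM !mulNr divfK ?gt_eqF// mulfK ?gt_eqF//.
  have -> : (b = e1 + e2 + al / p)%R.
    by rewrite /e1 /e2 /B /p'; field; rewrite gt_eqF.
  rewrite -!weightM (_ : c = t1 + t2)%R; last by rewrite /t2; ring.
  rewrite (_ : - (t1 + t2) = - t1 + - t2)%R; last by ring.
  rewrite powRD; last by rewrite (gt_eqF (cmod_rho2_gt0 z0 u0)) implybT.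
  by ring.
have mF' : measurable_fun setT (fun u => (weight al u)%:E * F u).
  by apply: emeasurable_funM => //; apply/measurable_EFinP; exact: measurable_weight.
have wF0 u : 0 <= (weight al u)%:E * F u by rewrite mule_ge0// lee_fin weight_ge0.
have := @schur_test _ _ _ _ R (V n.+1) (V n.+1) p q CA CB Ak Bk
  (fun u => (weight al u)%:E * F u) (weight (a * q + be)) (weight mu) p1 pq
  (@measurable_bergman_kernel _ _ _ _) (@bergman_kernel_ge0 _ _ _ _)
  (@measurable_bergman_kernel _ _ _ _) (@bergman_kernel_ge0 _ _ _ _)
  mF' wF0 (@measurable_weight _ _) (@weight_ge0 _ _) (@measurable_weight _ _)
  (@weight_ge0 _ _) CA0 CB0.
rewrite -/p' => /(_ _ _)/le_trans le.
apply: (@le_trans _ _ ((CA `^ (q * p') * CB)%:E * (\int[V n.+1]_u ((weight al u)%:E * F u)) `^ (q / p))); last first.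
  by apply: lee_wpmul2r; rewrite ?poweR_ge0// lee_fin lerDl.
apply: (le_trans _ (le _ _ _ (lexx _))) => {le}.
- rewrite le_eqVlt; apply/orP; left; apply/eqP; apply: eq_integral => z _.
  under eq_integral do rewrite integrandE.
  rewrite ge0_integralZl_EFin ?weight_ge0//; first last.
  + apply: emeasurable_funM; last exact: measurable_poweR_fun.
    apply/measurable_EFinP; apply: measurable_funM; apply: measurable_powR_fun.
      exact: (measurable_fun_pair2 z (@measurable_bergman_kernel _ _ _ _)).
    exact: (measurable_fun_pair2 z (@measurable_bergman_kernel _ _ _ _)).
  + by move=> u _; rewrite mule_ge0 ?poweR_ge0// lee_fin mulr_ge0 ?powR_ge0.
  rewrite poweRM ?lee_fin ?weight_ge0//; last first.
    by apply: integral_ge0 => u _; rewrite mule_ge0 ?poweR_ge0// lee_fin mulr_ge0 ?powR_ge0.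
  rewrite poweR_EFin weight_powR ?gt_eqF// muleA -EFinM weightM.
  by rewrite (addrC be).
- move=> z; rewrite /Ak /bergman_kernel/=.
  have [z0|z0] := ltP 0%R (rho z); last first.
    rewrite integral0_eq; first by rewrite lee_fin mulr_ge0// weight_ge0.
    by move=> u _; rewrite !(weight_le0 _ z0) mul0r.
  under eq_integral do rewrite {1}/weight z0 powRr0 mul1r.
  by apply: (le_trans (hA z z0)); rewrite /mu /weight z0 lexx.
- move=> u; rewrite /Bk /bergman_kernel/=.
  have [u0|u0] := ltP 0%R (rho u); last first.
    rewrite integral0_eq; first by rewrite lee_fin.
    by move=> z _; rewrite !(weight_le0 _ u0) mul0r !mulr0.
  have EE : (E = mu * (q * p') + (a * q + be))%R.
    rewrite /E /mu /t1 /e2 /A /p' /N; field.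
    by rewrite p10 !gt_eqF.
  (* By symmetry of |rho(z,u)| the Forelli-Rudin estimate also applies with u as the fixed point. *)
  rewrite (_ : (fun z => _) = (fun z => (rho u `^ (e1 * q))%:E *
     (weight E z * cmod (rho2 u z) `^ (- (t2 * q)))%:E)); last first.
    apply/funext => z; rewrite -EFinM; congr EFin.
    rewrite weight_powR ?gt_eqF ?mulr_gt0// weightM -EE cmod_rho2C.
    rewrite [weight (e1 * q) u]/weight u0 mulrA weightM addr0.
    by ring.
  rewrite ge0_integralZl_EFin ?powR_ge0//; first last.
  + apply/measurable_EFinP; apply: measurable_funM; first exact: measurable_weight.
    apply: measurable_powR_fun; exact: (measurable_fun_pair2 u (@measurable_rho2 R n.+1)).
  + by move=> z _; rewrite lee_fin mulr_ge0 ?weight_ge0 ?powR_ge0.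
  apply: (@le_trans _ _ ((rho u `^ (e1 * q))%:E * (CB * rho u `^ (n.+1%:R + 1 + E - t2 * q))%:E)).
    by apply: lee_wpmul2l; [rewrite lee_fin powR_ge0|exact: hB].
  rewrite -EFinM lee_fin mulrCA -powRD ?(gt_eqF u0) ?implybT//.
  (* By the homogeneity relation the powers of rho(u) cancel, so the second Schur integral is
     bounded by a constant. *)
  rewrite (_ : e1 * q + (n.+1%:R + 1 + E - t2 * q) = 0)%R ?powRr0 ?mulr1 ?lexx//.
  rewrite /t2 /t1 /E /e1 /e2 /A /B /p' /N cE; field.
  by rewrite !gt_eqF.
Qed.

End one_variable.

(** * From one variable to mixed norms *)

Section mixed_bound.
Context {R : realType}.
Variable n : nat.
Local Notation X := (pt R n.+1).
Local Notation V := (@pt_measure R n.+1).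
Local Open Scope ereal_scope.

Definition wmix (p1 p2 al1 al2 : R) (J : X * X -> \bar R) : \bar R :=
  (\int[V]_w ((weight al2 w)%:E *
     (\int[V]_z ((weight al1 z)%:E * J (z, w) `^ p1)) `^ (p2 / p1))) `^ p2^-1.

Definition double_op (a1 a2 b1 b2 c1 c2 : R) (h : X * X -> R) (zw : X * X) : \bar R :=
  \int[V]_eta ((bergman_kernel a2 b2 c2 (zw.2, eta))%:E *
    \int[V]_u ((bergman_kernel a1 b1 c1 (zw.1, u))%:E * (h (u, eta))%:E)).

Variables (p1 p2 q1 q2 a1 a2 b1 b2 c1 c2 al1 al2 be1 be2 : R).
Hypotheses (p1_gt1 : (1 < p1)%R) (p2_gt1 : (1 < p2)%R) (pq1 : (p1 <= q1)%R)
  (pq2 : (p2 <= q2)%R).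
Hypotheses (cond1 : cond3 n.+1 p1 q1 a1 b1 c1 al1 be1)
  (cond2 : cond3 n.+1 p2 q2 a2 b2 c2 al2 be2).
Local Notation K1 := (@bergman_kernel R n.+1 a1 b1 c1).
Local Notation K2 := (@bergman_kernel R n.+1 a2 b2 c2).

Let mw al : measurable_fun setT (EFin \o @weight R n.+1 al).
Proof. by apply/measurable_EFinP; exact: measurable_weight. Qed.

Let w0 al (u : X) : 0 <= (weight al u)%:E.
Proof. by rewrite lee_fin weight_ge0. Qed.

Lemma measurable_inner_op (h : X * X -> R) :
  measurable_fun setT h -> (forall x, 0 <= h x)%R ->
  measurable_fun setT (fun ze : X * X => \int[V]_u ((K1 (ze.1, u))%:E * (h (u, ze.2))%:E)).
Proof.
move=> mh h0.
apply: (@measurable_fun_fubini_tonelli_F _ _ _ _ _ V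
  (fun zeu : (X * X) * X => (K1 (zeu.1.1, zeu.2))%:E * (h (zeu.2, zeu.1.2))%:E)).
  apply: emeasurable_funM; apply/measurable_EFinP.
    apply: (measurableT_comp (@measurable_bergman_kernel _ _ _ _ _)).
    apply: measurable_fun_pair => //.
    by apply: (measurableT_comp measurable_fst); exact: measurable_fst.
  apply: (measurableT_comp mh).
  apply: measurable_fun_pair => //.
  by apply: (measurableT_comp measurable_snd); exact: measurable_fst.
by move=> x; rewrite mule_ge0// lee_fin// bergman_kernel_ge0.
Qed.

Lemma inner_op_ge0 (h : X * X -> R) z eta : (forall x, 0 <= h x)%R ->
  0 <= \int[V]_u ((K1 (z, u))%:E * (h (u, eta))%:E).
Proof.
move=> h0; apply: integral_ge0 => u _.
by rewrite mule_ge0// lee_fin ?bergman_kernel_ge0.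
Qed.

Lemma measurable_double_op (h : X * X -> R) :
  measurable_fun setT h -> (forall x, 0 <= h x)%R ->
  measurable_fun setT (double_op a1 a2 b1 b2 c1 c2 h).
Proof.
move=> mh h0.
apply: (@measurable_fun_fubini_tonelli_F _ _ _ _ _ V
  (fun zwe : (X * X) * X => (K2 (zwe.1.2, zwe.2))%:E *
    \int[V]_u ((K1 (zwe.1.1, u))%:E * (h (u, zwe.2))%:E))).
  apply: emeasurable_funM.
    apply/measurable_EFinP; apply: (measurableT_comp (@measurable_bergman_kernel _ _ _ _ _)).
    apply: measurable_fun_pair => //.
    by apply: (measurableT_comp measurable_snd); exact: measurable_fst.
  have mpair : measurable_fun setT (fun x : (X * X) * X => (x.1.1, x.2)).
    apply: measurable_fun_pair => //.
    by apply: (measurableT_comp measurable_fst); exact: measurable_fst.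
  exact: (measurableT_comp (measurable_inner_op mh h0) mpair).
by move=> x; rewrite mule_ge0 ?inner_op_ge0// lee_fin bergman_kernel_ge0.
Qed.

Lemma double_op_ge0 (h : X * X -> R) zw : (forall x, 0 <= h x)%R ->
  0 <= double_op a1 a2 b1 b2 c1 c2 h zw.
Proof.
move=> h0; apply: integral_ge0 => u _.
by rewrite mule_ge0 ?inner_op_ge0// lee_fin bergman_kernel_ge0.
Qed.

(** For fixed eta, the bound in the first variable controls the L^q1 norm of the inner integral by
    [g eta]. Minkowski's inequality with the kernel of the second variable as weight carries this
    norm under the integral over eta. What remains is the bound in the second variable, applied to
    N^(p2/p1), the p2-th power of N^(1/p1). *)
Lemma double_op_bound : exists2 C : R, (0 < C)%R & forall h : X * X -> R,
  measurable_fun setT h -> (forall x, 0 <= h x)%R ->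
  wmix q1 q2 be1 be2 (double_op a1 a2 b1 b2 c1 c2 h) <=
  C%:E * wmix p1 p2 al1 al2 (EFin \o h).
Proof.
have p10 : (0 < p1)%R by exact: lt_trans p1_gt1.
have p20 : (0 < p2)%R by exact: lt_trans p2_gt1.
have q10 : (0 < q1)%R by exact: lt_le_trans pq1.
have q20 : (0 < q2)%R by exact: lt_le_trans pq2.
have q11 : (1 < q1)%R by exact: lt_le_trans pq1.
have [C1 C10 hC1] := one_variable_bound p1_gt1 pq1 cond1.
have [C2 C20 hC2] := one_variable_bound p2_gt1 pq2 cond2.
exists (C1 `^ (q2 / q1 / q2) * C2 `^ q2^-1)%R; first by rewrite mulr_gt0 ?powR_gt0.
move=> h mh h0.
pose N eta := \int[V]_u ((weight al1 u)%:E * (h (u, eta))%:E `^ p1).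
pose H1 ze := \int[V]_u ((K1 (ze.1, u))%:E * (h (u, ze.2))%:E).
have h0E x : 0 <= (h x)%:E by rewrite lee_fin.
have mhE : measurable_fun setT (EFin \o h) by exact/measurable_EFinP.
have mhp eta : measurable_fun setT (fun u => (h (u, eta))%:E `^ p1).
  by apply: measurable_poweR_fun; exact: (measurable_fun_pair1 eta mhE).
have N0 eta : 0 <= N eta by apply: integral_ge0 => u _; rewrite mule_ge0 ?poweR_ge0.
have mN : measurable_fun setT N.
  apply: (@measurable_fun_fubini_tonelli_G _ _ _ _ _ V (fun ue : X * X =>
     (weight al1 ue.1)%:E * (h ue)%:E `^ p1)).
    apply: emeasurable_funM; last exact: measurable_poweR_fun.
    by apply: (measurableT_comp (mw _)); exact: measurable_fst.
  by move=> x; rewrite mule_ge0 ?poweR_ge0.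
have mH1 : measurable_fun setT H1 by exact: measurable_inner_op.
have H10 ze : 0 <= H1 ze by exact: inner_op_ge0.
have H1N eta : \int[V]_z ((weight be1 z)%:E * H1 (z, eta) `^ q1) <=
    C1%:E * N eta `^ (q1 / p1).
  have := hC1 (fun u => (h (u, eta))%:E `^ p1) (mhp eta) (fun u => poweR_ge0 _ _).
  under [X in X <= _ -> _]eq_integral => z _.
    under eq_integral => u _ do rewrite -poweRrM mulfV ?gt_eqF// poweRe1//.
    over.
  exact.
pose g eta := (C1 `^ q1^-1)%:E * N eta `^ p1^-1.
have g0 eta : 0 <= g eta by rewrite mule_ge0 ?poweR_ge0// lee_fin powR_ge0.
have mg : measurable_fun setT g.
  by apply: emeasurable_funM => //; exact: measurable_poweR_fun.
pose H (ze : X * X) := (weight be1 ze.1 `^ q1^-1)%:E * H1 ze.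
have mH : measurable_fun setT H.
  apply: emeasurable_funM => //; apply/measurable_EFinP; apply: measurable_powR_fun.
  by apply: (measurableT_comp (@measurable_weight R n.+1 be1)); exact: measurable_fst.
have H0 ze : 0 <= H ze by rewrite mule_ge0// lee_fin powR_ge0.
have Hq ze : H ze `^ q1 = (weight be1 ze.1)%:E * H1 ze `^ q1.
  rewrite poweRM ?lee_fin ?powR_ge0// poweR_EFin -powRrM mulVf ?gt_eqF// powRr1//.
  exact: weight_ge0.
have Hg eta : \int[V]_z H (z, eta) `^ q1 <= g eta `^ q1.
  under eq_integral do rewrite Hq.
  rewrite poweRM ?lee_fin ?powR_ge0 ?poweR_ge0// poweR_EFin -powRrM mulVf ?gt_eqF//.
  rewrite powRr1 ?(ltW C10)// -poweRrM (mulrC p1^-1%R); exact: H1N.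
(* [minkowski_integral] asks for vanishing at every point. If N(eta) = 0, then h(., eta) is 0 almost
   everywhere on T_B and the kernel is 0 elsewhere, so the integral vanishes for each z. *)
have N_eq0 z eta : N eta = 0 -> H1 (z, eta) = 0.
  move=> Neta; rewrite /H1/=.
  rewrite (ae_eq_integral (cst 0))//; first by rewrite integral0.
    apply: emeasurable_funM; apply/measurable_EFinP.
      exact: (measurable_fun_pair2 z (@measurable_bergman_kernel _ _ _ _ _)).
    exact: (measurable_fun_pair1 eta mh).
  have mint : measurable_fun setT (fun u => (weight al1 u)%:E * (h (u, eta))%:E `^ p1).
    by apply: emeasurable_funM => //; exact: mw.
  have : \int[V]_u `|(weight al1 u)%:E * (h (u, eta))%:E `^ p1| = 0.
    by under eq_integral do rewrite gee0_abs ?mule_ge0 ?poweR_ge0//.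
  move/(ae_eq_integral_abs V measurableT mint).
  apply: filterS => u /(_ I)/= wh _.
  rewrite /bergman_kernel/=.
  have [u0|u0] := ltP 0%R (rho u); last by rewrite (weight_le0 _ u0) mul0r mulr0 mul0e.
  move: wh => /eqP; rewrite -EFinM eqe mulf_eq0 /weight u0 !powR_eq0 (gt_eqF u0)/=.
  rewrite (gt_eqF p10) andbT => /eqP ->.
  by rewrite mule0.
have gH z eta : g eta = 0 -> H (z, eta) = 0.
  move=> /eqP; rewrite mule_eq0 eqe gt_eqF ?powR_gt0//= => /eqP.
  by move=> /(poweR_eq0_eq0 (N0 _)) /N_eq0 E; rewrite /H E mule0.
pose J := double_op a1 a2 b1 b2 c1 c2 h.
have mK2 w : measurable_fun setT (fun eta => K2 (w, eta)).
  exact: (measurable_fun_pair2 w (@measurable_bergman_kernel _ _ _ _ _)).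
have inner w : (\int[V]_z ((weight be1 z)%:E * J (z, w) `^ q1)) `^ (q2 / q1) <=
   (\int[V]_eta ((K2 (w, eta))%:E * g eta)) `^ q2.
  have IK0 : 0 <= \int[V]_eta ((K2 (w, eta))%:E * g eta).
    by apply: integral_ge0 => eta _; rewrite mule_ge0// lee_fin bergman_kernel_ge0.
  have -> : (\int[V]_eta ((K2 (w, eta))%:E * g eta)) `^ q2 =
     ((\int[V]_eta ((K2 (w, eta))%:E * g eta)) `^ q1) `^ (q2 / q1).
    by rewrite -poweRrM; congr (_ `^ _); field; rewrite gt_eqF.
  apply: le_poweR.
  - by rewrite divr_ge0// ltW.
  - by apply: integral_ge0 => z _; rewrite mule_ge0 ?poweR_ge0.
  have := @minkowski_integral _ _ _ _ R V V q1 (fun eta => K2 (w, eta)) g H q11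
    (mK2 w) (fun _ => bergman_kernel_ge0 _ _ _ _) mg g0 mH H0 Hg gH.
  apply: le_trans; rewrite le_eqVlt; apply/orP; left; apply/eqP.
  apply: eq_integral => z _.
  have -> : \int[V]_eta ((K2 (w, eta))%:E * H (z, eta)) =
     (weight be1 z `^ q1^-1)%:E * J (z, w).
    under eq_integral do rewrite /H [(_, _).1]/= muleCA.
    rewrite ge0_integralZl_EFin ?powR_ge0//.
      by move=> eta _; rewrite mule_ge0// lee_fin bergman_kernel_ge0.
    apply: emeasurable_funM; first exact/measurable_EFinP.
    exact: (measurable_fun_pair2 z mH1).
  rewrite poweRM ?lee_fin ?powR_ge0 ?double_op_ge0// poweR_EFin -powRrM mulVf ?gt_eqF//.
  by rewrite powRr1 ?weight_ge0.
have := hC2 (fun eta => N eta `^ (p2 / p1)) (measurable_poweR_fun _ mN) (fun u => poweR_ge0 _ _).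
under [X in X <= _ -> _]eq_integral => z _.
  under eq_integral => u _ do rewrite -poweRrM mulrAC mulfV ?gt_eqF// mul1r.
  over.
move=> outer.
rewrite /wmix -/J.
apply: (@le_trans _ _ (((C1 `^ (q2 / q1))%:E * (C2%:E *
    (\int[V]_u ((weight al2 u)%:E * N u `^ (p2 / p1))) `^ (q2 / p2))) `^ q2^-1)).
  apply: le_poweR; first by rewrite invr_ge0 ltW.
    by apply: integral_ge0 => w _; rewrite mule_ge0 ?poweR_ge0.
  apply: (@le_trans _ _ ((C1 `^ (q2 / q1))%:E * \int[V]_z
      ((weight be2 z)%:E * (\int[V]_u ((K2 (z, u))%:E * N u `^ p1^-1)) `^ q2))); last first.
    by apply: lee_wpmul2l => //; rewrite lee_fin powR_ge0.
  rewrite -ge0_integralZl_EFin ?powR_ge0//; first last.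
  - apply: emeasurable_funM; first exact: mw. apply: measurable_poweR_fun.
    apply: (@measurable_fun_fubini_tonelli_F _ _ _ _ _ V
      (fun we : X * X => (K2 we)%:E * N we.2 `^ p1^-1)).
      apply: emeasurable_funM.
        by apply/measurable_EFinP; exact: measurable_bergman_kernel.
      by apply: (measurableT_comp (measurable_poweR_fun p1^-1 mN)); exact: measurable_snd.
    by move=> x; rewrite mule_ge0 ?poweR_ge0// lee_fin bergman_kernel_ge0.
  - by move=> w _; rewrite mule_ge0 ?poweR_ge0.
  apply: le_integralT => w; first by rewrite mule_ge0 ?poweR_ge0.
  rewrite muleCA; apply: lee_wpmul2l => //.
  apply: (le_trans (inner w)); rewrite le_eqVlt; apply/orP; left; apply/eqP.
  under eq_integral do rewrite /g muleCA.
  rewrite ge0_integralZl_EFin ?powR_ge0//; first last.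
  - by apply: emeasurable_funM; [exact/measurable_EFinP|exact: measurable_poweR_fun].
  - by move=> eta _; rewrite mule_ge0 ?poweR_ge0// lee_fin bergman_kernel_ge0.
  rewrite poweRM ?lee_fin ?powR_ge0//; last first.
    by apply: integral_ge0 => eta _; rewrite mule_ge0 ?poweR_ge0// lee_fin bergman_kernel_ge0.
  by rewrite poweR_EFin -powRrM (mulrC _ q2).
rewrite muleA -EFinM poweRM ?poweR_ge0 ?lee_fin ?mulr_ge0 ?powR_ge0 ?(ltW C20)//.
rewrite poweR_EFin powRM ?powR_ge0 ?(ltW C20)// -powRrM -poweRrM.
have -> : (q2 / p2 / q2 = p2^-1)%R by field; rewrite !gt_eqF.
by [].
Qed.

End mixed_bound.

(** * Monotonicity of integrals over the domain *)

Section tube_integrals.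
Context {R : realType}.
Local Open Scope ereal_scope.
Local Notation V n := (@pt_measure R n).

Lemma intTB_weight n al (g : pt R n -> \bar R) :
  intTB al g = intV (fun z => (weight al z)%:E * g z).
Proof.
congr intV; apply/funext => z; rewrite /inTB /weight; case: ifP => //.
by rewrite mul0e.
Qed.

Lemma intTBE n al (g : pt R n -> \bar R) :
  measurable_fun setT g -> (forall z, 0 <= g z) ->
  intTB al g = \int[V n]_z ((weight al z)%:E * g z).
Proof.
move=> mg g0; rewrite intTB_weight intVE//.
  by apply: emeasurable_funM => //; apply/measurable_EFinP; exact: measurable_weight.
by move=> z; rewrite mule_ge0// lee_fin weight_ge0.
Qed.

Lemma intV_ge0 n (g : pt R n -> \bar R) : (forall z, 0 <= g z) -> 0 <= intV g.
Proof. by move=> g0; apply: iint_ge0 => x; apply: iint_ge0 => y. Qed.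

Lemma le_intV n (g h : pt R n -> \bar R) : (forall z, 0 <= g z) ->
  (forall z, g z <= h z) -> intV g <= intV h.
Proof.
move=> g0 gh; apply: le_iint => x; first exact: iint_ge0.
exact: le_iint.
Qed.

Lemma intTB_ge0 n al (g : pt R n -> \bar R) : (forall z, (0 < rho z)%R -> 0 <= g z) ->
  0 <= intTB al g.
Proof.
move=> g0; apply: intV_ge0 => z; rewrite /inTB; case: ifP => // z0.
by rewrite mule_ge0 ?g0// lee_fin powR_ge0.
Qed.

Lemma le_intTB n al (g h : pt R n -> \bar R) : (forall z, (0 < rho z)%R -> 0 <= g z) ->
  (forall z, (0 < rho z)%R -> g z <= h z) -> intTB al g <= intTB al h.
Proof.
move=> g0 gh; apply: le_intV => z; rewrite /inTB; case: ifP => // z0.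
  by rewrite mule_ge0 ?g0// lee_fin powR_ge0.
by rewrite lee_wpmul2l ?gh// lee_fin powR_ge0.
Qed.

Lemma eq_intTB n al (g h : pt R n -> \bar R) : (forall z, (0 < rho z)%R -> g z = h z) ->
  intTB al g = intTB al h.
Proof.
move=> gh; congr intV; apply/funext => z; rewrite /inTB; case: ifP => // z0.
by rewrite gh.
Qed.

Lemma intTB2_ge0 n (g : pt R n -> pt R n -> \bar R) :
  (forall u eta, (0 < rho u)%R -> (0 < rho eta)%R -> 0 <= g u eta) -> 0 <= intTB2 g.
Proof. by move=> g0; apply: intTB_ge0 => eta e0; apply: intTB_ge0 => u u0; exact: g0. Qed.

Lemma le_intTB2 n (g h : pt R n -> pt R n -> \bar R) :
  (forall u eta, (0 < rho u)%R -> (0 < rho eta)%R -> 0 <= g u eta) ->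
  (forall u eta, (0 < rho u)%R -> (0 < rho eta)%R -> g u eta <= h u eta) ->
  intTB2 g <= intTB2 h.
Proof.
move=> g0 gh; apply: le_intTB => eta e0.
  by apply: intTB_ge0 => u u0; exact: g0.
by apply: le_intTB => u u0; [exact: g0|exact: gh].
Qed.

(** The integrals of the positive and of the negative part both lie between 0 and the integral of
    [G], hence so does the modulus of their difference. Only monotonicity enters. *)
Lemma norm_rint2_le n (g : pt R n -> pt R n -> R) (G : pt R n -> pt R n -> R) :
  (forall u eta, 0 < rho u -> 0 < rho eta -> `|g u eta| <= G u eta)%R ->
  (`|rint2 g|)%:E <= intTB2 (fun u eta => (G u eta)%:E).
Proof.
move=> gG.
have max0 (x : R) : (0 <= Num.max x 0)%R by rewrite le_max lexx orbT.
have I0 : 0 <= intTB2 (fun u eta => (G u eta)%:E).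
  by apply: intTB2_ge0 => u eta u0 e0; rewrite lee_fin (le_trans _ (gG _ _ u0 e0)).
have A0 : 0 <= intTB2 (fun u eta => (Num.max (g u eta) 0)%:E).
  by apply: intTB2_ge0 => u eta _ _; rewrite lee_fin.
have B0 : 0 <= intTB2 (fun u eta => (Num.max (- g u eta) 0)%:E).
  by apply: intTB2_ge0 => u eta _ _; rewrite lee_fin.
have AI : intTB2 (fun u eta => (Num.max (g u eta) 0)%:E) <= intTB2 (fun u eta => (G u eta)%:E).
  apply: le_intTB2 => u eta u0 e0; first by rewrite lee_fin.
  have := gG _ _ u0 e0; rewrite lee_fin ge_max => h; apply/andP; split.
    by apply: le_trans h; exact: ler_norm.
  by apply: le_trans h; exact: normr_ge0.
have BI : intTB2 (fun u eta => (Num.max (- g u eta) 0)%:E) <= intTB2 (fun u eta => (G u eta)%:E).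
  apply: le_intTB2 => u eta u0 e0; first by rewrite lee_fin.
  have := gG _ _ u0 e0; rewrite lee_fin ge_max => h; apply/andP; split.
    by apply: le_trans h; rewrite -normrN; exact: ler_norm.
  by apply: le_trans h; exact: normr_ge0.
rewrite /rint2.
have [->|Iy] := eqVneq (intTB2 (fun u eta => (G u eta)%:E)) +oo; first exact: leey.
have Ifin : intTB2 (fun u eta => (G u eta)%:E) \is a fin_num by rewrite ge0_fin_numE// ltey.
have fin x : 0 <= x -> x <= intTB2 (fun u eta => (G u eta)%:E) -> x \is a fin_num.
  by move=> x0 xI; rewrite ge0_fin_numE//; apply: le_lt_trans xI _; rewrite ltey.
have Af := fin _ A0 AI; have Bf := fin _ B0 BI.
move: A0 B0 AI BI; rewrite -(fineK Ifin) -(fineK Af) -(fineK Bf) !lee_fin.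
move=> A0 B0 AI BI; rewrite ler_norml; apply/andP; split; lra.
Qed.

End tube_integrals.

(** * Boundedness under the three conditions *)

Section sufficiency.
Context {R : realType}.
Variable n : nat.
Local Notation X := (pt R n.+1).
Local Notation V := (@pt_measure R n.+1).
Local Open Scope ereal_scope.

Lemma measurable_cmod (f : X -> X -> R[i]) : cmeasurable f ->
  measurable_fun setT (fun zw : X * X => cmod (f zw.1 zw.2)).
Proof.
move=> [mRe mIm].
apply: (measurableT_comp (continuous_measurable_fun (@sqrt_continuous R))).
by apply: measurable_funD; apply: measurable_funX.
Qed.

Lemma mixintE (p1 p2 al1 al2 : R) (J : X * X -> \bar R) :
  measurable_fun setT J -> (forall zw, 0 <= J zw) ->
  (intTB al2 (fun w => (intTB al1 (fun z => J (z, w) `^ p1)) `^ (p2 / p1))) `^ p2^-1 =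
  wmix p1 p2 al1 al2 J.
Proof.
move=> mJ J0.
have mJp : measurable_fun setT (fun zw : X * X => (weight al1 zw.1)%:E * J zw `^ p1).
  apply: emeasurable_funM; last exact: measurable_poweR_fun.
  apply/measurable_EFinP; apply: (measurableT_comp (@measurable_weight _ _ _)).
  exact: measurable_fst.
have Jp0 zw : 0 <= (weight al1 zw.1)%:E * J zw `^ p1.
  by rewrite mule_ge0 ?poweR_ge0// lee_fin weight_ge0.
have E w : intTB al1 (fun z => J (z, w) `^ p1) =
    \int[V]_z ((weight al1 z)%:E * J (z, w) `^ p1).
  rewrite intTBE//.
    by apply: measurable_poweR_fun; exact: (measurable_fun_pair1 w mJ).
  by move=> z; exact: poweR_ge0.
rewrite (_ : (fun w => _) = (fun w =>
   (\int[V]_z ((weight al1 z)%:E * J (z, w) `^ p1)) `^ (p2 / p1))).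
  rewrite intTBE//.
    apply: measurable_poweR_fun.
    exact: (@measurable_fun_fubini_tonelli_G _ _ _ _ _ V _ mJp Jp0).
  by move=> w; exact: poweR_ge0.
by apply/funext => w; rewrite E.
Qed.

Variables (a1 a2 b1 b2 c1 c2 : R).

(** The modulus common to S and T; absolute convergence and upper bounds see nothing else of the
    kernel. *)
Definition dominated_kernel (K : X -> X -> X -> X -> R[i]) :=
  forall z w u eta, (0 < rho z)%R -> (0 < rho w)%R -> (0 < rho u)%R -> (0 < rho eta)%R ->
  cmod (K z w u eta) = (rho u `^ b1 * rho eta `^ b2 /
    (cmod (rho2 z u) `^ c1 * cmod (rho2 w eta) `^ c2))%R.

Variable K : X -> X -> X -> X -> R[i].
Hypothesis HK : dominated_kernel K.

(** Up to the outer factor, [double_op] at |f| is the integral whose finiteness is [converges]. A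
    bound on [double_op] thus serves both requirements of [bounded_op]. *)
Lemma double_opE (f : X -> X -> R[i]) z w : cmeasurable f ->
  (0 < rho z)%R -> (0 < rho w)%R ->
  double_op a1 a2 b1 b2 c1 c2 (fun ue => cmod (f ue.1 ue.2)) (z, w) =
  (rho z `^ a1 * rho w `^ a2)%:E *
    intTB2 (fun u eta => (cmod (K z w u eta * f u eta))%:E).
Proof.
move=> mf z0 w0; have mh := measurable_cmod mf.
pose k (v u : X) b c := (weight b u * cmod (rho2 v u) `^ (- c))%R.
have k0 v u b c : (0 <= k v u b c)%R by rewrite mulr_ge0 ?weight_ge0 ?powR_ge0.
have mk b c : measurable_fun setT (fun vu : X * X => k vu.1 vu.2 b c).
  apply: measurable_funM.
    by apply: (measurableT_comp (@measurable_weight _ _ _)); exact: measurable_snd.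
  by apply: measurable_powR_fun; exact: measurable_rho2.
have mkz v b c : measurable_fun setT (fun u => k v u b c).
  exact: (measurable_fun_pair2 v (mk b c)).
have bkE a b c v u : (0 < rho v)%R -> bergman_kernel a b c (v, u) = (rho v `^ a * k v u b c)%R.
  by move=> v0; rewrite /bergman_kernel/= {1}/weight v0.
have mhe eta : measurable_fun setT (fun u => (cmod (f u eta))%:E).
  by apply/measurable_EFinP; exact: (measurable_fun_pair1 eta mh).
have mI : measurable_fun setT (fun eta : X => \int[V]_u ((k z u b1 c1)%:E * (cmod (f u eta))%:E)).
  apply: (@measurable_fun_fubini_tonelli_G _ _ _ _ _ V (fun ue : X * X =>
    (k z ue.1 b1 c1)%:E * (cmod (f ue.1 ue.2))%:E)).
    apply: emeasurable_funM; apply/measurable_EFinP => //.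
    by apply: (measurableT_comp (mkz z b1 c1)); exact: measurable_fst.
  by move=> x; rewrite mule_ge0// lee_fin// cmod_ge0.
have I0 eta : 0 <= \int[V]_u ((k z u b1 c1)%:E * (cmod (f u eta))%:E).
  by apply: integral_ge0 => u _; rewrite mule_ge0// lee_fin// cmod_ge0.
have inner a v eta : (0 < rho v)%R ->
  \int[V]_u ((bergman_kernel a b1 c1 (v, u))%:E * (cmod (f u eta))%:E) =
  (rho v `^ a)%:E * \int[V]_u ((k v u b1 c1)%:E * (cmod (f u eta))%:E).
  move=> v0; under eq_integral => u _ do rewrite bkE// EFinM -muleA.
  rewrite ge0_integralZl_EFin ?powR_ge0//.
    by move=> u _; rewrite mule_ge0// lee_fin// cmod_ge0.
  by apply: emeasurable_funM => //; exact/measurable_EFinP.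
rewrite /double_op/=.
under eq_integral => eta _ do rewrite inner// bkE// EFinM muleACA -EFinM.
rewrite ge0_integralZl_EFin ?mulr_ge0 ?powR_ge0//; first last.
- by apply: emeasurable_funM => //; exact/measurable_EFinP.
- by move=> eta _; rewrite mule_ge0// lee_fin.
rewrite mulrC; congr (_ * _).
have E eta : (0 < rho eta)%R -> intTB 0 (fun u => (cmod (K z w u eta * f u eta))%:E) =
   (rho eta `^ b2 * cmod (rho2 w eta) `^ (- c2))%:E *
   \int[V]_u ((k z u b1 c1)%:E * (cmod (f u eta))%:E).
  move=> e0.
  rewrite (@eq_intTB _ _ _ _ (fun u => (rho eta `^ b2 * cmod (rho2 w eta) `^ (- c2))%:E *
    ((k z u b1 c1)%:E * (cmod (f u eta))%:E))); last first.
    move=> u u0; rewrite cmodM HK// -!EFinM; congr EFin.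
    by rewrite /k /weight u0 !powRN invfM; ring.
  rewrite intTBE//; first last.
  - move=> u; apply: mule_ge0; first by rewrite lee_fin mulr_ge0 ?powR_ge0.
    by rewrite mule_ge0// lee_fin// cmod_ge0.
  - apply: emeasurable_funM => //; apply: emeasurable_funM => //.
    exact/measurable_EFinP.
  rewrite -ge0_integralZl_EFin ?mulr_ge0 ?powR_ge0//; first last.
  - by apply: emeasurable_funM => //; exact/measurable_EFinP.
  - by move=> u _; rewrite mule_ge0// lee_fin// cmod_ge0.
  apply: eq_integral => u _.
  by rewrite /k/= -!EFinM; congr EFin; rewrite -[in RHS](add0r b1) -weightM; ring.
rewrite /intTB2 (eq_intTB _ E) intTB_weight intVE.
- apply: eq_integral => eta _; rewrite muleA -EFinM; congr (EFin _ * _).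
  rewrite /k /weight; case: ifPn => e0; last by rewrite !mul0r.
  by rewrite powRr0 mul1r.
- apply: emeasurable_funM; first by apply/measurable_EFinP; exact: measurable_weight.
  apply: emeasurable_funM => //; apply/measurable_EFinP; apply: measurable_funM.
    by apply: measurable_powR_fun; exact: measurable_rho.
  apply: measurable_powR_fun; exact: (measurable_fun_pair2 w (@measurable_rho2 _ _)).
- by move=> eta; rewrite !mule_ge0// lee_fin ?weight_ge0// mulr_ge0 ?powR_ge0.
Qed.

(** Real and imaginary part are each bounded by the absolute integral, whence the factor 2. *)
Lemma cmod_intop_le (f : X -> X -> R[i]) z w : cmeasurable f ->
  (0 < rho z)%R -> (0 < rho w)%R ->
  (cmod (intop a1 a2 K f z w))%:E <=
  2%:E * double_op a1 a2 b1 b2 c1 c2 (fun ue => cmod (f ue.1 ue.2)) (z, w).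
Proof.
move=> mf z0 w0; rewrite double_opE// /intop cmodM cmod_real ?mulr_ge0 ?powR_ge0//.
rewrite muleCA EFinM; apply: lee_wpmul2l; first by rewrite lee_fin mulr_ge0 ?powR_ge0.
set I := intTB2 _.
apply: (@le_trans _ _ (`|rint2 (fun u eta => complex.Re (K z w u eta * f u eta))|%:E +
    `|rint2 (fun u eta => complex.Im (K z w u eta * f u eta))|%:E)).
  by rewrite -EFinD lee_fin; exact: cmod_le.
have -> : 2%:E * I = I + I.
  rewrite (_ : 2%:E = 1 + 1); last by rewrite -EFinD; congr EFin; ring.
  by rewrite ge0_muleDl// !mul1e.
by apply: leeD; apply: norm_rint2_le => u eta _ _; [exact: cmod_Re|exact: cmod_Im].
Qed.

Variables (p1 p2 q1 q2 al1 al2 be1 be2 : R).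
Hypotheses (p1_gt1 : (1 < p1)%R) (p2_gt1 : (1 < p2)%R) (pq1 : (p1 <= q1)%R)
  (pq2 : (p2 <= q2)%R).
Hypotheses (cond1 : cond3 n.+1 p1 q1 a1 b1 c1 al1 be1)
  (cond2 : cond3 n.+1 p2 q2 a2 b2 c2 al2 be2).

Lemma ae_fin_zero (g : X -> \bar R) : measurable_fun setT g -> (forall z, 0 <= g z) ->
  \int[V]_z g z < +oo -> {ae V, forall z, g z < +oo}.
Proof.
move=> mg g0 Ig.
have : V.-integrable setT g.
  by apply/integrableP; split => //; under eq_integral do rewrite gee0_abs//.
move/(integrable_ae measurableT); apply: filterS => z /(_ I).
by rewrite ge0_fin_numE.
Qed.

(** Finiteness descends through the two layers: the outer integrand is finite for almost every w,
    then the inner one for almost every z. The set is confined to the domain because the weights are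
    positive exactly there. *)
Lemma wmix_lty_null (J : X * X -> \bar R) : measurable_fun setT J ->
  (forall zw, 0 <= J zw) -> wmix q1 q2 be1 be2 J < +oo ->
  null2 [set zw | (0 < rho zw.1)%R /\ (0 < rho zw.2)%R /\ J zw = +oo].
Proof.
have p10 : (0 < p1)%R by exact: lt_trans p1_gt1.
have p20 : (0 < p2)%R by exact: lt_trans p2_gt1.
have q10 : (0 < q1)%R by exact: lt_le_trans pq1.
have q20 : (0 < q2)%R by exact: lt_le_trans pq2.
move=> mJ J0 Jfin.
set N := [set zw | _].
have mN : measurable N.
  have -> : N = ((@rho R n.+1 \o fst) @^-1` `]0%R, +oo[) `&`
      (((@rho R n.+1 \o snd) @^-1` `]0%R, +oo[) `&` (J @^-1` [set +oo])).
    by apply/seteqP; split => zw /=; rewrite !in_itv/= !andbT.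
  have mr1 : measurable_fun setT (@rho R n.+1 \o fst : X * X -> R).
    by apply: measurableT_comp; [exact: measurable_rho|exact: measurable_fst].
  have mr2 : measurable_fun setT (@rho R n.+1 \o snd : X * X -> R).
    by apply: measurableT_comp; [exact: measurable_rho|exact: measurable_snd].
  apply: measurableI; first by rewrite -[X in measurable X]setTI; apply: mr1 => //; exact: measurable_itv.
  apply: measurableI; first by rewrite -[X in measurable X]setTI; apply: mr2 => //; exact: measurable_itv.
  by rewrite -[X in measurable X]setTI; apply: mJ.
split => //.
have m1 : measurable_fun setT (fun zw : X * X => (\1_N zw : R)%:E).
  by apply/measurable_EFinP; exact: measurable_indic.
have i0 (zw : X * X) : 0 <= (\1_N zw : R)%:E by rewrite lee_fin indicE ler0n.
pose D (zw : X * X) := (weight be1 zw.1)%:E * J zw `^ q1.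
have mD : measurable_fun setT D.
  apply: emeasurable_funM; last exact: measurable_poweR_fun.
  apply/measurable_EFinP; apply: (measurableT_comp (@measurable_weight _ _ _)).
  exact: measurable_fst.
have D0 zw : 0 <= D zw by rewrite mule_ge0 ?poweR_ge0// lee_fin weight_ge0.
have ID0 w : 0 <= \int[V]_z D (z, w) by apply: integral_ge0.
have IV w : intV (fun z => (\1_N (z, w) : R)%:E) = \int[V]_z (\1_N (z, w) : R)%:E.
  rewrite intVE//; first exact: (measurable_fun_pair1 w m1).
have -> : (fun w => intV (fun z => (\1_N (z, w) : R)%:E)) =
   (fun w => \int[V]_z (\1_N (z, w) : R)%:E).
  by apply/funext => w; exact: IV.
have mI : measurable_fun setT (fun w : X => \int[V]_z (\1_N (z, w) : R)%:E).
  exact: (@measurable_fun_fubini_tonelli_G _ _ _ _ _ V _ m1 i0).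
rewrite intVE//; last by move=> w; exact: integral_ge0.
rewrite (ae_eq_integral (cst 0))//; first by rewrite integral0.
have outer : {ae V, forall w, (weight be2 w)%:E * (\int[V]_z D (z, w)) `^ (q2 / q1) < +oo}.
  apply: ae_fin_zero.
  - apply: emeasurable_funM; first by apply/measurable_EFinP; exact: measurable_weight.
    apply: measurable_poweR_fun.
    exact: (@measurable_fun_fubini_tonelli_G _ _ _ _ _ V _ mD D0).
  - by move=> w; rewrite mule_ge0 ?poweR_ge0// lee_fin weight_ge0.
  - by apply: lty_poweRy Jfin; rewrite gt_eqF// invr_gt0.
apply: filterS outer => w hw _.
have [w0|w0] := ltP 0%R (rho w); last first.
  rewrite integral0_eq// => z _; rewrite indicE memNset// => -[_ [/= +]].
  by rewrite ltNge w0.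
have Dw : \int[V]_z D (z, w) < +oo.
  apply: (@lty_poweRy _ _ (q2 / q1)); first by rewrite gt_eqF// divr_gt0.
  rewrite ltey; apply: contraTN hw => /eqP ->.
  by rewrite /weight w0 gt0_muley ?ltxx// lte_fin powR_gt0.
rewrite (ae_eq_integral (cst 0))//; first by rewrite integral0.
  exact: (measurable_fun_pair1 w m1).
have := ae_fin_zero (measurable_fun_pair1 w mD) (fun z => D0 (z, w)) Dw.
apply: filterS => z hz _.
rewrite /= indicE memNset// => -[/= z0 [_ Jy]].
move: hz; rewrite /D/= Jy poweRyr ?gt_eqF// /weight z0 gt0_muley ?ltxx//.
by rewrite lte_fin powR_gt0.
Qed.

Theorem bounded_op_of_cond3 : bounded_op a1 a2 K p1 p2 al1 al2 q1 q2 be1 be2.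
Proof.
have p10 : (0 < p1)%R by exact: lt_trans p1_gt1.
have p20 : (0 < p2)%R by exact: lt_trans p2_gt1.
have q10 : (0 < q1)%R by exact: lt_le_trans pq1.
have q20 : (0 < q2)%R by exact: lt_le_trans pq2.
have [C C0 hC] := double_op_bound p1_gt1 p2_gt1 pq1 pq2 cond1 cond2.
exists (2 * C)%R => f [mf fL].
have mh := measurable_cmod mf.
have h0 (x : X * X) : (0 <= cmod (f x.1 x.2))%R by exact: cmod_ge0.
have mixE : mixnorm p1 p2 al1 al2 f = wmix p1 p2 al1 al2
    (EFin \o (fun ue : X * X => cmod (f ue.1 ue.2))).
  by rewrite -mixintE//; exact/measurable_EFinP.
have := hC _ mh h0; rewrite -mixE => bound.
pose J := double_op a1 a2 b1 b2 c1 c2 (fun ue : X * X => cmod (f ue.1 ue.2)).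
have mJ : measurable_fun setT J by exact: measurable_double_op.
have J0 zw : 0 <= J zw by exact: double_op_ge0.
have Jfin : wmix q1 q2 be1 be2 J < +oo.
  by apply: le_lt_trans bound _; rewrite lte_mul_pinfty// lee_fin ltW.
split.
  exists [set zw | (0 < rho zw.1)%R /\ (0 < rho zw.2)%R /\ J zw = +oo].
  split; first exact: wmix_lty_null.
  move=> z w z0 w0 /= nJ.
  have Jzw : J (z, w) < +oo.
    by rewrite ltey; apply/eqP => Jy; apply: nJ.
  rewrite /converges ltey; apply: contraTN Jzw => /eqP Iy.
  rewrite /J double_opE// Iy gt0_muley ?ltxx// lte_fin.
  by rewrite mulr_gt0 ?powR_gt0.
apply: (@le_trans _ _ (2%:E * wmix q1 q2 be1 be2 J)); last first.
  by rewrite EFinM -muleA; apply: lee_wpmul2l.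
(* The factor 2 goes inside the norm since [cmod_intop_le] is pointwise; homogeneity of the norm
   takes it out again. *)
apply: (@le_trans _ _ (wmix q1 q2 be1 be2 (fun zw => 2%:E * J zw))).
  rewrite -mixintE; last 2 first.
  - exact: measurable_funeM.
  - by move=> zw; rewrite mule_ge0.
  rewrite /mixnorm; apply: le_poweR; first by rewrite invr_ge0 ltW.
    by apply: intTB_ge0 => w _; exact: poweR_ge0.
  apply: le_intTB => w w0; first exact: poweR_ge0.
  apply: le_poweR; first by rewrite divr_ge0// ltW.
    by apply: intTB_ge0 => z _; rewrite lee_fin powR_ge0.
  apply: le_intTB => z z0; first by rewrite lee_fin powR_ge0.
  rewrite -poweR_EFin; apply: le_poweR; first exact: ltW.
    by rewrite lee_fin cmod_ge0.
  exact: cmod_intop_le.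
have mD : measurable_fun setT (fun zw : X * X => (weight be1 zw.1)%:E * J zw `^ q1).
  apply: emeasurable_funM; last exact: measurable_poweR_fun.
  apply/measurable_EFinP; apply: (measurableT_comp (@measurable_weight _ _ _)).
  exact: measurable_fst.
have D0 (zw : X * X) : 0 <= (weight be1 zw.1)%:E * J zw `^ q1.
  by rewrite mule_ge0 ?poweR_ge0// lee_fin weight_ge0.
have inner w : \int[V]_z ((weight be1 z)%:E * (2%:E * J (z, w)) `^ q1) =
    (2 `^ q1)%:E * \int[V]_z ((weight be1 z)%:E * J (z, w) `^ q1).
  under eq_integral do rewrite poweRM// poweR_EFin muleCA.
  rewrite ge0_integralZl_EFin ?powR_ge0//.
    by move=> z _; exact: (D0 (z, w)).
  exact: (measurable_fun_pair1 w mD).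
rewrite /wmix; under eq_integral do rewrite inner.
have ID0 w : 0 <= \int[V]_z ((weight be1 z)%:E * J (z, w) `^ q1).
  by apply: integral_ge0 => z _; exact: (D0 (z, w)).
under eq_integral do rewrite poweRM ?lee_fin ?powR_ge0// poweR_EFin -powRrM muleCA.
rewrite ge0_integralZl_EFin ?powR_ge0//; first last.
- apply: emeasurable_funM; first by apply/measurable_EFinP; exact: measurable_weight.
  apply: measurable_poweR_fun.
  exact: (@measurable_fun_fubini_tonelli_G _ _ _ _ _ V _ mD D0).
- by move=> w _; rewrite mule_ge0 ?poweR_ge0// lee_fin weight_ge0.
rewrite poweRM ?lee_fin ?powR_ge0//; last first.
  by apply: integral_ge0 => w _; rewrite mule_ge0 ?poweR_ge0// lee_fin weight_ge0.
rewrite poweR_EFin -powRrM (_ : q1 * (q2 / q1) * q2^-1 = 1)%R ?powRr1//.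
by field; rewrite !gt_eqF.
Qed.

End sufficiency.

(** * Necessity *)

Section kernels.
Context {R : realType}.
Variables (n : nat) (b1 b2 c1 c2 : R).
Local Notation X := (pt R n.+1).
Local Notation Re := complex.Re.
Local Notation Im := complex.Im.

(* Holds for |K| and for K with a common constant: the argument of K is small
   where those of [rho2 z u] and [rho2 w eta] are. *)
Definition sectorial (K : X -> X -> X -> X -> R[i]) := exists2 d : R, 0 < d &
  forall z w u eta, 0 < rho z -> 0 < rho w -> 0 < rho u -> 0 < rho eta ->
  `|Im (rho2 z u)| <= d * Re (rho2 z u) ->
  `|Im (rho2 w eta)| <= d * Re (rho2 w eta) ->
  cmod (K z w u eta) <= 2 * Re (K z w u eta).

Lemma dominated_kerS : dominated_kernel b1 b2 c1 c2 (@kerS R n.+1 b1 b2 c1 c2).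
Proof.
move=> z w u eta z0 w0 u0 e0; rewrite /kerS cmod_real//.
by rewrite divr_ge0 ?mulr_ge0 ?powR_ge0.
Qed.

Lemma sectorial_kerS : sectorial (@kerS R n.+1 b1 b2 c1 c2).
Proof.
exists 1 => // z w u eta z0 w0 u0 e0 _ _.
have k0 : 0 <= rho u `^ b1 * rho eta `^ b2 /
   (cmod (rho2 z u) `^ c1 * cmod (rho2 w eta) `^ c2).
  by rewrite divr_ge0 ?mulr_ge0 ?powR_ge0.
by rewrite /kerS cmod_real// ler_peMl// ler1n.
Qed.

Definition unit_circle (t : R) : R[i] := (cos t +i* sin t)%C.

Lemma cmod_unit_circle t : cmod (unit_circle t) = 1.
Proof. by rewrite /cmod/= cos2Dsin2 sqrtr1. Qed.

Lemma unit_circleD s t : unit_circle s * unit_circle t = unit_circle (s + t).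
Proof.
apply/eqP; rewrite eq_complex/= cosD sinD; apply/andP; split; apply/eqP; ring.
Qed.

Lemma unit_circleV t : (unit_circle t)^-1 = unit_circle (- t).
Proof.
apply/eqP; rewrite eq_complex/= cosN sinN cos2Dsin2 invr1 !mulr1.
by rewrite !eqxx.
Qed.

Lemma rho2_neq0 (z u : X) : 0 < rho z -> 0 < rho u -> rho2 z u != 0.
Proof.
move=> z0 u0; apply/eqP => E; have := cmod_rho2_gt0 z0 u0.
by rewrite E /cmod/= expr0n/= addr0 sqrtr0 ltxx.
Qed.

Lemma Re_rho2_gt0 (z u : X) : 0 < rho z -> 0 < rho u -> 0 < Re (rho2 z u).
Proof.
move=> z0 u0; rewrite rho2E /= mulr_gt0// ltr_wpDl//.
  by apply: sumr_ge0 => j _; rewrite addr_ge0// sqr_ge0.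
by rewrite mulr_gt0// addr_gt0.
Qed.

(** The real part of [rho2] is positive on the domain, so the principal argument is an arctangent
    there and the phases of the two powers add. *)
Lemma kerTE (z w u eta : X) : 0 < rho z -> 0 < rho w -> 0 < rho u -> 0 < rho eta ->
  kerT b1 b2 c1 c2 z w u eta =
  ((rho u `^ b1 * rho eta `^ b2 /
    (cmod (rho2 z u) `^ c1 * cmod (rho2 w eta) `^ c2))%:C)%C *
  unit_circle (- (c1 * atan (Im (rho2 z u) / Re (rho2 z u)) +
     c2 * atan (Im (rho2 w eta) / Re (rho2 w eta)))).
Proof.
move=> z0 w0 u0 e0.
rewrite /kerT /cpow !(negbTE (rho2_neq0 _ _))// /Arg !Re_rho2_gt0//.
rewrite -![(cos _ +i* sin _)%C]/(unit_circle _).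
rewrite mulrACA unit_circleD invfM unit_circleV mulrA; congr (_ * _).
by rewrite -rmorphM/= -fmorphV -rmorphM.
Qed.

Lemma dominated_kerT : dominated_kernel b1 b2 c1 c2 (@kerT R n.+1 b1 b2 c1 c2).
Proof.
move=> z w u eta z0 w0 u0 e0; rewrite kerTE// cmodM cmod_unit_circle mulr1 cmod_real//.
by rewrite divr_ge0 ?mulr_ge0 ?powR_ge0.
Qed.

Lemma cos_near0 : exists2 d : R, 0 < d & forall t, `|t| <= d -> 1 <= 2 * cos t.
Proof.
have : \forall t \near (0 : R), 2^-1 < cos t.
  have h : (2^-1 : R) < cos 0 by rewrite cos0 invf_lt1// ltr1n.
  exact: (@continuous_cos R 0 _ (lt_nbhsr h)).
move=> /nbhs_ballP[e /= e0 he]; exists (e / 2); first by rewrite divr_gt0.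
move=> t td; rewrite -ler_pdivrMl// mulr1 ltW//; apply: he.
rewrite /ball/= sub0r normrN; apply: le_lt_trans td _.
by rewrite gtr_pMr// invf_lt1// ltr1n.
Qed.

Lemma atan_near0 (c e : R) : 0 < e -> exists2 d : R, 0 < d &
  forall t, `|t| <= d -> `|c * atan t| <= e.
Proof.
move=> e0.
have : \forall t \near (0 : R), `|c * atan t| < e.
  have : c * atan t @[t --> (0 : R)] --> (0 : R).
    rewrite -[X in _ --> X](mulr0 c) -{2}(@atan0 R).
    by apply: cvgMr; exact: continuous_atan.
  by move=> /cvgr0_norm_lt; apply.
move=> /nbhs_ballP[d /= d0 hd]; exists (d / 2); first by rewrite divr_gt0.
move=> t td; rewrite ltW//; apply: hd.
rewrite /ball/= sub0r normrN; apply: le_lt_trans td _.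
by rewrite gtr_pMr// invf_lt1// ltr1n.
Qed.

(** Each of the two phases is at most e/2 on the sector, and the cosine of their sum is at least
    1/2; this is the constant 2 in [sectorial]. *)
Lemma sectorial_kerT : sectorial (@kerT R n.+1 b1 b2 c1 c2).
Proof.
have [e e0 he] := cos_near0.
have e20 : 0 < e / 2 by rewrite divr_gt0.
have [d1 d10 hd1] := atan_near0 c1 e20.
have [d2 d20 hd2] := atan_near0 c2 e20.
exists (Num.min d1 d2); first by rewrite lt_min d10.
move=> z w u eta z0 w0 u0 eta0 h1 h2; rewrite kerTE//.
have quot (v v' : X) d : 0 < rho v -> 0 < rho v' -> Num.min d1 d2 <= d ->
    `|Im (rho2 v v')| <= Num.min d1 d2 * Re (rho2 v v') ->
    `|Im (rho2 v v') / Re (rho2 v v')| <= d.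
  move=> v0 v'0 md h; have r0 := Re_rho2_gt0 v0 v'0.
  rewrite normrM normfV (gtr0_norm r0) ler_pdivrMr//; apply: (le_trans h).
  by rewrite ler_wpM2r// ltW.
have ge_min_l : Num.min d1 d2 <= d1 by rewrite ge_min lexx.
have ge_min_r : Num.min d1 d2 <= d2 by rewrite ge_min lexx orbT.
have t1 := hd1 _ (quot z u d1 z0 u0 ge_min_l h1).
have t2 := hd2 _ (quot w eta d2 w0 eta0 ge_min_r h2).
have k0 : 0 <= rho u `^ b1 * rho eta `^ b2 /
   (cmod (rho2 z u) `^ c1 * cmod (rho2 w eta) `^ c2).
  by rewrite divr_ge0 ?mulr_ge0 ?powR_ge0.
rewrite cmodM cmod_unit_circle mulr1 cmod_real//=.
rewrite mul0r subr0 mulrCA ler_peMr// he// normrN.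
apply: (le_trans (ler_normD _ _)).
by rewrite (splitr e) lerD// ?t1 ?t2// ge_min lexx ?orbT.
Qed.

End kernels.

(** * Power integrals and anisotropic boxes *)

Section power_primitive.
Context {R : realType}.

(** Closed form of the integral of t^e over [i, j] for 0 < i < j, logarithmic at the exponent -1. It
    keeps the test inequalities among real numbers. *)
Definition pint (e i j : R) : R :=
  if e + 1 == 0 then ln j - ln i else (j `^ (e + 1) - i `^ (e + 1)) / (e + 1).

Definition step (i j t : R) : R := if i <= t <= j then 1 else 0.

Lemma step_ge0 i j t : 0 <= step i j t.
Proof. by rewrite /step; case: ifP. Qed.

Lemma measurable_step i j : measurable_fun setT (step i j).
Proof.
rewrite (_ : step i j = \1_(`[i, j]%classic)).
  exact: measurable_indic.
by apply/funext => t; rewrite /step indicE mem_setE in_itv/=; case: (i <= t <= j).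
Qed.

Lemma integral_step (e i j : R) : 0 < i -> i < j ->
  (\int[@lebesgue_measure R]_t (step i j t * t `^ e)%:E = (pint e i j)%:E)%E.
Proof.
move=> i0 ij; transitivity (\int[@lebesgue_measure R]_(t in `[i, j]) (t `^ e)%:E)%E.
  rewrite [RHS]integral_mkcond; apply: eq_integral => t _.
  rewrite patchE /step mem_setE in_itv/=.
  by case: ifP => _; rewrite ?mul1r ?mul0r.
rewrite /pint; case: eqVneq => [e1|e1]; last exact: integral_powR_itv.
have -> : e = -1 by apply/eqP; rewrite -subr_eq0 opprK e1.
exact: integral_inv_itv.
Qed.

Lemma pint_ge (e i j m : R) : 0 < i -> i < j ->
  (forall t, i <= t <= j -> m <= t `^ e) -> m * (j - i) <= pint e i j.
Proof.
move=> i0 ij hm.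
have [m0|m0] := leP m 0.
  apply: (@le_trans _ _ 0); first by rewrite mulr_le0_ge0// subr_ge0 ltW.
  rewrite -lee_fin -integral_step//; apply: integral_ge0 => t _.
  by rewrite lee_fin mulr_ge0 ?powR_ge0// step_ge0.
have : (\int[@lebesgue_measure R]_(t in `[i, j]) (cst m%:E t) <=
   \int[@lebesgue_measure R]_t (step i j t * t `^ e)%:E)%E.
  rewrite [leLHS]integral_mkcond; apply: le_integralT => t.
    by rewrite patchE; case: ifP => // _; rewrite lee_fin ltW.
  rewrite patchE /step mem_setE in_itv/=; case: ifPn => [ijt|_].
    by rewrite mul1r lee_fin hm.
  by rewrite mul0r.
rewrite integral_step// integral_cst//= lebesgue_measure_itv/= lte_fin ij.
by rewrite -EFinD -EFinM lee_fin.
Qed.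

Lemma pint_gt0 (e i j : R) : 0 < i -> i < j -> 0 < pint e i j.
Proof.
move=> i0 ij; have j0 := lt_trans i0 ij.
pose m := Num.min (i `^ e) (j `^ e).
have m0 : 0 < m by rewrite lt_min !powR_gt0.
apply: (@lt_le_trans _ _ (m * (j - i))); first by rewrite mulr_gt0// subr_gt0.
apply: pint_ge => // t /andP[it tj]; have t0 := lt_le_trans i0 it.
rewrite ge_min; have [e0|e0] := leP 0 e.
  by rewrite ge0_ler_powR// nnegrE ltW.
by apply/orP; right; rewrite -[e]opprK ler_powRN// oppr_ge0 ltW.
Qed.

Lemma le_pint (e e' i j : R) : 0 < i -> i < j -> j <= 1 -> e <= e' ->
  pint e' i j <= pint e i j.
Proof.
move=> i0 ij j1 ee'; rewrite -lee_fin -!integral_step//.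
apply: le_integralT => t; first by rewrite lee_fin mulr_ge0 ?powR_ge0// step_ge0.
rewrite lee_fin /step; case: ifPn => [/andP[it tj]|_]; last by rewrite !mul0r.
rewrite !mul1r ger_powR// (lt_le_trans i0 it)/=.
exact: le_trans j1.
Qed.

Lemma pintZ (e i j l : R) : 0 < i -> i < j -> 0 < l ->
  pint e (l * i) (l * j) = l `^ (e + 1) * pint e i j.
Proof.
move=> i0 ij l0; have j0 := lt_trans i0 ij.
rewrite /pint; case: eqVneq => [->|e1].
  by rewrite powRr0 mul1r !lnM ?posrE//; ring.
rewrite !powRM ?(ltW l0) ?(ltW i0) ?(ltW j0)//.
by rewrite -mulrBr mulrA.
Qed.

Lemma pintN1 (i j : R) : pint (-1) i j = ln j - ln i.
Proof. by rewrite /pint addNr eqxx. Qed.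

End power_primitive.

Section boxes.
Context {R : realType}.
Variable n : nat.
Local Notation X := (pt R n.+1).
Local Notation Re := complex.Re.
Local Notation Im := complex.Im.

Definition zero_pt : X := (nseq_tuple n.+1 0, nseq_tuple n.+1 0).

Lemma nth_zero1 j : nth 0 zero_pt.1 j = 0 :> R.
Proof. by rewrite nth_nseq; case: ifP. Qed.

Lemma nth_zero2 j : nth 0 zero_pt.2 j = 0 :> R.
Proof. by rewrite nth_nseq; case: ifP. Qed.

(** Adapted to the dilations z' -> s z', z_n -> s^2 z_n, which multiply rho by s^2, and written in
    the coordinates of [intV_siegel] at the origin, where the volume is explicit. The variable
    rho(u) stays free here and is cut off in [test]. *)
Definition box (s : R) (u : X) : R :=
  \prod_(j < n) step (- s) s (nth 0 u.1 j) * \prod_(j < n) step (- s) s (nth 0 u.2 j) *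
  step (- s ^+ 2) (s ^+ 2) (nth 0 u.1 n - shear zero_pt u).

Definition vol (s : R) : R := (2 * s) ^+ n * (2 * s) ^+ n * (2 * s ^+ 2).

Lemma vol_gt0 s : 0 < s -> 0 < vol s.
Proof. by move=> s0; rewrite !mulr_gt0 ?exprn_gt0// mulr_gt0. Qed.

Lemma prod_step (s : R) (v : 'I_n -> R) :
  \prod_(j < n) step (- s) s (v j) = if [forall j, (- s <= v j <= s)%R] then 1 else 0.
Proof.
case: (boolP [forall j, (- s <= v j <= s)%R]) => [/forallP h|].
  by rewrite big1// => j _; rewrite /step h.
rewrite negb_forall => /existsP[j hj].
by rewrite (bigD1 j)//= /step (negbTE hj) mul0r.
Qed.

Lemma boxP (s : R) (u : X) : box s u = 0 \/ box s u = 1 /\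
  [/\ forall j, (j < n)%N -> `|nth 0 u.1 j| <= s, forall j, (j < n)%N -> `|nth 0 u.2 j| <= s &
   `|nth 0 u.1 n - shear zero_pt u| <= s ^+ 2].
Proof.
rewrite /box !prod_step /step.
case: (boolP [forall j, _]) => [/forallP h1|_]; last by left; rewrite !mul0r.
case: (boolP [forall j, _]) => [/forallP h2|_]; last by left; rewrite mulr0 mul0r.
case: (boolP (_ <= _ <= _)) => [h3|_]; last by left; rewrite mulr0.
right; split; first by rewrite !mulr1.
split; [move=> j jn|move=> j jn|]; rewrite ler_norml//.
  exact: (h1 (Ordinal jn)).
exact: (h2 (Ordinal jn)).
Qed.

Lemma box_ge0 s u : 0 <= box s u.
Proof. by have [->|[-> _]] := boxP s u. Qed.

Lemma box_powR s u k : k != 0 -> box s u `^ k = box s u.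
Proof. by move=> k0; have [->|[-> _]] := boxP s u; rewrite ?powR0 ?powR1. Qed.

Lemma measurable_box s : measurable_fun setT (box s).
Proof.
have mst i j := @measurable_step R i j.
apply: measurable_funM; last first.
  apply: (measurableT_comp (mst _ _)); apply: measurable_funB.
    exact: measurable_re_coord.
  exact: (measurable_fun_pair2 zero_pt (@measurable_shear R n.+1)).
apply: measurable_funM; apply: measurable_prod => j _; apply: (measurableT_comp (mst _ _)).
  exact: measurable_re_coord.
exact: measurable_im_coord.
Qed.

Lemma integral_step0 (s : R) : 0 < s ->
  (\int[@lebesgue_measure R]_t (step (- s) s t)%:E = (2 * s)%:E)%E.
Proof.
move=> s0; transitivity (\int[@lebesgue_measure R]_(t in `[(- s)%R, s]) (cst 1%:E t))%E.
  rewrite [RHS]integral_mkcond; apply: eq_integral => t _.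
  by rewrite patchE /step mem_setE in_itv/=; case: ifP.
rewrite integral_cst//= lebesgue_measure_itv/= lte_fin gtrN// mul1e -EFinD.
by congr EFin; ring.
Qed.

Lemma intV_box s (psi : R -> R) : 0 < s -> measurable_fun setT psi ->
  (forall t, 0 <= psi t) ->
  (intV (fun u => (box s u * psi (rho u))%:E) =
   (vol s)%:E * \int[@lebesgue_measure R]_t (psi t)%:E)%E.
Proof.
move=> s0 mpsi psi0.
transitivity (intV (fun u : X =>
     (\prod_(j < n) step (- s) s (nth 0 u.1 j - nth 0 zero_pt.1 j) *
     \prod_(j < n) step (- s) s (nth 0 u.2 j - nth 0 zero_pt.2 j) *
     step (- s ^+ 2) (s ^+ 2) (nth 0 u.1 n - shear zero_pt u) * psi (rho u))%:E)).
  congr intV; apply/funext => u; congr EFin; rewrite /box; congr (_ * _ * _ * _).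
    by apply: eq_bigr => j _; rewrite nth_zero1 subr0.
  by apply: eq_bigr => j _; rewrite nth_zero2 subr0.
rewrite intV_siegel//; do ?[exact: measurable_step].
- by rewrite !integral_step0// ?exprn_gt0// -EFin_expe -!EFinM.
- by move=> t; exact: step_ge0.
- by move=> t; exact: step_ge0.
Qed.

Definition test (s i j e : R) (u : X) : R := box s u * (step i j (rho u) * rho u `^ e).

Lemma test_ge0 s i j e u : 0 <= test s i j e u.
Proof. by rewrite mulr_ge0 ?box_ge0// mulr_ge0 ?powR_ge0 ?step_ge0. Qed.

Lemma measurable_test s i j e : measurable_fun setT (test s i j e).
Proof.
apply: measurable_funM; first exact: measurable_box.
apply: measurable_funM.
  by apply: (measurableT_comp (@measurable_step R i j)); exact: measurable_rho.
by apply: measurable_powR_fun; exact: measurable_rho.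
Qed.

Lemma intTB_test (b k s i j e l : R) : 0 < s -> 0 < i -> i < j -> k != 0 -> 0 <= l ->
  (intTB b (fun u => (l * test s i j e u `^ k)%:E) =
   (l * (vol s * pint (b + e * k) i j))%:E)%E.
Proof.
move=> s0 i0 ij k0 l0.
pose psi t := l * (step i j t * t `^ (b + e * k)).
have st0 t : 0 <= step i j t by exact: step_ge0.
have mst : measurable_fun setT (fun t : R => step i j t * t `^ (b + e * k)).
  by apply: measurable_funM; [exact: measurable_step|exact: measurable_powR].
rewrite intTB_weight.
transitivity (intV (fun u : X => (box s u * psi (rho u))%:E)).
  congr intV; apply/funext => u; rewrite -EFinM; congr EFin.
  rewrite /test powRM ?box_ge0 ?mulr_ge0 ?powR_ge0 ?step_ge0// box_powR//.
  rewrite powRM ?powR_ge0 ?step_ge0// -powRrM.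
  rewrite /psi /weight /step; case: (boolP (i <= rho u <= j)) => [/andP[iu uj]|_]/=.
    have u0 := lt_le_trans i0 iu.
    rewrite u0 powR1 powRD ?(gt_eqF u0) ?implybT//.
    by ring.
  by rewrite powR0// !(mul0r, mulr0).
rewrite intV_box//; first last.
- by move=> t; rewrite mulr_ge0// mulr_ge0 ?powR_ge0.
- by apply: measurable_funM => //; exact: measurable_cst.
rewrite /psi; under eq_integral do rewrite EFinM.
rewrite ge0_integralZl_EFin//; first last.
- exact/measurable_EFinP.
- by move=> t _; rewrite lee_fin mulr_ge0 ?powR_ge0.
by rewrite integral_step// -!EFinM; congr EFin; ring.
Qed.

(** With N the dimension, the box alone bounds the imaginary part by 4 N s^2, while a value of rho
    at least M s^2 at z or at u pushes the real part above M s^2 / 2. The ratio is at most 8 N / M,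
    whence the condition linking d and M. *)
Lemma box_rho2 (s M d : R) (z u : X) : 0 < s -> 1 <= M -> 8 * n.+1%:R <= d * M -> 0 <= d ->
  box s z = 1 -> box s u = 1 -> 0 < rho z -> 0 < rho u ->
  rho z <= 2 * M * s ^+ 2 -> rho u <= 2 * M * s ^+ 2 ->
  M * s ^+ 2 <= rho z \/ M * s ^+ 2 <= rho u ->
  [/\ `|Im (rho2 z u)| <= d * Re (rho2 z u),
    M / 2 * s ^+ 2 <= cmod (rho2 z u) &
    cmod (rho2 z u) <= (6 * n.+1%:R + 2 * M) * s ^+ 2].
Proof.
move=> s0 M1 dM d0 bz bu z0 u0 zM uM zuM.
have one0 : (1 : R) <> 0 by move/eqP; rewrite oner_eq0.
have [|[_ [hz1 hz2 hz3]]] := boxP s z; first by rewrite bz => /one0.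
have [|[_ [hu1 hu2 hu3]]] := boxP s u; first by rewrite bu => /one0.
set N : R := n.+1%:R.
have NE : N = n%:R + 1 by rewrite /N -natr1.
have s20 : 0 < s ^+ 2 by rewrite exprn_gt0.
have ns0 : 0 <= n%:R * s ^+ 2 by rewrite mulr_ge0 ?(ltW s20).
have sum_le (v : 'I_n -> R) (m : R) : (forall j, `|v j| <= m) -> `|\sum_(j < n) v j| <= n%:R * m.
  move=> vm; apply: (le_trans (ler_norm_sum _ _ _)).
  rewrite mulr_natl -[X in _ *+ X](card_ord n) -sumr_const.
  by apply: ler_sum => j _.
have shear0 (v : X) : shear zero_pt v = \sum_(j < n) nth 0 v.1 j * nth 0 v.2 j.
  rewrite /shear nth_zero1 add0r -sumrN; apply: eq_bigr => j _.
  by rewrite nth_zero1 ?nth_zero2 sub0r add0r mulNr opprK.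
have last_le (v : X) : (forall j, (j < n)%N -> `|nth 0 v.1 j| <= s) ->
    (forall j, (j < n)%N -> `|nth 0 v.2 j| <= s) ->
    `|nth 0 v.1 n - shear zero_pt v| <= s ^+ 2 -> `|nth 0 v.1 n| <= N * s ^+ 2.
  move=> h1 h2 h3; rewrite -[nth 0 v.1 n](subrK (shear zero_pt v)).
  apply: (le_trans (ler_normD _ _)); rewrite NE mulrDl mul1r addrC.
  apply: lerD => //; rewrite shear0; apply: sum_le => j.
  by rewrite normrM expr2 ler_pM// ?h1 ?h2.
have hz := last_le z hz1 hz2 hz3; have hu := last_le u hu1 hu2 hu3.
have diff (a b : R) : `|a| <= s -> `|b| <= s -> `|a - b| <= 2 * s.
  by move=> ha hb; apply: (le_trans (ler_normB _ _)); rewrite mulr_natl mulr2n lerD.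
have sumd (a b : R) : `|a| <= s -> `|b| <= s -> `|a + b| <= 2 * s.
  by move=> ha hb; apply: (le_trans (ler_normD _ _)); rewrite mulr_natl mulr2n lerD.
have hI : `|Im (rho2 z u)| <= 4 * N * s ^+ 2.
  rewrite rho2E /= normrM gtr0_norm ?invr_gt0// mulrC ler_pdivrMr//.
  rewrite /shear/= opprB addrA.
  have hs : `|\sum_(j < n) (nth 0 z.1 j - nth 0 u.1 j) * (nth 0 z.2 j + nth 0 u.2 j)| <=
    n%:R * (4 * s ^+ 2).
    apply: sum_le => j; rewrite normrM.
    have -> : 4 * s ^+ 2 = (2 * s) * (2 * s) by ring.
    by rewrite ler_pM// ?diff ?sumd ?hz1 ?hz2 ?hu1 ?hu2.
  apply: (@le_trans _ _ (N * s ^+ 2 + n%:R * (4 * s ^+ 2) + N * s ^+ 2)).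
    apply: (le_trans (ler_normB _ _)); apply: lerD => //.
    by apply: (le_trans (ler_normD _ _)); exact: lerD.
  by rewrite NE; lra.
have hRlow : (rho z + rho u) / 2 <= Re (rho2 z u).
  rewrite rho2E /= mulrC.
  have : 0 <= \sum_(j < n) ((nth 0 z.1 j - nth 0 u.1 j) ^+ 2 + (nth 0 z.2 j - nth 0 u.2 j) ^+ 2).
    by apply: sumr_ge0 => j _; rewrite addr_ge0// sqr_ge0.
  by lra.
have hRup : Re (rho2 z u) <= 2 * N * s ^+ 2 + 2 * M * s ^+ 2.
  rewrite rho2E /=.
  have : `|\sum_(j < n) ((nth 0 z.1 j - nth 0 u.1 j) ^+ 2 +
      (nth 0 z.2 j - nth 0 u.2 j) ^+ 2)| <= n%:R * (8 * s ^+ 2).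
    apply: sum_le => j; rewrite ger0_norm ?addr_ge0 ?sqr_ge0//.
    have sq (x : R) : `|x| <= 2 * s -> x ^+ 2 <= 4 * s ^+ 2.
      move=> hx; rewrite -real_normK ?num_real//.
      have -> : 4 * s ^+ 2 = (2 * s) ^+ 2 by ring.
      by rewrite lerXn2r// nnegrE ?normr_ge0// mulr_ge0// ltW.
    have -> : 8 * s ^+ 2 = 4 * s ^+ 2 + 4 * s ^+ 2 by ring.
    by rewrite lerD// sq// diff// ?hz1 ?hz2 ?hu1 ?hu2.
  move=> /(le_trans (ler_norm _)) h.
  by rewrite NE; lra.
have hRM : M / 2 * s ^+ 2 <= Re (rho2 z u).
  by apply: le_trans hRlow; case: zuM => h; lra.
split.
- apply: (le_trans hI).
  apply: (@le_trans _ _ (d * (M / 2 * s ^+ 2))).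
    have -> : d * (M / 2 * s ^+ 2) = (d * M / 2) * s ^+ 2 by ring.
    by rewrite ler_wpM2r ?(ltW s20)//; lra.
  exact: ler_wpM2l.
- by apply: (le_trans hRM); apply: le_trans (cmod_Re _); exact: ler_norm.
- apply: (le_trans (cmod_le _)).
  rewrite ger0_norm; last by apply: le_trans hRM; rewrite mulr_ge0 ?(ltW s20)//; lra.
  by lra.
Qed.

End boxes.

(** * Boundedness tested on boxes *)

Section test_inequality.
Context {R : realType}.
Variable n : nat.
Local Notation X := (pt R n.+1).
Local Notation Re := complex.Re.
Local Notation Im := complex.Im.

Lemma powR_between (e A B y : R) : 0 < A -> A <= y -> y <= B ->
  Num.min (A `^ e) (B `^ e) <= y `^ e <= Num.max (A `^ e) (B `^ e).
Proof.
move=> A0 Ay yB; have y0 := lt_le_trans A0 Ay; have B0 := lt_le_trans y0 yB.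
rewrite ge_min le_max; have [e0|e0] := leP 0 e.
  apply/andP; split; apply/orP; [left|right];
    by rewrite ge0_ler_powR// nnegrE ltW.
by apply/andP; split; apply/orP; [right|left];
  rewrite -[e]opprK ler_powRN// oppr_ge0 ltW.
Qed.

(* The last condition, M s^2 <= i or M s^2 <= j with M large, makes [rho2 z u]
   nearly real for z, u in the box of size s with rho(u) in [i, i'] and rho(z) in
   [j, j']. *)
Definition admissible (M s i i' j j' : R) : Prop :=
  [/\ 0 < s, 0 < i < i', 0 < j < j', i' <= 2 * M * s ^+ 2 /\ j' <= 2 * M * s ^+ 2 &
   M * s ^+ 2 <= i \/ M * s ^+ 2 <= j].

(** The three factors are the size of the kernel, the integral of rho^b against the test function,
    and the L^q norm of rho^a over the output box with weight exponent [be]. *)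
Definition out_size (a b c q be s i i' j j' e : R) : R :=
  (s ^+ 2) `^ (- c) * (vol n s * pint (b + e) i i') *
  (vol n s * pint (be + a * q) j j') `^ q^-1.

Definition in_size (p al s i i' e : R) : R :=
  (vol n s * pint (al + e * p) i i') `^ p^-1.

Lemma testP s i j e (u : X) : 0 < i -> test s i j e u = 0 \/
  [/\ box s u = 1, 0 < rho u, i <= rho u, rho u <= j & test s i j e u = rho u `^ e].
Proof.
move=> i0; rewrite /test /step; have [->|[-> _]] := boxP s u; first by left; rewrite mul0r.
case: (boolP (_ <= _ <= _)) => [/andP[iu uj]|_]; last by left; rewrite mul0r mulr0.
by right; rewrite !mul1r; split => //; exact: lt_le_trans iu.
Qed.

Lemma testD b s i j e (u : X) : 0 < rho u ->
  rho u `^ b * test s i j e u = test s i j (b + e) u `^ 1.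
Proof.
move=> u0; rewrite powRr1 ?test_ge0// /test powRD ?(gt_eqF u0) ?implybT//.
by ring.
Qed.

Local Open Scope ereal_scope.

Lemma mixint_test (p1 p2 al1 al2 s1 i1 j1 e1 s2 i2 j2 e2 L : R) :
  (0 < p1)%R -> (0 < p2)%R -> (0 <= L)%R ->
  (0 < s1)%R -> (0 < i1)%R -> (i1 < j1)%R -> (0 < s2)%R -> (0 < i2)%R -> (i2 < j2)%R ->
  (intTB al2 (fun w : X => (intTB al1 (fun z : X =>
     ((L * test s1 i1 j1 e1 z * test s2 i2 j2 e2 w) `^ p1)%:E)) `^ (p2 / p1))) `^ p2^-1 =
  (L * in_size p1 al1 s1 i1 j1 e1 * in_size p2 al2 s2 i2 j2 e2)%:E.
Proof.
move=> p10 p20 L0 s10 i10 ij1 s20 i20 ij2.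
have P10 : (0 <= vol n s1 * pint (al1 + e1 * p1) i1 j1)%R.
  by rewrite mulr_ge0// ltW// ?vol_gt0// pint_gt0.
have P20 : (0 <= vol n s2 * pint (al2 + e2 * p2) i2 j2)%R.
  by rewrite mulr_ge0// ltW// ?vol_gt0// pint_gt0.
set P1 := (vol n s1 * _)%R in P10; set P2 := (vol n s2 * _)%R in P20.
have inner w : intTB al1 (fun z : X =>
     ((L * test s1 i1 j1 e1 z * test s2 i2 j2 e2 w) `^ p1)%:E) =
    ((L * test s2 i2 j2 e2 w) `^ p1 * P1)%:E.
  rewrite -intTB_test ?powR_ge0 ?gt_eqF//; congr intTB; apply/funext => z; congr EFin.
  by rewrite mulrAC (powRM p1 (mulr_ge0 L0 (test_ge0 s2 i2 j2 e2 w)) (test_ge0 s1 i1 j1 e1 z)).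
under [X in intTB al2 X]eq_fun => w.
  rewrite inner poweR_EFin powRM ?powR_ge0// -powRrM.
  rewrite (_ : p1 * (p2 / p1) = p2)%R; last by field; rewrite gt_eqF.
  rewrite (powRM p2 L0 (test_ge0 s2 i2 j2 e2 w)) mulrAC; over.
rewrite intTB_test ?mulr_ge0 ?powR_ge0 ?gt_eqF// poweR_EFin; congr EFin.
have LP : (0 <= L `^ p2 * P1 `^ (p2 / p1))%R by rewrite mulr_ge0 ?powR_ge0.
rewrite -/P2 (powRM p2^-1 LP P20) (powRM p2^-1 (powR_ge0 _ _) (powR_ge0 _ _)).
rewrite -!powRrM mulfV ?gt_eqF// powRr1//.
rewrite /in_size -/P1 -/P2; congr (_ * _ `^ _ * _)%R; field.
by rewrite !gt_eqF.
Qed.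

Lemma intTB2_test (b1 b2 s1 i1 j1 e1 s2 i2 j2 e2 L : R) : (0 <= L)%R ->
  (0 < s1)%R -> (0 < i1)%R -> (i1 < j1)%R -> (0 < s2)%R -> (0 < i2)%R -> (i2 < j2)%R ->
  intTB2 (fun u eta : X => (L * (rho u `^ b1 * rho eta `^ b2) *
     (test s1 i1 j1 e1 u * test s2 i2 j2 e2 eta))%:E) =
  (L * (vol n s1 * pint (b1 + e1) i1 j1) * (vol n s2 * pint (b2 + e2) i2 j2))%:E.
Proof.
move=> L0 s10 i10 ij1 s20 i20 ij2.
have P10 : (0 <= vol n s1 * pint (b1 + e1) i1 j1)%R.
  by rewrite mulr_ge0// ltW// ?vol_gt0// pint_gt0.
have inner (eta : X) : (0 < rho eta)%R -> intTB 0 (fun u : X => (L * (rho u `^ b1 * rho eta `^ b2) *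
     (test s1 i1 j1 e1 u * test s2 i2 j2 e2 eta))%:E) =
    (L * (vol n s1 * pint (b1 + e1) i1 j1) * test s2 i2 j2 (b2 + e2) eta `^ 1)%:E.
  move=> e0; rewrite (@eq_intTB _ _ _ _ (fun u => (L * test s2 i2 j2 (b2 + e2) eta `^ 1 *
     test s1 i1 j1 (b1 + e1) u `^ 1)%:E)).
    rewrite intTB_test ?oner_eq0 ?mulr_ge0 ?powR_ge0// add0r mulr1; congr EFin.
    by ring.
  by move=> u u0; rewrite -!testD//; congr EFin; ring.
have LP := mulr_ge0 L0 P10.
rewrite /intTB2 (eq_intTB _ inner).
rewrite (intTB_test n 0 (b2 + e2) s20 i20 ij2 (oner_neq0 R) LP).
by rewrite add0r mulr1.
Qed.

Variables (p1 p2 q1 q2 a1 a2 b1 b2 c1 c2 al1 al2 be1 be2 : R).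
Hypotheses (p10 : (0 < p1)%R) (p20 : (0 < p2)%R) (q10 : (0 < q1)%R) (q20 : (0 < q2)%R).
Variable K : X -> X -> X -> X -> R[i].
Hypotheses (HK : dominated_kernel b1 b2 c1 c2 K) (SK : sectorial K)
  (BK : bounded_op a1 a2 K p1 p2 al1 al2 q1 q2 be1 be2).

Lemma Re_mulr_real (x : R[i]) (t : R) : (Re (x * (t%:C)%C) = Re x * t)%R.
Proof. by case: x => x y /=; rewrite mulr0 subr0. Qed.

(** For z and w in the output boxes the kernel has a positive real part comparable to its modulus on
    the whole support of the product test function. The real part of the integral therefore has no
    cancellation and bounds the modulus of the image from below. *)
Lemma bounded_op_test : exists M C : R, (1 <= M)%R /\
  forall s1 i1 i1' j1 j1' e1 s2 i2 i2' j2 j2' e2 : R,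
  admissible M s1 i1 i1' j1 j1' -> admissible M s2 i2 i2' j2 j2' ->
  (out_size a1 b1 c1 q1 be1 s1 i1 i1' j1 j1' e1 *
   out_size a2 b2 c2 q2 be2 s2 i2 i2' j2 j2' e2 <=
   C * (in_size p1 al1 s1 i1 i1' e1 * in_size p2 al2 s2 i2 i2' e2))%R.
Proof.
have [d d0 hd] := SK.
pose N : R := n.+1%:R.
(* With d the opening of the sector, this choice gives 1 <= M and 8 N <= d M, as [box_rho2]
   requires. *)
pose M : R := (1 + 8 * N / d)%R.
have N0 : (0 < N)%R by [].
have M1 : (1 <= M)%R by rewrite lerDl divr_ge0 ?mulr_ge0 ?ltW.
have dM : (8 * N <= d * M)%R.
  have -> : (d * M = d + 8 * N)%R by rewrite /M; field; rewrite gt_eqF.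
  by rewrite lerDr ltW.
have [C hC] := BK.
pose A : R := (M / 2)%R; pose B : R := (6 * N + 2 * M)%R.
have M0 : (0 < M)%R by exact: lt_le_trans M1.
have A0 : (0 < A)%R by rewrite divr_gt0.
have B0 : (0 < B)%R by rewrite addr_gt0 ?mulr_gt0.
(* The exponent -c may have either sign, so the extreme values over the range [A, B] of |rho2| / s^2
   are taken at one end or the other. *)
pose lo (c : R) : R := Num.min (A `^ (- c))%R (B `^ (- c))%R.
pose hi (c : R) : R := Num.max (A `^ (- c))%R (B `^ (- c))%R.
have lo0 c : (0 < lo c)%R by rewrite lt_min !powR_gt0.
exists M, (C * (2 / (lo c1 * lo c2)))%R; split => //.
move=> s1 i1 i1' j1 j1' e1 s2 i2 i2' j2 j2' e2.
move=> [s10 /andP[i10 i11] /andP[j10 j11] [i1M j1M] M1ij].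
move=> [s20 /andP[i20 i21] /andP[j20 j21] [i2M j2M] M2ij].
pose phi1 : X -> R := test s1 i1 i1' e1; pose phi2 : X -> R := test s2 i2 i2' e2.
pose f (u eta : X) : R[i] := ((phi1 u * phi2 eta)%:C)%C.
have phi0 u eta : (0 <= phi1 u * phi2 eta)%R by rewrite mulr_ge0 ?test_ge0.
have cf u eta : cmod (f u eta) = (phi1 u * phi2 eta)%R by rewrite cmod_real.
have mf : cmeasurable f.
  split; last exact: measurable_cst.
  apply: measurable_funM.
    by apply: (measurableT_comp (measurable_test _ _ _ _)); exact: measurable_fst.
  by apply: (measurableT_comp (measurable_test _ _ _ _)); exact: measurable_snd.
have mixf : mixnorm p1 p2 al1 al2 f =
    (in_size p1 al1 s1 i1 i1' e1 * in_size p2 al2 s2 i2 i2' e2)%:E.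
  have := mixint_test al1 al2 e1 e2 p10 p20 (@ler01 R) s10 i10 i11 s20 i20 i21.
  rewrite (mul1r (in_size _ _ _ _ _ _)).
  move=> <-.
  rewrite /mixnorm.
  refine (congr1 (@poweR R ^~ p2^-1%R) _).
  apply: eq_intTB => w _.
  refine (congr1 (@poweR R ^~ (p2 / p1)%R) _).
  apply: eq_intTB => z _.
  by rewrite cf mul1r.
have [|_ bound] := hC f; first by split => //; rewrite mixf ltry.
have kernel_bounds s i i' j j' (z u : X) c : (0 < s)%R -> (i' <= 2 * M * s ^+ 2)%R ->
    (j' <= 2 * M * s ^+ 2)%R ->
    (M * s ^+ 2 <= i \/ M * s ^+ 2 <= j)%R -> box s z = 1%R -> box s u = 1%R ->
    (0 < rho z)%R -> (0 < rho u)%R -> (i <= rho u)%R -> (rho u <= i')%R ->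
    (j <= rho z)%R -> (rho z <= j')%R ->
    [/\ (`|Im (rho2 z u)| <= d * Re (rho2 z u))%R,
     ((s ^+ 2) `^ (- c) * lo c <= cmod (rho2 z u) `^ (- c))%R &
     (cmod (rho2 z u) `^ (- c) <= (s ^+ 2) `^ (- c) * hi c)%R].
  move=> s0 iM jM Mij bz bu z0 u0 iu ui jz zj.
  have ss0 : (0 < s ^+ 2)%R by rewrite exprn_gt0.
  have [|||hI hA hB] := box_rho2 s0 M1 dM (ltW d0) bz bu z0 u0.
  - exact: le_trans jM.
  - exact: le_trans iM.
  - by case: Mij => h; [right; exact: le_trans iu|left; exact: le_trans jz].
  have := @powR_between (- c) A B (cmod (rho2 z u) / s ^+ 2) A0.
  rewrite ler_pdivlMr// ler_pdivrMr// => /(_ hA hB)/andP[l h].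
  have -> : (cmod (rho2 z u) `^ (- c) = (s ^+ 2) `^ (- c) * (cmod (rho2 z u) / s ^+ 2) `^ (- c))%R.
    by rewrite -powRM ?(ltW ss0) ?divr_ge0 ?cmod_ge0 ?(ltW ss0)// mulrC divfK// gt_eqF.
  by split => //; rewrite ler_wpM2l ?powR_ge0.
pose S1 : R := ((s1 ^+ 2) `^ (- c1))%R; pose S2 : R := ((s2 ^+ 2) `^ (- c2))%R.
pose kl : R := ((S1 * lo c1) * (S2 * lo c2) / 2)%R.
pose kh : R := ((S1 * hi c1) * (S2 * hi c2))%R.
have hi0 c : (0 <= hi c)%R by rewrite le_max powR_ge0.
have kl0 : (0 <= kl)%R by rewrite divr_ge0// !mulr_ge0 ?powR_ge0// ltW.
have kh0 : (0 <= kh)%R by rewrite !mulr_ge0 ?powR_ge0.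
pose I1 : R := (vol n s1 * pint (b1 + e1) i1 i1')%R.
pose I2 : R := (vol n s2 * pint (b2 + e2) i2 i2')%R.
have I10 : (0 < I1)%R by rewrite mulr_gt0 ?vol_gt0 ?pint_gt0.
have I20 : (0 < I2)%R by rewrite mulr_gt0 ?vol_gt0 ?pint_gt0.
have kI0 : (0 <= kl * I1 * I2)%R := mulr_ge0 (mulr_ge0 kl0 (ltW I10)) (ltW I20).
have lower z w : (kl * I1 * I2 * test s1 j1 j1' a1 z * test s2 j2 j2' a2 w <=
    cmod (intop a1 a2 K f z w))%R.
  have [->|[bz z0 jz zj ->]] := testP s1 j1' a1 z j10.
    by rewrite mulr0 mul0r cmod_ge0.
  have [->|[bw w0 jw wj ->]] := testP s2 j2' a2 w j20.
    by rewrite mulr0 cmod_ge0.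
  rewrite /intop cmodM cmod_real ?mulr_ge0 ?powR_ge0//.
  rewrite -mulrA mulrC ler_wpM2l ?mulr_ge0 ?powR_ge0//.
  apply: (@le_trans _ _ (Re (cint2 (fun u eta => K z w u eta * f u eta)))%R); last first.
    by apply: le_trans (cmod_Re _); exact: ler_norm.
  rewrite /cint2/=/rint2.
  have point (u eta : X) : (0 < rho u)%R -> (0 < rho eta)%R ->
     (kl * (rho u `^ b1 * rho eta `^ b2) * (phi1 u * phi2 eta) <= Re (K z w u eta * f u eta)%R)%R /\
     (Re (K z w u eta * f u eta)%R <= kh * (rho u `^ b1 * rho eta `^ b2) * (phi1 u * phi2 eta))%R.
    move=> u0 eta0; rewrite Re_mulr_real.
    have [E|[bu _ iu ui _]] := testP s1 i1' e1 u i10.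
      by rewrite /phi1 E !mul0r !mulr0.
    have [E|[be _ ie ei _]] := testP s2 i2' e2 eta i20.
      by rewrite /phi2 E !mulr0.
    have [h1 l1 u1] := kernel_bounds s1 i1 i1' j1 j1' z u c1 s10 i1M j1M M1ij bz bu z0 u0 iu ui jz zj.
    have [h2 l2 u2] := kernel_bounds s2 i2 i2' j2 j2' w eta c2 s20 i2M j2M M2ij bw be w0 eta0 ie ei jw wj.
    have hK := hd z w u eta z0 w0 u0 eta0 h1 h2.
    have KE := HK z0 w0 u0 eta0.
    rewrite invfM -!powRN in KE.
    have rr0 : (0 <= rho u `^ b1 * rho eta `^ b2)%R by rewrite mulr_ge0 ?powR_ge0.
    have S10 : (0 <= S1 * lo c1)%R by rewrite mulr_ge0 ?powR_ge0// ltW.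
    have S20 : (0 <= S2 * lo c2)%R by rewrite mulr_ge0 ?powR_ge0// ltW.
    split; apply: ler_wpM2r => //.
      have : ((S1 * lo c1) * (S2 * lo c2) * (rho u `^ b1 * rho eta `^ b2) <= cmod (K z w u eta))%R.
        by rewrite KE mulrC ler_wpM2l// ler_pM.
      by rewrite /kl => h; lra.
    apply: (@le_trans _ _ (cmod (K z w u eta))).
      by apply: le_trans (cmod_Re _); exact: ler_norm.
    by rewrite KE [leRHS]mulrC ler_wpM2l// ler_pM ?powR_ge0.
  have phr (u eta : X) k : (0 <= k)%R -> (0 <= k * (rho u `^ b1 * rho eta `^ b2) * (phi1 u * phi2 eta))%R.
    by move=> k0; rewrite mulr_ge0// mulr_ge0// mulr_ge0 ?powR_ge0.
  have Rge0 (u eta : X) : (0 < rho u)%R -> (0 < rho eta)%R -> (0 <= Re (K z w u eta * f u eta)%R)%R.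
    by move=> u0 eta0; apply: le_trans (point u eta u0 eta0).1; exact: phr.
  have -> : intTB2 (fun u eta : X => (Num.max (- Re (K z w u eta * f u eta)%R) 0)%:E) = 0.
    apply/eqP; rewrite eq_le; apply/andP; split; last first.
      by apply: intTB2_ge0 => u eta _ _; rewrite lee_fin le_max lexx orbT.
    rewrite (_ : 0 = intTB2 (fun u eta : X => (0 * (rho u `^ b1 * rho eta `^ b2) * (phi1 u * phi2 eta))%:E)).
      apply: le_intTB2 => u eta u0 eta0; rewrite lee_fin; first by rewrite le_max lexx orbT.
      by rewrite !mul0r ge_max lexx oppr_le0 Rge0.
    by rewrite (intTB2_test b1 b2 e1 e2 (lexx 0%R) s10 i10 i11 s20 i20 i21) !mul0r.
  have Alow : (kl * I1 * I2)%:E <= intTB2 (fun u eta : X => (Num.max (Re (K z w u eta * f u eta)%R) 0)%:E).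
    rewrite -(intTB2_test b1 b2 e1 e2 kl0 s10 i10 i11 s20 i20 i21).
    apply: le_intTB2 => u eta u0 eta0; rewrite lee_fin; first exact: phr.
    by rewrite le_max (point u eta u0 eta0).1.
  (* [fine] sends +oo to 0, which would destroy the lower bound; the upper bound rules out an
     infinite integral. *)
  have Ahigh : intTB2 (fun u eta : X => (Num.max (Re (K z w u eta * f u eta)%R) 0)%:E) <= (kh * I1 * I2)%:E.
    rewrite -(intTB2_test b1 b2 e1 e2 kh0 s10 i10 i11 s20 i20 i21).
    apply: le_intTB2 => u eta u0 eta0; rewrite lee_fin.
      by rewrite le_max lexx orbT.
    by rewrite ge_max (point u eta u0 eta0).2 phr.
  rewrite subr0 -lee_fin fineK// ge0_fin_numE.
    by apply: le_lt_trans Ahigh _; rewrite ltry.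
  by apply: le_trans Alow; rewrite lee_fin.
have : (kl * I1 * I2 * in_size q1 be1 s1 j1 j1' a1 * in_size q2 be2 s2 j2 j2' a2)%:E <=
    C%:E * (in_size p1 al1 s1 i1 i1' e1 * in_size p2 al2 s2 i2 i2' e2)%:E.
  rewrite -mixf; apply: le_trans bound.
  rewrite -(mixint_test be1 be2 a1 a2 q10 q20 kI0 s10 j10 j11 s20 j20 j21).
  apply: le_poweR; first by rewrite invr_ge0 ltW.
    by apply: intTB_ge0 => w _; exact: poweR_ge0.
  apply: le_intTB => w _; first exact: poweR_ge0.
  apply: le_poweR; first by rewrite divr_ge0// ltW.
    by apply: intTB_ge0 => z _; rewrite lee_fin powR_ge0.
  apply: le_intTB => z _; first by rewrite lee_fin powR_ge0.
  rewrite lee_fin ge0_ler_powR ?nnegrE ?cmod_ge0 ?(ltW q10)//.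
  by rewrite mulr_ge0 ?test_ge0// mulr_ge0 ?test_ge0.
rewrite -EFinM lee_fin => le.
have lolo : (0 < lo c1 * lo c2)%R by rewrite mulr_gt0.
have -> : (out_size a1 b1 c1 q1 be1 s1 i1 i1' j1 j1' e1 *
    out_size a2 b2 c2 q2 be2 s2 i2 i2' j2 j2' e2 =
  2 / (lo c1 * lo c2) *
  (kl * I1 * I2 * in_size q1 be1 s1 j1 j1' a1 * in_size q2 be2 s2 j2 j2' a2))%R.
  rewrite /kl /out_size /in_size -/S1 -/S2 -/I1 -/I2.
  by field; rewrite !gt_eqF.
rewrite (mulrC C) -[leRHS]mulrA; apply: ler_wpM2l => //.
by rewrite divr_ge0// ltW.
Qed.

End test_inequality.

(** * Extraction of the three conditions *)

Section necessity.
Context {R : realType}.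
Variable n : nat.

Lemma vol_sqr (s : R) : 0 < s -> vol n s = vol n 1 * (s ^+ 2) `^ n.+1%:R.
Proof.
move=> s0; rewrite powR_mulrn ?exprn_ge0 ?(ltW s0)// /vol expr1n !mulr1.
have -> : (s ^+ 2) ^+ n.+1 = s ^+ n * s ^+ n * s ^+ 2 by rewrite exprSr -exprM mul2n -addnn exprD.
by rewrite !exprMn; ring.
Qed.

Lemma powR_bounded_eq0 (nu C : R) : (forall t, 0 < t -> t `^ nu <= C) -> nu = 0.
Proof.
move=> h; apply/eqP; apply/negPn/negP => nu0.
have C0 : 0 < C + 1.
  have := h 1 ltr01; rewrite powR1 => C1.
  by rewrite (lt_le_trans ltr01)// (le_trans C1)// lerDl ler01.
(* At this point the power equals C + 1, whatever the sign of nu. *)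
have := h ((C + 1) `^ nu^-1) (powR_gt0 _ C0).
rewrite -powRrM mulVf// powRr1 ?(ltW C0)//.
by rewrite gerDl ler10.
Qed.

Variables (p q a b c al be M C : R).
Hypotheses (p1 : 1 < p) (q0 : 0 < q) (M1 : 1 <= M).
(* The inequality of [bounded_op_test] with the other variable fixed. *)
Hypothesis H : forall s i i' j j' e, admissible M s i i' j j' ->
  out_size n a b c q be s i i' j j' e <= C * in_size n p al s i i' e.

Let p0 : 0 < p. Proof. exact: lt_trans p1. Qed.
Let M0 : 0 < M. Proof. exact: lt_le_trans M1. Qed.
Let MM : M < 2 * M. Proof. by rewrite ltr_pMl// ltr1n. Qed.
Let v0 : 0 < vol n (1 : R). Proof. exact: vol_gt0. Qed.

Lemma integrability_out : - (q * a) < be + 1.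
Proof.
rewrite ltNge; apply/negP => hab.
(* If be + a q <= -1, the integral over rho(z) in [exp(-y), 1] is at least y. *)
pose K0 := vol n 1 * pint (b + 0) M (2 * M).
pose K1 := C * in_size n p al 1 M (2 * M) 0.
have K00 : 0 < K0 by rewrite mulr_gt0// pint_gt0.
have main y : 0 < y -> K0 * (vol n 1 * y) `^ q^-1 <= K1.
  move=> y0.
  have e0 : 0 < expR (- y) by exact: expR_gt0.
  have e1 : expR (- y) < 1 by rewrite -expR0 ltr_expR oppr_lt0.
  have ad : admissible M 1 M (2 * M) (expR (- y)) 1.
    rewrite /admissible !expr1n !mulr1 ltr01 M0 MM e0 e1 lexx.
    split => //; last by left.
    by split => //; apply: (le_trans M1); exact: ltW.
  apply: le_trans (@H _ _ _ _ _ 0 ad).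
  rewrite /out_size expr1n powR1 mul1r ler_pM2l//.
  rewrite ge0_ler_powR ?invr_ge0 ?(ltW q0)// ?nnegrE ?mulr_ge0 ?(ltW v0) ?(ltW y0) ?(ltW (pint_gt0 _ _ _))//.
  rewrite ler_pM2l//.
  have yE : y = pint (-1) (expR (- y)) 1 by rewrite pintN1 ln1 expRK sub0r opprK.
  rewrite {1}yE; apply: le_pint e0 e1 (lexx _) _.
  move: hab; rewrite -subr_ge0 => hab; rewrite -subr_ge0; move: hab.
  by have -> : - (q * a) - (be + 1) = -1 - (be + a * q) by ring.
(* The value y = x^q / vol turns [main] into K0 x <= K1, which fails since x exceeds K1 / K0. *)
pose x := `|K1 / K0| + 1.
have x0 : 0 < x by rewrite ltr_wpDl.
have := main (x `^ q / vol n 1) _; rewrite divr_gt0 ?powR_gt0// => /(_ isT).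
rewrite [vol n 1 * _]mulrC divfK ?gt_eqF// -powRrM mulfV ?gt_eqF// powRr1 ?(ltW x0)//.
rewrite mulrC -ler_pdivlMr// => h.
have := le_trans h (ler_norm _); rewrite /x.
by rewrite gerDl ler10.
Qed.

Lemma integrability_in : al + 1 < p * (b + 1).
Proof.
rewrite ltNge; apply/negP => hab.
(* Testing with rho^e, the right side grows like y^(1/p), the left side at least
   like y, for rho(u) cut off to [exp(-y), 1]. *)
pose e := - (al + 1) / p.
pose K0 := (vol n 1 * pint (be + a * q) M (2 * M)) `^ q^-1.
have K00 : 0 < K0 by rewrite powR_gt0// mulr_gt0// pint_gt0.
(* The exponent e makes the input integral exactly logarithmic. Failure of the condition means b + e
   <= -1, so the integral on the output side is at least as large. *)
have ep : al + e * p = -1 by rewrite /e divfK ?gt_eqF//; ring.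
have be1 : b + e <= -1.
  by rewrite /e mulNr lerBlDr -lerBlDl opprK ler_pdivlMr// mulrC.
have main x : 0 < x -> x * K0 <= C * x `^ p^-1.
  move=> x0; pose y := x / vol n 1.
  have y0 : 0 < y by rewrite divr_gt0.
  have xE : x = vol n 1 * y by rewrite /y mulrC divfK ?gt_eqF.
  have e0 : 0 < expR (- y) by exact: expR_gt0.
  have e1 : expR (- y) < 1 by rewrite -expR0 ltr_expR oppr_lt0.
  have yE : y = pint (-1) (expR (- y)) 1 by rewrite pintN1 ln1 expRK sub0r opprK.
  have ad : admissible M 1 (expR (- y)) 1 M (2 * M).
    rewrite /admissible !expr1n !mulr1 ltr01 M0 MM e0 e1 lexx.
    split => //; last by right.
    by split => //; apply: (le_trans M1); exact: ltW.
  have -> : x `^ p^-1 = in_size n p al 1 (expR (- y)) 1 e.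
    by rewrite /in_size ep -yE -xE.
  apply: le_trans (@H _ _ _ _ _ e ad).
  rewrite /out_size expr1n powR1 mul1r -/K0 ler_pM2r// {1}xE ler_pM2l// {1}yE.
  exact: le_pint.
(* Since p > 1, the power x^th is unbounded, whereas [main] bounds it by C / K0. *)
pose th := 1 - p^-1.
have th0 : 0 < th by rewrite subr_gt0 invf_lt1.
pose y := `|C / K0| + 1.
have y0 : 0 < y by rewrite ltr_wpDl.
have x0 : 0 < y `^ th^-1 by rewrite powR_gt0.
have := main _ x0.
have E : y `^ th^-1 = (y `^ th^-1) `^ p^-1 * y.
  rewrite -powRrM -[X in _ = _ * X](powRr1 (ltW y0)) -powRD ?(gt_eqF y0) ?implybT//.
  congr (_ `^ _); rewrite /th; field.
  by rewrite !gt_eqF// subr_gt0.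
rewrite {1}E -mulrA [leRHS]mulrC ler_pM2l ?powR_gt0// -ler_pdivlMr//.
move=> h; have := le_trans h (ler_norm _); rewrite /y.
by rewrite gerDl ler10.
Qed.

Lemma homogeneity : c = n.+1%:R + 1 + a + b + ((n.+1%:R + 1 + be) / q - (n.+1%:R + 1 + al) / p).
Proof.
pose N : R := n.+1%:R.
(* The exponent of t = s^2 in the ratio of the two sides when all intervals scale with t: -c from
   the kernel, N + b + 1 from the integral of the test function, then the output norm and the input
   norm. Each volume contributes N. *)
pose nu := - c + N + (b + 1) + (N + (be + a * q + 1)) / q - (N + (al + 1)) / p.
suff nu0 : nu = 0.
  have -> : c = nu + c by rewrite nu0 add0r.
  rewrite /nu -/N; field.
  by rewrite !gt_eqF.
have hM : 0 < (2^-1 : R) < 1 by rewrite invr_gt0 ltr0n invf_lt1// ltr1n.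
pose V := vol n (1 : R).
pose K1 := V * pint (b + 0) 2^-1 1 * (V * pint (be + a * q) M (2 * M)) `^ q^-1.
pose K2 := (V * pint (al + 0 * p) 2^-1 1) `^ p^-1.
have [h0 h1] := andP hM.
have K10 : 0 < K1 by rewrite mulr_gt0 ?powR_gt0 ?mulr_gt0// ?pint_gt0.
apply: (@powR_bounded_eq0 _ (C * K2 / K1)) => t t0.
have t0' : 0 <= t by exact: ltW.
pose s := Num.sqrt t.
have s0 : 0 < s by rewrite sqrtr_gt0.
have sE : s ^+ 2 = t by rewrite sqr_sqrtr.
have ad : admissible M s (t * 2^-1) (t * 1) (t * M) (t * (2 * M)).
  rewrite /admissible sE s0 !mulr_gt0// !ltr_pM2l// h1 MM.
  split => //; last by right; rewrite mulrC.
  split => //; last by rewrite mulrC.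
  by rewrite mulrC ler_pM2r//; apply: (le_trans M1); exact: ltW.
have := @H _ _ _ _ _ 0 ad.
rewrite /out_size /in_size sE !pintZ// vol_sqr// sE -/V -/N.
have vp e x : V * t `^ N * (t `^ (e + 1) * x) = t `^ (N + (e + 1)) * (V * x).
  by rewrite [in RHS]powRD ?(gt_eqF t0) ?implybT//; ring.
rewrite !vp.
have pg (r e x : R) : 0 < x -> (t `^ e * x) `^ r = t `^ (e * r) * x `^ r.
  by move=> x0; rewrite powRM ?powR_ge0 ?(ltW x0)// -powRrM.
rewrite !pg ?mulr_gt0// ?pint_gt0// -/K2 => le.
rewrite ler_pdivlMr//.
have tp : 0 < t `^ ((N + (al + 0 * p + 1)) * p^-1) by rewrite powR_gt0.
rewrite -(ler_pM2r tp).
have -> : t `^ nu * K1 * t `^ ((N + (al + 0 * p + 1)) * p^-1) =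
  t `^ (- c) * (t `^ (N + (b + 0 + 1)) * (V * pint (b + 0) 2^-1 1)) *
    (t `^ ((N + (be + a * q + 1)) * q^-1) * (V * pint (be + a * q) M (2 * M)) `^ q^-1).
  have -> : t `^ nu * K1 * t `^ ((N + (al + 0 * p + 1)) * p^-1) =
     t `^ nu * t `^ ((N + (al + 0 * p + 1)) * p^-1) * K1 by ring.
  transitivity (t `^ (- c) * t `^ (N + (b + 0 + 1)) * t `^ ((N + (be + a * q + 1)) * q^-1) * K1).
    rewrite -!powRD ?(gt_eqF t0) ?implybT//; congr (_ `^ _ * _).
    by rewrite /nu mul0r !addr0; ring.
  by rewrite /K1; ring.
by apply: (le_trans le); rewrite le_eqVlt; apply/orP; left; apply/eqP; ring.
Qed.

Lemma cond3_of_test : cond3 n.+1 p q a b c al be.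
Proof. by split; [exact: integrability_out|split; [exact: integrability_in|exact: homogeneity]]. Qed.

End necessity.

(** * Separation of the two variables *)

Section equivalence.
Context {R : realType}.
Variables (n : nat) (p1 p2 q1 q2 a1 a2 b1 b2 c1 c2 al1 al2 be1 be2 : R).
Hypotheses (p11 : 1 < p1) (p21 : 1 < p2) (pq1 : p1 <= q1) (pq2 : p2 <= q2).
Variable K : pt R n.+1 -> pt R n.+1 -> pt R n.+1 -> pt R n.+1 -> R[i].
Hypotheses (HK : dominated_kernel b1 b2 c1 c2 K) (SK : sectorial K).

Lemma out_size_gt0 (a b c q be s i i' j j' e : R) : 0 < s -> 0 < i -> i < i' ->
  0 < j -> j < j' -> 0 < out_size n a b c q be s i i' j j' e.
Proof.
move=> s0 i0 ii j0 jj.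
have v0 := vol_gt0 n s0.
by repeat (apply: mulr_gt0 || apply: powR_gt0 || apply: pint_gt0 || apply: exprn_gt0) => //.
Qed.

(** For necessity, one fixed admissible box in one variable turns the product inequality into an
    inequality in the other: the fixed [out_size] is positive and is divided out, and the fixed
    [in_size] joins the constant. *)
Theorem bounded_op_iff_cond3 : bounded_op a1 a2 K p1 p2 al1 al2 q1 q2 be1 be2 <->
  cond3 n.+1 p1 q1 a1 b1 c1 al1 be1 /\ cond3 n.+1 p2 q2 a2 b2 c2 al2 be2.
Proof.
have p10 : 0 < p1 by exact: lt_trans p11.
have p20 : 0 < p2 by exact: lt_trans p21.
have q10 : 0 < q1 by exact: lt_le_trans pq1.
have q20 : 0 < q2 by exact: lt_le_trans pq2.
split=> [BK|[h1 h2]]; last exact: (bounded_op_of_cond3 HK p11 p21 pq1 pq2 h1 h2).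
have [M [C [M1 hC]]] := bounded_op_test p10 p20 q10 q20 HK SK BK.
have M0 : 0 < M by exact: lt_le_trans M1.
have h0 : 0 < (2^-1 : R) by rewrite invr_gt0.
have h1 : (2^-1 : R) < 1 by rewrite invf_lt1// ltr1n.
have MM : M < 2 * M by rewrite ltr_pMl// ltr1n.
have adm : admissible M 1 2^-1 1 M (2 * M).
  rewrite /admissible !expr1n !mulr1 ltr01 h0 h1 M0 MM lexx; split => //; last by right.
  by split => //; apply: (le_trans M1); exact: ltW.
pose O1 := out_size n a1 b1 c1 q1 be1 1 2^-1 1 M (2 * M) 0.
pose O2 := out_size n a2 b2 c2 q2 be2 1 2^-1 1 M (2 * M) 0.
have O10 : 0 < O1 by exact: out_size_gt0.
have O20 : 0 < O2 by exact: out_size_gt0.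
split.
- apply: (@cond3_of_test R n p1 q1 a1 b1 c1 al1 be1 M
    (C * in_size n p2 al2 1 2^-1 1 0 / O2)) => // s i i' j j' e ad.
  have := hC _ _ _ _ _ e _ _ _ _ _ 0 ad adm; rewrite -/O2 => le.
  rewrite mulrAC ler_pdivlMr//; apply: (le_trans le).
  by rewrite le_eqVlt; apply/orP; left; apply/eqP; ring.
- apply: (@cond3_of_test R n p2 q2 a2 b2 c2 al2 be2 M
    (C * in_size n p1 al1 1 2^-1 1 0 / O1)) => // s i i' j j' e ad.
  have := hC _ _ _ _ _ 0 _ _ _ _ _ e adm ad; rewrite -/O1 => le.
  rewrite mulrAC ler_pdivlMr// [leLHS]mulrC; apply: (le_trans le).
  by rewrite mulrA.
Qed.

End equivalence.

Theorem theorem6p1 (R : realType) (n : nat) (hn : (0 < n)%N)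
  (p1 p2 q1 q2 a1 a2 b1 b2 c1 c2 al1 al2 be1 be2 : R)
  (hp : 1 < Num.min p1 p2)
  (hpq : Num.max p1 p2 <= Num.min q1 q2)
  (hal1 : -1 < al1) (hal2 : -1 < al2) (hbe1 : -1 < be1) (hbe2 : -1 < be2) :
  [/\ (bounded_op a1 a2 (@kerS R n b1 b2 c1 c2) p1 p2 al1 al2 q1 q2 be1 be2 <->
       bounded_op a1 a2 (@kerT R n b1 b2 c1 c2) p1 p2 al1 al2 q1 q2 be1 be2),
      (bounded_op a1 a2 (@kerT R n b1 b2 c1 c2) p1 p2 al1 al2 q1 q2 be1 be2 <->
       (cond3 n p1 q1 a1 b1 c1 al1 be1 /\ cond3 n p2 q2 a2 b2 c2 al2 be2))
    & (cond3 n p1 q1 a1 b1 c1 al1 be1 /\ cond3 n p2 q2 a2 b2 c2 al2 be2 <->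
       bounded_op a1 a2 (@kerS R n b1 b2 c1 c2) p1 p2 al1 al2 q1 q2 be1 be2)].
Proof.
case: n hn => [|n] hn; first by rewrite ltnn in hn.
move: hp; rewrite lt_min => /andP[p11 p21].
move: hpq; rewrite ge_max !le_min => /andP[/andP[pq1 _] /andP[_ pq2]].
have S := bounded_op_iff_cond3 a1 a2 al1 al2 be1 be2 p11 p21 pq1 pq2
  (@dominated_kerS R n b1 b2 c1 c2) (@sectorial_kerS R n b1 b2 c1 c2).
have T := bounded_op_iff_cond3 a1 a2 al1 al2 be1 be2 p11 p21 pq1 pq2
  (@dominated_kerT R n b1 b2 c1 c2) (@sectorial_kerT R n b1 b2 c1 c2).
split; [exact: iff_trans S (iff_sym T)|exact: T|exact: iff_sym S].
Qed.
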